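(* Let $N \ge 5$ be an integer, $p>1$ and $\sigma > -4$. Consider the elliptic problem $$\Delta^2 u - \frac{\mu}{|x|^4} u = |x|^{\sigma} |u|^p + f(x),\quad x \in \Omega_e, \qquad u = \Delta u = 0,\quad x \in \partial B_1. \tag{E}$$ (i) Assume that either $$0 < \mu \le \mu^*\quad\text{and}\quad 1 < p < 1 + \frac{\sigma + 4}{\mu_N},$$ or $$0 < \mu < \mu^*\quad\text{and}\quad p = 1 + \frac{\sigma + 4}{\mu_N}.$$ Then problem (E) admits no weak solution for every positive function $f \in L^1_{\mathrm{loc}}(\overline{\Omega_e})$. (ii) If $0 < \mu \le \mu^*$ and $$p > 1 + \frac{\sigma + 4}{\mu_N},$$ then problem (E) admits smooth solutions $u \in C^\infty(\overline{\Omega_e})$ for some positive function $f$.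
   Context: $B_1$ is the open unit ball of $\mathbb{R}^N$ and $\Omega_e = \mathbb{R}^N \setminus \overline{B_1}$. The source satisfies $f>0$ and $f\in L^1_{\mathrm{loc}}(\overline{\Omega_e})$. The constant $\mu^*$ is $$\mu^* = \left( \frac{N(N-4)}{4} \right)^2,$$ and for $0<\mu\le\mu^*$, $$\mu_N = \frac{N-4}{2} + \sqrt{\left(\frac{N-2}{2}\right)^2 + 1 - \sqrt{(N-2)^2 + \mu}}.$$ A function $u\in L^p_{\mathrm{loc}}(\overline{\Omega_e})$ is a weak solution of (E) if $$\int_{\Omega_e} |x|^{\sigma} |u|^p \psi \, dx + \int_{\Omega_e} f\, \psi \, dx = \int_{\Omega_e} u \left( \Delta^2 \psi - \frac{\mu}{|x|^4} \psi \right) dx$$ for all $\psi\in C_c^4(\overline{\Omega_e})$ (compact support in $\overline{\Omega_e}$, which may touch $\partial B_1$) with $\psi\ge 0$ and $\psi=\Delta\psi=0$ on $\partial B_1$. *)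

(* Defs.v *)
From HB Require Import structures.
From mathcomp Require Import all_boot all_order all_algebra.
From mathcomp Require Import all_classical all_reals all_analysis.

Set Implicit Arguments.
Unset Strict Implicit.
Unset Printing Implicit Defensive.

Import Order.TTheory GRing.Theory Num.Theory.
Import numFieldNormedType.Exports.

Local Open Scope classical_set_scope.
Local Open Scope ring_scope.

(* The measurable structure and the Lebesgue measure on row vectors follow the
   library's sigma-algebra on tuples and its binary product measures. The
   sigma-algebra generated by the coordinates is the Borel sigma-algebra. *)
Section measurable_rV.
Context {R : realType}.
Variable n : nat.

Let coords : 'I_n -> 'rV[R]_n -> measurableTypeR R := fun i x => x ord0 i.

Let rV_set0 : g_sigma_preimage coords set0.
Proof. exact: sigma_algebra0. Qed.

Let rV_setC A : g_sigma_preimage coords A -> g_sigma_preimage coords (~` A).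
Proof. exact: sigma_algebraC. Qed.

Let rV_bigcup (F : _^nat) : (forall i, g_sigma_preimage coords (F i)) ->
  g_sigma_preimage coords (\bigcup_i (F i)).
Proof. exact: sigma_algebra_bigcup. Qed.

HB.instance Definition _ := @isMeasurable.Build
  (measure_tuple_display default_measure_display) 'rV[R]_n
  (g_sigma_preimage coords) rV_set0 rV_setC rV_bigcup.

Lemma measurable_coord (i : 'I_n) :
  measurable_fun setT (fun x : 'rV[R]_n => x ord0 i : measurableTypeR R).
Proof.
move=> _ Y mY; rewrite setTI; apply: sub_sigma_algebra => /=.
rewrite -bigcup_seq/=; exists i => /=; first by rewrite mem_index_enum.
by exists Y => //; rewrite setTI.
Qed.

Lemma measurable_fun_rVP d (T : measurableType d) (f : T -> 'rV[R]_n) :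
  (forall i, measurable_fun setT (fun t => f t ord0 i : measurableTypeR R)) ->
  measurable_fun setT f.
Proof.
move=> mf _ A mA; rewrite setTI; move: A mA.
have sP : sigma_algebra setT [set A : set 'rV[R]_n | measurable (f @^-1` A)].
  split=> /=; first by rewrite preimage_set0.
  - by move=> A mA; rewrite setTD preimage_setC; exact: measurableC.
  - by move=> F mF; rewrite preimage_bigcup; exact: bigcup_measurable.
apply: smallest_sub => //=.
rewrite -bigcup_seq => A [i _ [B mB <-]] /=.
by rewrite setTI; have := mf i measurableT B mB; rewrite setTI.
Qed.

End measurable_rV.

Section lebesgue_step.
Context {R : realType}.
Variables (n : nat) (m : {sigma_finite_measure set 'rV[R]_n -> \bar R}).
Local Open Scope ereal_scope.

Definition rV_cons (t : measurableTypeR R * 'rV[R]_n) : 'rV[R]_n.+1 :=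
  row_mx (\row_(_ < 1) t.1) t.2.

Definition rV_uncons (x : 'rV[R]_n.+1) : measurableTypeR R * 'rV[R]_n :=
  (x ord0 ord0, \row_i x ord0 (lift ord0 i)).

Lemma rV_consK : cancel rV_cons rV_uncons.
Proof.
move=> [a v]; congr pair.
  by rewrite /rV_cons mxE split1 unlift_none /= mxE.
by apply/rowP => i; rewrite !mxE split1 liftK.
Qed.

Lemma measurable_rV_cons : measurable_fun setT rV_cons.
Proof.
apply: measurable_fun_rVP => i.
case: (unliftP ord0 i) => [j ->|->].
  rewrite (_ : (fun t => _) = (fun v : 'rV[R]_n => v ord0 j : measurableTypeR R) \o snd).
    by apply: measurableT_comp => //; exact: measurable_coord.
  by apply/funext => t /=; rewrite /rV_cons mxE split1 liftK.
rewrite (_ : (fun t => _) = fst)//.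
by apply/funext => t /=; rewrite /rV_cons mxE split1 unlift_none /= mxE.
Qed.

Lemma measurable_rV_uncons : measurable_fun setT rV_uncons.
Proof.
apply/measurable_fun_pairP; split; first exact: measurable_coord.
apply: measurable_fun_rVP => i.
rewrite (_ : (fun t => _) =
  fun x : 'rV[R]_n.+1 => x ord0 (lift ord0 i) : measurableTypeR R).
  exact: measurable_coord.
by apply/funext => x /=; rewrite mxE.
Qed.

Definition lebesgue_succ : set 'rV[R]_n.+1 -> \bar R :=
  pushforward (@lebesgue_measure R \x m) rV_cons.

Let measurable_preimage A : measurable A -> measurable (rV_cons @^-1` A).
Proof. by move=> /(measurable_rV_cons measurableT); rewrite setTI. Qed.

Let lebesgue_succ0 : lebesgue_succ set0 = 0.
Proof. by rewrite /lebesgue_succ /pushforward preimage_set0 measure0. Qed.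

Let lebesgue_succ_ge0 A : 0 <= lebesgue_succ A.
Proof. by rewrite /lebesgue_succ /pushforward measure_ge0. Qed.

Let lebesgue_succ_sigma_additive : semi_sigma_additive lebesgue_succ.
Proof.
move=> F mF tF mUF; rewrite /lebesgue_succ /pushforward preimage_bigcup.
apply: measure_semi_sigma_additive.
- by move=> k; exact: measurable_preimage.
- apply/trivIsetP => /= i j _ _ ij; rewrite -preimage_setI.
  by move/trivIsetP : tF => /(_ _ _ _ _ ij) ->//; rewrite preimage_set0.
- by rewrite -preimage_bigcup; exact: measurable_preimage.
Qed.

HB.instance Definition _ := isMeasure.Build _ _ _ lebesgue_succ
  lebesgue_succ0 lebesgue_succ_ge0 lebesgue_succ_sigma_additive.

Let lebesgue_succ_sigma_finite : sigma_finite setT lebesgue_succ.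
Proof.
have /sigma_finiteP[F [TF ndF Foo]] := sigma_finiteT (@lebesgue_measure R).
have /sigma_finiteP[G [TG ndG Goo]] := sigma_finiteT m.
exists (fun k => rV_uncons @^-1` (F k `*` G k)).
  rewrite -preimage_bigcup (_ : \bigcup_k _ = setT) ?preimage_setT//.
  rewrite -subTset => -[x y] _ /=.
  have [i _ Fix] : (\bigcup_k F k) x by rewrite -TF.
  have [j _ Gjy] : (\bigcup_k G k) y by rewrite -TG.
  exists (maxn i j) => //; split.
    by move: x Fix; exact/subsetPset/ndF/leq_maxl.
  by move: y Gjy; exact/subsetPset/ndG/leq_maxr.
move=> k; have [mF Fk] := Foo k; have [mG Gk] := Goo k; split.
  by rewrite -[_ @^-1` _]setTI; apply: measurable_rV_uncons => //; exact: measurableX.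
rewrite /lebesgue_succ /pushforward -comp_preimage.
rewrite (_ : rV_uncons \o rV_cons = id) ?preimage_id; last first.
  by apply/funext => t; exact: rV_consK.
by rewrite product_measure1E// lte_mul_pinfty// ge0_fin_numE.
Qed.

HB.instance Definition _ := Measure_isSigmaFinite.Build _ _ _ lebesgue_succ
  lebesgue_succ_sigma_finite.

End lebesgue_step.

Fixpoint lebesgue_rV {R : realType} n :
    {sigma_finite_measure set 'rV[R]_n -> \bar R} :=
  match n with
  | 0 => @dirac _ 'rV[R]_0 0 R
  | n'.+1 => lebesgue_succ (lebesgue_rV n')
  end.

Lemma lebesgue_rV_box {R : realType} n (A : 'I_n -> set (measurableTypeR R)) :
  (forall i, measurable (A i)) ->
  lebesgue_rV n [set x | forall i, A i (x ord0 i)] =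
  (\prod_(i < n) lebesgue_measure (A i))%E.
Proof.
elim: n A => [|n IH] A mA.
  have A0 : [set x : 'rV[R]_0 | forall i, A i (x ord0 i)] 0 by case.
  by rewrite big_ord0 /= diracE mem_set.
pose B := [set x : 'rV[R]_n | forall i, A (lift ord0 i) (x ord0 i)].
have mB : measurable B.
  rewrite (_ : B = \bigcap_(i in [set: 'I_n])
      (fun x : 'rV[R]_n => x ord0 i : measurableTypeR R) @^-1` A (lift ord0 i)).
    apply: fin_bigcap_measurable => // i _.
    by rewrite -[_ @^-1` _]setTI; exact: measurable_coord.
  by apply/seteqP; split=> [x Bx i _|x Bx i]; exact: Bx.
rewrite big_ord_recl -IH// -product_measure1E//=.
rewrite /lebesgue_succ /pushforward; congr (_ _).
apply/seteqP; split=> -[a v] /=.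
  move=> Aav; split=> [|i] /=.
    by have := Aav ord0; rewrite /rV_cons mxE split1 unlift_none /= mxE.
  by have := Aav (lift ord0 i); rewrite /rV_cons mxE split1 liftK.
move=> [Aa Bv] i; case: (unliftP ord0 i) => [j ->|->]; rewrite /rV_cons mxE split1.
  by rewrite liftK; exact: Bv.
by rewrite unlift_none /= mxE.
Qed.

Section exterior_problem.
Context {R : realType} {N : nat}.
Implicit Types (x y : 'rV[R]_N) (g f u psi : 'rV[R]_N -> R).

(* The library's norm `|x| on row vectors is the maximum norm. *)
Definition enorm x : R := Num.sqrt (\sum_(i < N) x ord0 i ^+ 2).

Definition unit_ball : set 'rV[R]_N := [set x | enorm x < 1].
Definition unit_sphere : set 'rV[R]_N := [set x | enorm x = 1].
Definition Omega_e : set 'rV[R]_N := ~` closure unit_ball.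

Definition unit_vec (i : 'I_N) : 'rV[R]_N := delta_mx ord0 i.

Definition partial (i : 'I_N) g : 'rV[R]_N -> R := fun x => 'D_(unit_vec i) g x.

Definition iter_partial (s : seq 'I_N) g : 'rV[R]_N -> R := foldr partial g s.

Definition laplacian g : 'rV[R]_N -> R := fun x =>
  \sum_(i < N) partial i (partial i g) x.

Definition bilaplacian g : 'rV[R]_N -> R := laplacian (laplacian g).

(* C^k(closure Omega_e): all partial derivatives up to order k exist in the open
   set Omega_e and extend continuously to its closure. *)
Definition Ck_closure (k : nat) g : Prop :=
  [/\ {within closure Omega_e, continuous g},
      forall (s : seq 'I_N) (i : 'I_N) x, (size s < k)%N -> Omega_e x ->
        derivable (iter_partial s g) x (unit_vec i)
    & forall s : seq 'I_N, (size s <= k)%N -> exists h : 'rV[R]_N -> R,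
        {within closure Omega_e, continuous h} /\
        forall x, Omega_e x -> h x = iter_partial s g x].

Definition Cinf_closure g : Prop := forall k, Ck_closure k g.

(* Boundary values are limits from inside Omega_e: the derivatives of a function
   in C^k(closure Omega_e), taken in R^N, are meaningless on the sphere, and
   their boundary values are those of the continuous extensions. *)
Definition zero_on_sphere g : Prop := forall y, unit_sphere y ->
  g x @[x --> within Omega_e (nbhs y)] --> (0 : R).

Definition Lp_loc (q : R) g : Prop :=
  measurable_fun (closure Omega_e) g /\
  forall K : set 'rV[R]_N, compact K -> K `<=` closure Omega_e ->
    (lebesgue_rV N).-integrable K (fun x => (`|g x| `^ q)%:E).

Definition positive_on_Omega_e f : Prop := forall x, Omega_e x -> 0 < f x.

Definition test_function psi : Prop :=
  [/\ Ck_closure 4 psi,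
      compact (closure [set x | closure Omega_e x /\ psi x != 0]),
      forall x, closure Omega_e x -> 0 <= psi x,
      zero_on_sphere psi
    & zero_on_sphere (laplacian psi)].

Definition weak_solution (mu p sigma : R) f u : Prop :=
  Lp_loc p u /\
  forall psi, test_function psi ->
    (\int[lebesgue_rV N]_(x in Omega_e)
        (enorm x `^ sigma * `|u x| `^ p * psi x)%:E
     + \int[lebesgue_rV N]_(x in Omega_e) (f x * psi x)%:E
     = \int[lebesgue_rV N]_(x in Omega_e)
        (u x * (bilaplacian psi x - mu / enorm x ^+ 4 * psi x))%:E)%E.

Definition classical_solution (mu p sigma : R) f u : Prop :=
  [/\ forall x, Omega_e x ->
        bilaplacian u x - mu / enorm x ^+ 4 * u x =
        enorm x `^ sigma * `|u x| `^ p + f x,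
      zero_on_sphere u
    & zero_on_sphere (laplacian u)].

End exterior_problem.

Definition mu_star {R : realType} (N : nat) : R :=
  (N%:R * (N%:R - 4) / 4) ^+ 2.

Definition mu_N {R : realType} (N : nat) (mu : R) : R :=
  (N%:R - 4) / 2 +
  Num.sqrt (((N%:R - 2) / 2) ^+ 2 + 1 - Num.sqrt ((N%:R - 2) ^+ 2 + mu)).

(* Main.v *)
(* Write [a = (N - 4) / 2]. On radial functions [r ^ (s - a)] the operator
   [Delta^2 - mu / r^4] is multiplication by [(s^2 - t^2) (s^2 - T^2) r^-4], where
   [0 <= t < a], [a + 2 < T] and [mu_N = a + t].

   Nonexistence: let [H] be the radial solution of the homogeneous equation with
   [H = Delta H = 0] on the sphere and growth [r ^ (t - a)] (times [ln r] if [t = 0]).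
   Test the equation against [H] times a cutoff in the variable [ln r / L]. Only the
   terms where the cutoff is differentiated survive, each carrying a factor [1 / L];
   absorbing [u] into the nonlinear term leaves
     [\int f psi_L <= C L ^ (- p / (p - 1)) \int_(1 < r < e^L) r ^ -N = O (L ^ (- 1 / (p - 1)))],
   which tends to 0 although the left-hand side increases with [L]. Because the cutoff is
   logarithmic, the critical exponent is covered when [t > 0].

   Existence: take [u = eps (- r ^ (- a - d) + A r ^ (- a - t) + B r ^ (- a - T))] with
   [t < d < T] close to [t]; [A] and [B] are fixed by the boundary conditions. Then
   [Delta^2 u - mu u / r^4] is a positive multiple of [eps r ^ (- 4 - a - d)] and
   dominates [r ^ sigma |u| ^ p] for small [eps]; [f] is the difference. The weak
   formulation follows from Green's formula, used twice; its boundary terms are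
   controlled by a radial cutoff because both functions vanish on the sphere. *)

Require Import Defs.
From mathcomp Require Import all_boot all_order all_algebra.
From mathcomp Require Import all_classical all_reals all_analysis.
From mathcomp Require Import measurable_realfun.
From mathcomp Require Import ring lra.

Set Implicit Arguments.
Unset Strict Implicit.
Unset Printing Implicit Defensive.

Import Order.TTheory GRing.Theory Num.Theory.
Import numFieldNormedType.Exports.

Local Open Scope classical_set_scope.
Local Open Scope ring_scope.

(** * Topology and measurability of row vectors *)

(** In [y = ln |x|] the operator is [e^(-4 y)] times one with constant coefficients, so every radial
    profile below is a sum of exponentials in [y]. The difficulty sits on the sphere, in two places.

    Green's formula: a test function is controlled only from inside [Omega_e]. The radial factor [v]
    is therefore made to vanish for [y <= e], which changes the integrand on a layer of volume
    [O(e)]. Since [v 0 = 0], the second derivative of the modified factor is [O(1 / e)] instead of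
    [O(1 / e^2)], and the error tends to 0 with [e].

    Young's inequality: its remainder contains a negative power of the test function. [H] vanishes
    linearly on the sphere, so the error made by the cutoff has to vanish there too. A cutoff built
    on [1 - (y / L)^5] achieves this: its first four derivatives all keep a factor [y / L]. A high
    power of this base does the same at [y = L].

    Exponents: [H] is bounded by [r ^ (t + e - a)] with [e >= 0] chosen to make the remainder
    exactly [r ^ -N]. The logarithm at [t = 0] is absorbed as soon as [t + e > 0], which fails only
    for critical [p] together with [mu = mu^*]. *)

Section rV_topology.
Context {R : realType} {n : nat}.
Implicit Types (x y : 'rV[R]_n) (A B K U : set 'rV[R]_n).

Lemma ball_rVE x (e : R) : 0 < e ->
  ball x e = [set y | forall i, `|x ord0 i - y ord0 i| < e].
Proof.
move=> e0; apply/seteqP; split=> y /=.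
  by move=> [_ xy] i; have := xy ord0 i.
by move=> xy; split=> // i j; rewrite (ord1 i); exact: xy.
Qed.

Lemma measurable_rV_coords (P : 'I_n -> set (measurableTypeR R)) :
  (forall i, measurable (P i)) ->
  measurable [set x : 'rV[R]_n | forall i, P i (x ord0 i)].
Proof.
move=> mP.
rewrite (_ : mkset _ = \bigcap_(i in [set: 'I_n])
    ((fun x : 'rV[R]_n => x ord0 i : measurableTypeR R) @^-1` P i)).
  apply: fin_bigcap_measurable => // i _.
  by rewrite -[_ @^-1` _]setTI; exact: measurable_coord.
by apply/seteqP; split=> [x Bx i _|x Bx i]; exact: Bx.
Qed.

Lemma measurable_ball_rV x (e : R) : measurable (ball x e).
Proof.
have [e0|e0] := ltP 0 e; last first.
  rewrite (_ : ball x e = set0)//; apply/seteqP; split=> y //= [].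
  by rewrite ltNge e0.
rewrite ball_rVE//.
apply: (measurable_rV_coords (P := fun i => ball (x ord0 i) e)) => i.
by apply: open_measurable; exact: ball_open.
Qed.

(* An open set is a countable union of balls with rational centers. *)
Lemma open_measurable_rV U : open U -> measurable U.
Proof.
move=> oU.
pose r (k : nat) : R := k.+1%:R^-1.
pose c (q : {ffun 'I_n -> rat}) : 'rV[R]_n := \row_i ratr (q i).
pose F (t : {ffun 'I_n -> rat} * nat) :=
  if `[< ball (c t.1) (r t.2) `<=` U >] then ball (c t.1) (r t.2) else set0.
rewrite (_ : U = \bigcup_t F t).
  apply: countable_bigcupT_measurable => // t.
  by rewrite /F; case: ifPn => // _; exact: measurable_ball_rV.
apply/seteqP; split=> [x Ux|x [t _]]; last first.
  by rewrite /F; case: ifPn => // /asboolP; apply.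
have /nbhs_ballP[e /= e0 xeU] := open_nbhs_nbhs (conj oU Ux).
(* The factor 2 leaves room for the triangle inequality: a ball of radius [r k] whose centre is
   within [r k] of [x] lies in [ball x e]. *)
pose k := Num.bound (2 / e).
have r0 : 0 < r k by rewrite invr_gt0.
have re : r k + r k <= e.
  have : 2 / e < k.+1%:R.
    have := archi_boundP (ltW (divr_gt0 (ltr0n R 2) e0)).
    by move=> /lt_le_trans; apply; rewrite ler_nat leqnSn.
  rewrite ltr_pdivrMr// => h; rewrite -mulr2n -[_ *+ _]mulr_natl.
  by rewrite ler_pdivrMr// mulrC ltW// mulrC.
have qP i : exists q : rat, `|x ord0 i - ratr q| < r k.
  have [q] : exists q : rat, ratr q \in `](x ord0 i - r k), (x ord0 i + r k)[.
    by apply: rat_in_itvoo; rewrite ltrBlDr -addrA ltrDl addr_gt0.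
  by rewrite in_itv/= => /andP[q1 q2]; exists q; rewrite ltr_norml; apply/andP;
     split; lra.
have [q xq] := choice qP.
exists ([ffun i => q i], k) => //; rewrite /F/=.
have xB : ball (c [ffun i => q i]) (r k) x.
  by rewrite ball_rVE// => i /=; rewrite mxE ffunE distrC.
case: ifPn => // /asboolP nU; exfalso; apply: nU => y yB; apply: xeU.
apply: le_ball re _ _; apply: ball_triangle yB.
exact: ball_sym.
Qed.

Lemma closed_measurable_rV U : closed U -> measurable U.
Proof.
by move=> cU; rewrite -[U]setCK; apply: measurableC; apply: open_measurable_rV;
  exact: closed_openC.
Qed.

Lemma continuous_measurable_fun_rV U (f : 'rV[R]_n -> R) : open U ->
  {in U, continuous f} -> measurable_fun U f.
Proof.
move=> oU cf; apply: (measurability _ (RGenOpens.measurableE R)).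
move=> _ [_ [a [b ->] <-]]; apply: open_measurable_rV.
rewrite openE => x [Ux fx].
have /cf/= cfx : x \in U by rewrite inE.
apply: filterI; first exact: open_nbhs_nbhs.
by apply: cfx; apply: open_nbhs_nbhs; split => //; exact: interval_open.
Qed.

Lemma compact_measurable_rV K : compact K -> measurable K.
Proof.
move=> /compact_closed cK; apply: closed_measurable_rV; apply: cK.
exact: norm_hausdorff.
Qed.

Lemma compact_norm_bounded K : compact K -> exists M : R, forall x, K x -> `|x| <= M.
Proof.
by move=> /compact_bounded[M [Mr bM]]; exists (M + 1) => x Kx; apply: bM Kx;
  rewrite ltrDl.
Qed.

Lemma coord_le_norm x i : `|x ord0 i| <= `|x|.
Proof.
rewrite [`|x|]mx_normrE.
by rewrite (le_bigmax_cond _ (fun ij : 'I_1 * 'I_n => `|x ij.1 ij.2|)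
  (j := (ord0, i))).
Qed.

Lemma lebesgue_rV_box_le (M : R) : 0 <= M ->
  lebesgue_rV n [set x | forall i, `|x ord0 i| <= M] = ((2 * M) ^+ n)%:E.
Proof.
move=> M0; rewrite (_ : mkset _ = [set x | forall i, `[- M, M]%classic (x ord0 i)]).
  rewrite (lebesgue_rV_box (A := fun=> `[- M, M]%classic))//.
  under eq_bigr do rewrite lebesgue_measure_itv/= lte_fin.
  (* At [M = 0] the box is a point, of measure 1 in dimension 0 and of measure 0 otherwise, in
     agreement with [0 ^+ n]. *)
  move: M0; rewrite le_eqVlt => /orP[/eqP<-|M0].
    rewrite oppr0 ltxx mulr0.
    case: n => [|k]; first by rewrite big_ord0 expr0.
    by rewrite big_ord_recl mul0e expr0n.
  rewrite (_ : - M < M) ?gtrN// -EFinB prodEFin prodr_const card_ord.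
  by congr (_ ^+ _)%:E; ring.
by apply/seteqP; split=> x xM i; have := xM i; rewrite /= in_itv/= ler_norml.
Qed.

Lemma lebesgue_rV_bounded_lty A (M : R) : measurable A ->
  (forall x, A x -> `|x| <= M) -> (lebesgue_rV n A < +oo)%E.
Proof.
move=> mA AM.
have M0 : 0 <= Num.max M 0 by rewrite le_max lexx orbT.
apply: (@le_lt_trans _ _
    (lebesgue_rV n [set x | forall i, `|x ord0 i| <= Num.max M 0])); last first.
  by rewrite lebesgue_rV_box_le// ltry.
apply: le_measure; rewrite ?inE//.
  apply: (measurable_rV_coords (P := fun i => [set z | `|z| <= Num.max M 0])) => i.
  rewrite (_ : mkset _ = `[- Num.max M 0, Num.max M 0]%classic)//.
  by apply/seteqP; split=> z /=; rewrite in_itv/= ler_norml.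
move=> x /AM xM i; rewrite le_max (le_trans _ xM)//; exact: coord_le_norm.
Qed.

Lemma continuous_integrable_compact U K (f : 'rV[R]_n -> R) :
  open U -> {in U, continuous f} -> compact K -> K `<=` U ->
  (lebesgue_rV n).-integrable K (EFin \o f).
Proof.
move=> oU cf cK KU.
have mK := compact_measurable_rV cK.
have [M KM] := compact_norm_bounded cK.
apply: measurable_bounded_integrable => //.
- exact: lebesgue_rV_bounded_lty KM.
- apply: measurable_funS (continuous_measurable_fun_rV oU cf) => //.
  exact: open_measurable_rV.
have cK' : {within K, continuous f}.
  apply: (@continuous_subspaceW _ _ K U) => //.
  by rewrite continuous_open_subspace.
have := continuous_compact cK' cK.
by move=> /compact_bounded[B [Br bB]]; exists B; split => // y By x Kx; apply: bB By _ _;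
  exists x.
Qed.

End rV_topology.

(** * Radial calculus *)

Section pointwise_derivatives.
Context {R : realType} {V : normedModType R}.
Implicit Types (f g : V -> R) (x v : V).

Lemma is_derive_val f x v (df df' : R) :
  is_derive x v f df -> df = df' -> is_derive x v f df'.
Proof. by move=> ? <-. Qed.

Lemma is_derive_add f g x v (df dg : R) :
  is_derive x v f df -> is_derive x v g dg ->
  is_derive x v (fun y => f y + g y) (df + dg).
Proof. by move=> hf hg; exact: is_deriveD. Qed.

Lemma is_derive_mul f g x v (df dg : R) :
  is_derive x v f df -> is_derive x v g dg ->
  is_derive x v (fun y => f y * g y) (f x * dg + df * g x).
Proof.
move=> hf hg; have := is_deriveM hf hg.
by rewrite /GRing.scale/= [g x * _]mulrC.
Qed.

Lemma derive1P (f : V -> R) x v : 'D_v f x = 'D_1 (fun h : R => f (h *: v + x)) 0.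
Proof.
rewrite /derive; set g1 := fun h => h^-1 *: _; set g2 := fun h => h^-1 *: _.
suff -> : g1 = g2 by [].
by rewrite funeqE /g1 /g2 => h /=; rewrite addr0 scale0r add0r [_%:A]mulr1.
Qed.

(** Restricting to the line through [x] gives a chain rule for directional derivatives that asks for
    no Fréchet differentiability; test functions come with partial derivatives only. *)
Lemma is_derive1P f x v (df : R) :
  is_derive x v f df <-> is_derive (0 : R) (1 : R) (fun h : R => f (h *: v + x)) df.
Proof.
split=> -[h1 <-]; apply: DeriveDef.
- exact: (iffLR (derivable1P f x v) h1).
- by rewrite derive1P.
- exact: (iffRL (derivable1P f x v) h1).
- by rewrite derive1P.
Qed.

Lemma is_derive_comp (k : R -> R) f x v (dk df : R) :
  is_derive (f x) 1 k dk -> is_derive x v f df ->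
  is_derive x v (fun y => k (f y)) (dk * df).
Proof.
move=> hk /is_derive1P hf; apply/is_derive1P.
apply: (@is_derive1_comp _ k) => //.
by rewrite scale0r add0r.
Qed.

End pointwise_derivatives.

Section pointwise_continuity.
Context {R : realType} {T : topologicalType}.
Implicit Types (f g : T -> R) (x : T).

Lemma continuous_at_add f g x : {for x, continuous f} -> {for x, continuous g} ->
  {for x, continuous (fun y => f y + g y)}.
Proof. exact: continuousD. Qed.

Lemma continuous_at_mul f g x : {for x, continuous f} -> {for x, continuous g} ->
  {for x, continuous (fun y => f y * g y)}.
Proof. exact: continuousM. Qed.

Lemma continuous_at_cst (c : R) x : {for x, continuous (fun=> c)}.
Proof. exact: cst_continuous. Qed.

Lemma continuous_at_comp (k : R -> R) f x : continuous k -> {for x, continuous f} ->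
  {for x, continuous (fun y => k (f y))}.
Proof. by move=> ck cf; apply: continuous_comp => //; exact: ck. Qed.

End pointwise_continuity.
Arguments continuous_at_add {R T f g x}.
Arguments continuous_at_mul {R T f g x}.
Arguments continuous_at_cst {R T} c x.
Arguments continuous_at_comp {R T k f x}.

Section sqnorm.
Context {R : realType} {N : nat}.
Implicit Types (x y : 'rV[R]_N).

Definition sqnorm x : R := \sum_(i < N) x ord0 i ^+ 2.

(** This is the logarithm of the Euclidean norm. Going through the square, a polynomial in the
    coordinates, gives its derivatives directly. *)
Definition ln_norm x : R := ln (sqnorm x) / 2.

Lemma enormE x : enorm x = Num.sqrt (sqnorm x). Proof. by []. Qed.

Lemma sqnorm_ge0 x : 0 <= sqnorm x.
Proof. by apply: sumr_ge0 => i _; rewrite sqr_ge0. Qed.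

Lemma coord_sqr_le x i : x ord0 i ^+ 2 <= sqnorm x.
Proof.
by rewrite /sqnorm (bigD1 i)//= lerDl; apply: sumr_ge0 => j _; rewrite sqr_ge0.
Qed.

Lemma norm_le_enorm x : `|x| <= enorm x.
Proof.
rewrite [`|x|]mx_normrE; apply/bigmax_leP; split=> [|[i j] _] /=; first exact: sqrtr_ge0.
by rewrite (ord1 i) -sqrtr_sqr ler_sqrt ?sqnorm_ge0// coord_sqr_le.
Qed.

Lemma sqnormZ (s : R) x : sqnorm (s *: x) = s ^+ 2 * sqnorm x.
Proof.
by rewrite /sqnorm mulr_sumr; apply: eq_bigr => i _; rewrite mxE exprMn.
Qed.

Lemma is_derive_coord x (i j : 'I_N) :
  is_derive x (unit_vec i) (fun y : 'rV[R]_N => y ord0 j) (j == i)%:R.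
Proof.
have h : is_derive (0 : R) (1 : R)
    (fun h : R => h * (j == i)%:R + x ord0 j) (j == i)%:R.
  have := is_derive_add (is_derive_mul (is_derive_id (0 : R) (1 : R))
    (is_derive_cst ((j == i)%:R : R) (0 : R) (1 : R)))
    (is_derive_cst (x ord0 j) (0 : R) (1 : R)).
  by rewrite mulr0 add0r mul1r addr0.
apply/is_derive1P; rewrite (_ : (fun _ => _) =
    (fun h : R => h * (j == i)%:R + x ord0 j))//.
by apply/funext => s; rewrite !mxE eqxx.
Qed.

Lemma is_derive_sqnorm x (i : 'I_N) :
  is_derive x (unit_vec i) sqnorm (2 * x ord0 i).
Proof.
rewrite (_ : sqnorm = \sum_(j < N) (fun y => y ord0 j ^+ 2)); last first.
  by apply/funext => y; rewrite fct_sumE.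
apply: is_derive_eq.
  apply: is_derive_sum => j.
  exact: (is_derive_mul (is_derive_coord x i j) (is_derive_coord x i j)).
rewrite (bigD1 i)//= eqxx big1 ?addr0; first by rewrite mulr1 mul1r mulr_natl.
by move=> j /negbTE ->; rewrite mulr0 mul0r addr0.
Qed.

Lemma continuous_sqnorm : continuous sqnorm.
Proof.
move=> x; rewrite /sqnorm (_ : (fun _ => _) = \sum_(j < N) (fun y => y ord0 j ^+ 2)); last first.
  by apply/funext => y; rewrite fct_sumE.
elim/big_ind: _ => [|f g cf cg|j _]; first exact: cst_continuous.
  exact: continuousD.
apply: continuousM; exact: coord_continuous.
Qed.

Lemma open_sqnorm_gt (c : R) : open [set x | c < sqnorm x].
Proof. exact: (open_comp (fun x _ => @continuous_sqnorm x) (@open_gt _ c)). Qed.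

Lemma open_sqnorm_lt (c : R) : open [set x | sqnorm x < c].
Proof. exact: (open_comp (fun x _ => @continuous_sqnorm x) (@open_lt _ c)). Qed.

Lemma closed_sqnorm_ge (c : R) : closed [set x | c <= sqnorm x].
Proof. exact: (preimage_closed (fun x _ => @continuous_sqnorm x) (@closed_ge _ c)). Qed.

Lemma closed_sqnorm_le (c : R) : closed [set x | sqnorm x <= c].
Proof. exact: (preimage_closed (fun x _ => @continuous_sqnorm x) (@closed_le _ c)). Qed.

Lemma closure_unit_ball : closure (@unit_ball R N) = [set x | sqnorm x <= 1].
Proof.
have ubE : @unit_ball R N = [set x | sqnorm x < 1].
  apply/funext => x; apply/propext; rewrite /unit_ball/= enormE.
  by rewrite -[X in _ < X]sqrtr1 ltr_sqrt.
apply/seteqP; split.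
  rewrite [X in _ `<=` X](iffLR (closure_id _) (@closed_sqnorm_le 1)) ubE.
  by apply: closure_subset => x /= /ltW.
move=> x /= x1 B /nbhs_ballP[e /= e0 xB].
have [s [s0 s1 sB]] : exists s : R, [/\ 0 <= s, s < 1 & ball x e (s *: x)].
  have x0 : 0 < `|x| + 1 by rewrite ltr_wpDl.
  (* Shrinking [x] by the factor [1 - d] moves it by [d |x| < e] and brings it into the open ball;
     the [+ 1] covers [x = 0]. *)
  pose d := Num.min (1 / 2) (e / (`|x| + 1) / 2).
  have d0 : 0 < d by rewrite lt_min !divr_gt0.
  have d1 : d <= 1 / 2 by rewrite ge_min lexx.
  have d2 : d <= e / (`|x| + 1) / 2 by rewrite ge_min lexx orbT.
  exists (1 - d); split; [lra|lra|].
  rewrite -ball_normE/= -[X in X - _]scale1r -scalerBl subKr normrZ gtr0_norm//.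
  apply: (@le_lt_trans _ _ (d * (`|x| + 1))).
    by rewrite ler_pM2l// lerDl.
  have : e / (`|x| + 1) / 2 < e / (`|x| + 1) by rewrite gtr_pMr ?divr_gt0//; lra.
  by move=> /(le_lt_trans d2); rewrite ltr_pdivlMr.
exists (s *: x); split; last exact: xB.
rewrite ubE /= sqnormZ; apply: (@le_lt_trans _ _ (s ^+ 2)).
  by rewrite ler_piMr ?sqr_ge0.
by rewrite expr_lt1.
Qed.

Lemma Omega_eE : @Omega_e R N = [set x | 1 < sqnorm x].
Proof.
rewrite /Omega_e closure_unit_ball; apply/seteqP; split=> x /=.
  by move/negP; rewrite -ltNge.
by move=> x1; apply/negP; rewrite -ltNge.
Qed.

Lemma open_Omega_e : open (@Omega_e R N).
Proof. rewrite Omega_eE; exact: open_sqnorm_gt. Qed.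

Lemma measurable_Omega_e : measurable (@Omega_e R N).
Proof. apply: open_measurable_rV; exact: open_Omega_e. Qed.

Lemma closure_Omega_e_sub : closure (@Omega_e R N) `<=` [set x | 1 <= sqnorm x].
Proof.
rewrite [X in _ `<=` X](iffLR (closure_id _) (@closed_sqnorm_ge 1)) Omega_eE.
by apply: closure_subset => x /= /ltW.
Qed.

Lemma Omega_e_ln_norm x : Omega_e x <-> 0 < ln_norm x.
Proof.
rewrite Omega_eE /= /ln_norm; split=> [x1|]; first by rewrite divr_gt0 ?ln_gt0.
rewrite pmulr_lgt0 ?invr_gt0//; apply: contraTT; rewrite -!leNgt => ?.
exact: ln_le0.
Qed.

Lemma ln_norm_ge0 x : 1 <= sqnorm x -> 0 <= ln_norm x.
Proof. by move=> x1; rewrite divr_ge0 ?ln_ge0. Qed.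

Lemma sqnorm_expR x : 0 < sqnorm x -> sqnorm x = expR (2 * ln_norm x).
Proof. by move=> x0; rewrite /ln_norm mulrCA divff// mulr1 lnK. Qed.

Lemma enorm_expR x : 0 < sqnorm x -> enorm x = expR (ln_norm x).
Proof.
move=> x0; rewrite enormE sqnorm_expR//.
by rewrite expRM_natl sqrtr_sqr ger0_norm ?expR_ge0.
Qed.

Lemma ln_norm_sphere x : unit_sphere x -> 0 < sqnorm x /\ ln_norm x = 0.
Proof.
rewrite /unit_sphere /= enormE => x1.
have {x1} x1 : sqnorm x = 1 by rewrite -(sqr_sqrtr (sqnorm_ge0 x)) x1 expr1n.
by rewrite /ln_norm x1 ln1 mul0r.
Qed.

(** It includes the origin: there [ln 0 = 0], and [0 < e] makes both sides true. *)
Lemma ln_norm_lt x (e : R) : 0 < e -> (ln_norm x < e) = (sqnorm x < expR (2 * e)).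
Proof.
move=> e0; have [x0|x0] := ltP 0 (sqnorm x).
  by rewrite [in RHS]sqnorm_expR// ltr_expR ltr_pM2l.
have -> : sqnorm x = 0 by apply/eqP; rewrite eq_le x0 sqnorm_ge0.
have s0 : sqnorm x = 0 by apply/eqP; rewrite eq_le x0 sqnorm_ge0.
by rewrite /ln_norm s0 ln0// mul0r e0 expR_gt0.
Qed.

Lemma is_derive_ln_norm x (i : 'I_N) : 0 < sqnorm x ->
  is_derive x (unit_vec i) ln_norm (expR (- 2 * ln_norm x) * x ord0 i).
Proof.
move=> x0; apply: is_derive_val (is_derive_mul
  (is_derive_comp (is_derive1_ln x0) (is_derive_sqnorm x i))
  (is_derive_cst (2^-1 : R) x (unit_vec i))) _.
rewrite mulr0 add0r (_ : - 2 * ln_norm x = - ln (sqnorm x)) ?expRN ?lnK//.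
  by rewrite /=; field; rewrite gt_eqF.
rewrite /ln_norm. by rewrite mulNr mulrCA divff ?mulr1. 
Qed.

Lemma is_derive_radial (k : R -> R) (dk : R) x (i : 'I_N) : 0 < sqnorm x ->
  is_derive (ln_norm x) 1 k dk ->
  is_derive x (unit_vec i) (fun y => k (ln_norm y))
    (expR (- 2 * ln_norm x) * dk * x ord0 i).
Proof.
move=> x0 hk; apply: is_derive_val (is_derive_comp hk (is_derive_ln_norm i x0)) _.
by rewrite mulrCA mulrA.
Qed.

Lemma continuous_ln_norm x : 0 < sqnorm x -> {for x, continuous ln_norm}.
Proof.
move=> x0; apply: continuousM; last exact: cst_continuous.
apply: (@continuous_comp _ _ _ sqnorm (@ln R)); first exact: continuous_sqnorm.
exact: continuous_ln.
Qed.

End sqnorm.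

(** * Functions of class C^n on the line and on the punctured space *)

Section smooth_real.
Context {R : realType}.
Implicit Types (k l : R -> R) (n : nat).

(** Carrying the derivative as a witness lets each closure rule follow by induction on [n] from a
    single differentiation rule. *)
Fixpoint smooth1 n k : Prop :=
  continuous k /\
  if n is m.+1 then
    exists2 dk, smooth1 m dk & forall y : R, is_derive y (1 : R) k (dk y)
  else True.

Lemma smooth1_continuous n k : smooth1 n k -> continuous k.
Proof. by case: n => [|n] []. Qed.

Lemma smooth1W n k : smooth1 n.+1 k -> smooth1 n k.
Proof.
elim: n k => [|n IH] k; first by move=> [].
by move=> [ck [dk /IH dkn kdk]]; split=> //; exists dk.
Qed.

Lemma smooth1_cst n (c : R) : smooth1 n (fun=> c).
Proof.
elim: n c => [|n IH] c; first by split=> // ?; exact: cst_continuous.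
split; first by move=> ?; exact: cst_continuous.
by exists (fun=> 0) => // y; exact: is_derive_cst.
Qed.

Lemma smooth1D n k l : smooth1 n k -> smooth1 n l -> smooth1 n (fun y => k y + l y).
Proof.
elim: n k l => [|n IH] k l [ck hk] [cl hl].
  by split=> // y; apply: continuousD; [exact: ck|exact: cl].
split; first by move=> y; apply: continuousD; [exact: ck|exact: cl].
case: hk => dk sk kdk; case: hl => dl sl ldl.
exists (fun y => dk y + dl y); first exact: IH.
by move=> y; exact: is_derive_add.
Qed.

Lemma smooth1M n k l : smooth1 n k -> smooth1 n l -> smooth1 n (fun y => k y * l y).
Proof.
elim: n k l => [|n IH] k l hk hl.
  split=> // y.
  by apply: continuousM; [case: hk => + _|case: hl => + _]; exact.
have sk := smooth1W hk; have sl := smooth1W hl.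
case: hk hl => ck [dk dks kdk] [cl [dl dls ldl]].
split; first by move=> y; apply: continuousM; [exact: ck|exact: cl].
exists (fun y => k y * dl y + dk y * l y).
  by apply: smooth1D; exact: IH.
by move=> y; exact: is_derive_mul.
Qed.

Lemma is_derive_expRM (c y : R) :
  is_derive y (1 : R) (fun z => expR (c * z)) (c * expR (c * y)).
Proof.
have h := is_derive_mul (is_derive_cst (c : R) y (1 : R)) (is_derive_id y (1 : R)).
have := is_derive_comp (is_derive_expR (c * y)) h.
by move=> /is_derive_val; apply; rewrite /= mul0r addr0 mulr1 mulrC.
Qed.

Lemma smooth1_expRM n (c : R) : smooth1 n (fun y => expR (c * y)).
Proof.
have ce : continuous (fun y : R => expR (c * y)).
  move=> y; apply: (@continuous_comp _ _ _ (fun z => c * z) expR).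
    exact: mulrl_continuous.
  exact: continuous_expR.
elim: n => [|n IH]; split=> //.
exists (fun y => c * expR (c * y)).
  by apply: smooth1M => //; exact: smooth1_cst.
by move=> y; exact: is_derive_expRM.
Qed.

End smooth_real.

Section smooth_punctured_space.
Context {R : realType} {N : nat}.
Implicit Types (f g : 'rV[R]_N -> R) (n : nat) (x : 'rV[R]_N).

Lemma is_derive_open (O : set 'rV[R]_N) f g x v (df : R) : open O -> O x ->
  (forall y, O y -> f y = g y) -> is_derive x v f df -> is_derive x v g df.
Proof.
move=> oO Ox fg; apply: near_eq_is_derive.
by have := open_nbhs_nbhs (conj oO Ox); apply: filterS => y; exact: fg.
Qed.

(** The domain is the space without the origin, an open set that contains the sphere, so that
    derivatives on the sphere are ordinary ones. *)
Fixpoint smooth n f : Prop :=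
  (forall x, 0 < sqnorm x -> {for x, continuous f}) /\
  if n is m.+1 then
    forall i, exists2 df, smooth m df &
      forall x, 0 < sqnorm x -> is_derive x (unit_vec i) f (df x)
  else True.

Lemma smooth_continuous n f x : smooth n f -> 0 < sqnorm x -> {for x, continuous f}.
Proof. by case: n => [|n] [+ _]; exact. Qed.

Lemma smoothW n f : smooth n.+1 f -> smooth n f.
Proof.
elim: n f => [|n IH] f; first by move=> [].
move=> [cf hf]; split=> // i; have [df /IH sdf fdf] := hf i.
by exists df.
Qed.

Lemma smooth_cst n (c : R) : smooth n (fun=> c).
Proof.
elim: n c => [|n IH] c; first by split=> // ? _; exact: cst_continuous.
split; first by move=> ? _; exact: cst_continuous.
by move=> i; exists (fun=> 0) => // x _; exact: is_derive_cst.
Qed.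

Lemma smoothD n f g : smooth n f -> smooth n g -> smooth n (fun x => f x + g x).
Proof.
elim: n f g => [|n IH] f g [cf hf] [cg hg].
  by split=> // y y0; apply: continuousD; [exact: cf|exact: cg].
split; first by move=> y y0; apply: continuousD; [exact: cf|exact: cg].
move=> i; have [df sf fdf] := hf i; have [dg sg gdg] := hg i.
exists (fun y => df y + dg y); first exact: IH.
by move=> y y0; apply: is_derive_add; [exact: fdf|exact: gdg].
Qed.

Lemma smoothM n f g : smooth n f -> smooth n g -> smooth n (fun x => f x * g x).
Proof.
elim: n f g => [|n IH] f g hf hg.
  split=> // y y0.
  by apply: continuousM; [case: hf => + _|case: hg => + _]; exact.
have sf := smoothW hf; have sg := smoothW hg.
case: hf hg => cf {}hf [cg {}hg].
split; first by move=> y y0; apply: continuousM; [exact: cf|exact: cg].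
move=> i; have [df dfs fdf] := hf i; have [dg dgs gdg] := hg i.
exists (fun y => f y * dg y + df y * g y).
  by apply: smoothD; exact: IH.
by move=> y y0; apply: is_derive_mul; [exact: fdf|exact: gdg].
Qed.

Lemma smooth_coord n (j : 'I_N) : smooth n (fun x => x ord0 j).
Proof.
case: n => [|n]; split=> //; do ?by move=> x _; exact: coord_continuous.
move=> i; exists (fun=> (j == i)%:R); first exact: smooth_cst.
by move=> x _; exact: is_derive_coord.
Qed.

(** The induction closes because a partial derivative of a radial function is again a radial
    function, [e^(-2 y) k'(y)], times a coordinate. *)
Lemma smooth_radial n (k : R -> R) : smooth1 n k -> smooth n (k \o ln_norm).
Proof.
have cr (l : R -> R) : continuous l ->
    forall x : 'rV[R]_N, 0 < sqnorm x -> {for x, continuous (l \o ln_norm)}.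
  move=> cl x x0; apply: continuous_comp; last exact: cl.
  exact: continuous_ln_norm.
elim: n k => [|n IH] k [ck hk].
  by split=> //; exact: cr.
split; first exact: cr.
move=> i; case: hk => dk sdk kdk.
exists (fun x => ((fun y => expR (- 2 * y) * dk y) \o ln_norm) x * x ord0 i).
  apply: smoothM; last exact: smooth_coord.
  by apply: IH; apply: smooth1M => //; exact: smooth1_expRM.
by move=> x x0; exact: is_derive_radial.
Qed.

Lemma iter_partial_smooth n f (s : seq 'I_N) : smooth (size s + n) f ->
  exists2 h, smooth n h & forall x, 0 < sqnorm x -> iter_partial s f x = h x.
Proof.
elim: s n f => [|i s IH] n f; first by exists f.
rewrite [size _]/= addSnnS => /IH[h [ch hh] fh].
have [dh sdh hdh] := hh i; exists dh => // x x0.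
have := is_derive_open (@open_sqnorm_gt _ _ 0) x0 (fun y y0 => esym (fh y y0)) (hdh _ x0).
by move=> [_ <-].
Qed.

(** The closure of [Omega_e] avoids the origin, so the derivative witnesses themselves are the
    required continuous extensions. *)
Lemma smooth_Ck_closure n f : smooth n f -> Ck_closure n f.
Proof.
move=> sf.
have gt0 x : closure Omega_e x -> 0 < sqnorm x.
  by move=> /closure_Omega_e_sub /= /(lt_le_trans ltr01).
have wc m h : smooth m h -> {within closure Omega_e, continuous h}.
  move=> sh; apply: (@continuous_subspaceW _ _ _ [set x | 0 < sqnorm x] h gt0).
  rewrite continuous_open_subspace; last exact: open_sqnorm_gt.
  by move=> x; rewrite inE; exact: smooth_continuous sh.
have sub s : (size s <= n)%N -> exists2 h, smooth (n - size s) h &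
    forall x, 0 < sqnorm x -> iter_partial s f x = h x.
  by move=> sn; apply: iter_partial_smooth; rewrite subnKC.
split; first exact: wc sf.
  move=> s i x sn /subset_closure /gt0 x0.
  have [h] := sub s (ltnW sn); rewrite -[(n - _)%N]prednK ?subn_gt0//.
  move=> [_ hh] fh; have [dh _ hdh] := hh i.
  have := is_derive_open (@open_sqnorm_gt _ _ 0) x0 (fun y y0 => esym (fh y y0)) (hdh _ x0).
  by case.
move=> s sn; have [h sh fh] := sub s sn; exists h; split; first exact: wc sh.
by move=> x /subset_closure /gt0 x0; rewrite fh.
Qed.

Lemma smooth_zero_on_sphere n f : smooth n f ->
  (forall x, unit_sphere x -> f x = 0) -> zero_on_sphere f.
Proof.
move=> sf f0 y y1; rewrite -(f0 y y1).
have [y0 _] := ln_norm_sphere y1.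
apply: cvg_within_filter; exact: smooth_continuous sf y0.
Qed.

(** The second derivative in direction [i] of a radial function whose profile has derivatives [a1]
    and [a2] at [ln |x|]. *)
Definition radial_hess (a1 a2 : R) x (i : 'I_N) : R :=
  expR (- 2 * ln_norm x) * a1 +
  expR (- 2 * ln_norm x) * (expR (- 2 * ln_norm x) * (a2 - 2 * a1)) * x ord0 i ^+ 2.

Lemma is_derive_radial_grad (k1 : R -> R) (a2 : R) x (i : 'I_N) : 0 < sqnorm x ->
  is_derive (ln_norm x) (1 : R) k1 a2 ->
  is_derive x (unit_vec i)
    (fun y => expR (- 2 * ln_norm y) * k1 (ln_norm y) * y ord0 i)
    (radial_hess (k1 (ln_norm x)) a2 x i).
Proof.
move=> x0 k1d; apply: is_derive_val (is_derive_mul (is_derive_radial i x0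
  (is_derive_mul (is_derive_expRM (- 2) _) k1d)) (is_derive_coord x i i)) _.
by rewrite /radial_hess eqxx /=; ring.
Qed.

Lemma sum_radial_hess (a1 a2 : R) x : 0 < sqnorm x ->
  \sum_i radial_hess a1 a2 x i = expR (- 2 * ln_norm x) * (a2 + (N%:R - 2) * a1).
Proof.
move=> x0; rewrite big_split/= sumr_const card_ord -mulr_sumr -/(sqnorm x) sqnorm_expR//.
have -> : expR (2 * ln_norm x) = (expR (- 2 * ln_norm x))^-1.
  by rewrite -expRN; congr expR; ring.
have e0 : expR (- 2 * ln_norm x) != 0 by rewrite gt_eqF ?expR_gt0.
by rewrite -[_ *+ N]mulr_natl; field.
Qed.

Lemma laplacian_radial (k k1 k2 : R -> R) x :
  (forall y, is_derive y (1 : R) k (k1 y)) ->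
  (forall y, is_derive y (1 : R) k1 (k2 y)) -> 0 < sqnorm x ->
  laplacian (k \o ln_norm) x =
  expR (- 2 * ln_norm x) * (k2 (ln_norm x) + (N%:R - 2) * k1 (ln_norm x)).
Proof.
move=> kd k1d x0; rewrite -sum_radial_hess//; apply: eq_bigr => i _.
have [_ <-] := is_derive_radial_grad i x0 (k1d (ln_norm x)).
apply: near_eq_derive.
have := open_nbhs_nbhs (conj (@open_sqnorm_gt _ _ 0) x0); apply: filterS => y y0.
by have [_ <-] := is_derive_radial i y0 (kd (ln_norm y)).
Qed.

(** The radial bilaplacian without its factor [e^(-4 y)]. Its symbol is
    [l (l + N - 2) (l - 2) (l + N - 4)]: the Laplacian acts on [r ^ l], then on [r ^ (l - 2)]. *)
Definition biharmonic_op (k1 k2 k3 k4 : R -> R) (y : R) : R :=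
  k4 y + (2 * N%:R - 8) * k3 y
  + ((N%:R - 6) * (N%:R - 2) - 2 * (N%:R - 4)) * k2 y
  + - (2 * (N%:R - 4) * (N%:R - 2)) * k1 y.

Lemma laplacian_eq_open (O : set 'rV[R]_N) f g x : open O -> O x ->
  (forall y, O y -> f y = g y) -> laplacian f x = laplacian g x.
Proof.
move=> oO Ox fg.
have pE (h1 h2 : 'rV[R]_N -> R) i : (forall z, O z -> h1 z = h2 z) ->
    forall y, O y -> partial i h1 y = partial i h2 y.
  move=> h12 y Oy; apply: near_eq_derive.
  by have := open_nbhs_nbhs (conj oO Oy); apply: filterS => z; exact: h12.
by apply: eq_bigr => i _; exact/pE/Ox/pE.
Qed.

(* The Laplacian of [k (ln |x|)] is [radial_lap k1 k2 (ln |x|)]; [radial_lap1] and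
   [radial_lap2] are the first two derivatives of this profile. *)
Definition radial_lap (k1 k2 : R -> R) (y : R) : R :=
  expR (- 2 * y) * (k2 y + (N%:R - 2) * k1 y).

Definition radial_lap1 (k1 k2 k3 : R -> R) (y : R) : R :=
  expR (- 2 * y) * (k3 y + (N%:R - 4) * k2 y + (- (2 * (N%:R - 2))) * k1 y).

Definition radial_lap2 (k1 k2 k3 k4 : R -> R) (y : R) : R :=
  expR (- 2 * y) * (k4 y + (N%:R - 6) * k3 y
  + (- 4 * N%:R + 12) * k2 y + 4 * (N%:R - 2) * k1 y).

Section radial_bilaplacian.
Context (k k1 k2 k3 k4 : R -> R)
  (d0 : forall y, is_derive y (1 : R) k (k1 y))
  (d1 : forall y, is_derive y (1 : R) k1 (k2 y))
  (d2 : forall y, is_derive y (1 : R) k2 (k3 y))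
  (d3 : forall y, is_derive y (1 : R) k3 (k4 y)).

Lemma is_derive_radial_lap y :
  is_derive y (1 : R) (radial_lap k1 k2) (radial_lap1 k1 k2 k3 y).
Proof.
rewrite /radial_lap; apply: is_derive_val (is_derive_mul (is_derive_expRM (- 2) _)
  (is_derive_add (d2 y) (is_derive_mul (is_derive_cst (N%:R - 2 : R) y (1 : R)) (d1 y)))) _.
by rewrite /radial_lap1 /=; ring.
Qed.

Lemma is_derive_radial_lap1 y :
  is_derive y (1 : R) (radial_lap1 k1 k2 k3) (radial_lap2 k1 k2 k3 k4 y).
Proof.
have c (z : R) := is_derive_cst z y (1 : R).
rewrite /radial_lap1; apply: is_derive_val (is_derive_mul (is_derive_expRM (- 2) _)
  (is_derive_add (is_derive_add (d3 y) (is_derive_mul (c (N%:R - 4)) (d2 y)))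
     (is_derive_mul (c (- (2 * (N%:R - 2)))) (d1 y)))) _.
by rewrite /radial_lap2 /=; ring.
Qed.

Lemma radial_lap_lap y :
  radial_lap (radial_lap1 k1 k2 k3) (radial_lap2 k1 k2 k3 k4) y =
  expR (- 4 * y) * biharmonic_op k1 k2 k3 k4 y.
Proof.
rewrite /radial_lap /radial_lap1 /radial_lap2 /biharmonic_op.
have -> : expR (- 4 * y) = expR (- 2 * y) * expR (- 2 * y).
  by rewrite -expRD; congr expR; ring.
by ring.
Qed.

Lemma bilaplacian_radial x : 0 < sqnorm x ->
  bilaplacian (k \o ln_norm) x =
  expR (- 4 * ln_norm x) * biharmonic_op k1 k2 k3 k4 (ln_norm x).
Proof.
move=> x0; rewrite -radial_lap_lap.
rewrite /bilaplacian (laplacian_eq_open (@open_sqnorm_gt _ _ 0)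
  (g := radial_lap k1 k2 \o ln_norm))//.
  exact: (laplacian_radial is_derive_radial_lap is_derive_radial_lap1).
by move=> y y0; exact: (laplacian_radial d0 d1).
Qed.

End radial_bilaplacian.

End smooth_punctured_space.

(** * Green's formula *)

Section compact_support.
Context {R : realType}.

Lemma lebesgue_rV_succE n : @lebesgue_rV R n.+1 = lebesgue_succ (lebesgue_rV n).
Proof. by []. Qed.

Lemma compact_norm_le n (M : R) : compact [set x : 'rV[R]_n | `|x| <= M].
Proof.
apply: bounded_closed_compact.
  by exists M; split; [exact: num_real|move=> e Me x /= /le_trans; apply; exact: ltW].
rewrite (_ : [set x | _] = (fun x : 'rV[R]_n => `|x|) @^-1` [set t | t <= M])//.
apply: preimage_closed; last exact: closed_le.
by move=> x _; exact: norm_continuous.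
Qed.

Lemma continuous_integrable_supp n (H : 'rV[R]_n -> R) (M : R) :
  continuous H -> (forall x, M < `|x| -> H x = 0) ->
  (lebesgue_rV n).-integrable setT (EFin \o H).
Proof.
move=> cH H0.
have cK := @compact_norm_le n M.
have mK := compact_measurable_rV cK.
have : (lebesgue_rV n).-integrable [set x | `|x| <= M] (EFin \o H).
  by apply: (@continuous_integrable_compact _ _ setT) => //; exact: openT.
move/(integrable_mkcond _ mK); rewrite (_ : _ \_ _ = EFin \o H)//.
apply/funext => x; rewrite patchE; case: ifPn => //.
by rewrite notin_setE /= => /negP; rewrite -ltNge => /H0 ->.
Qed.

Lemma norm_rV_cons n (a : R) (v : 'rV[R]_n) :
  `|a| <= `|rV_cons (a, v)| /\ `|v| <= `|rV_cons (a, v)|.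
Proof.
split.
  have := coord_le_norm (rV_cons (a, v)) ord0.
  by rewrite /rV_cons mxE split1 unlift_none /= mxE.
rewrite [`|v|]mx_normrE; apply/bigmax_leP; split=> // -[i j] _ /=.
have := coord_le_norm (rV_cons (a, v)) (lift ord0 j).
by rewrite /rV_cons mxE split1 liftK /= (ord1 i).
Qed.

Lemma ball_rV_cons n (a b : R) (v w : 'rV[R]_n) (e : R) : 0 < e ->
  ball a e b -> ball v e w -> ball (rV_cons (a, v)) e (rV_cons (b, w)).
Proof.
move=> e0 ab vw; rewrite ball_rVE// => i /=; rewrite /rV_cons !mxE.
case: (unliftP ord0 i) => [j|] ->; rewrite split1.
  by rewrite liftK; move: vw; rewrite ball_rVE//; exact.
by rewrite unlift_none /= !mxE.
Qed.

Lemma continuous_rV_cons1 n (v : 'rV[R]_n) : continuous (fun a : R => rV_cons (a, v)).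
Proof.
move=> a; apply/cvg_ballP => e e0; apply: filterS (nbhsx_ballx a e e0) => b ab.
by apply: ball_rV_cons => //; exact: ballxx.
Qed.

Lemma continuous_rV_cons2 n (a : R) : continuous (fun v : 'rV[R]_n => rV_cons (a, v)).
Proof.
move=> v A /= /nbhs_ballP[e /= e0 eA].
apply: (iffRL (@nbhs_ballP _ _ v _)); exists e => // w vw; apply: eA.
by apply: ball_rV_cons => //; exact: ballxx.
Qed.

Lemma integral_derive_eq0 (g dg : R -> R) (M : R) : continuous dg ->
  (forall x, M < `|x| -> g x = 0) -> (forall x, is_derive x (1 : R) g (dg x)) ->
  (\int[lebesgue_measure]_x (dg x)%:E = 0)%E.
Proof.
move=> cdg g0 gd.
(* [M] may be negative, and the hypothesis gives zeros of [g] only strictly beyond it; [|M| + 1]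
   yields a nondegenerate interval with [g = 0] at its ends. *)
have M0 : 0 < `|M| + 1 by rewrite ltr_wpDl.
have gM x : `|M| + 1 <= `|x| -> g x = 0.
  move=> h; apply: g0; apply: lt_le_trans h.
  by rewrite (le_lt_trans (ler_norm M))// ltrDl.
have dg0 x : `|M| + 1 < `|x| -> dg x = 0.
  move=> h; have [_ <-] := gd x.
  rewrite (@near_eq_derive _ _ _ _ (cst 0)) ?derive_cst//.
  have oU : open [set y : R | `|M| + 1 < `|y|].
    by apply: (open_comp (fun x _ => @norm_continuous _ _ x) (@open_gt _ _)).
  have := open_nbhs_nbhs (conj oU h).
  by apply: filterS => y /ltW; exact: gM.
have cg : continuous g.
  by move=> x; apply: differentiable_continuous; apply/derivable1_diffP; have [] := gd x.
rewrite (_ : (fun x => _) = (EFin \o dg) \_ `[- (`|M| + 1), `|M| + 1]); last first.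
  apply/funext => x; rewrite patchE; case: ifPn => //.
  by rewrite notin_setE /= in_itv/= -ler_norml => /negP; rewrite -ltNge => /dg0 ->.
rewrite -integral_mkcond (@continuous_FTC2 _ dg g).
- have b1 : `|M| + 1 <= `| `|M| + 1| by exact: ler_norm.
  by rewrite !gM ?sube0 ?normrN.
- by rewrite gtrN.
- exact: continuous_subspaceT.
- by split=> [x _||]; [have [] := gd x|exact/cvg_at_right_filter/cg|
    exact/cvg_at_left_filter/cg].
- by move=> x _; rewrite derive1E; have [_ <-] := gd x.
Qed.

(* Integration by parts in one coordinate: Fubini and the one-dimensional
   fundamental theorem of calculus. *)
Lemma integral_partial_eq0 n (i : 'I_n) (G H : 'rV[R]_n -> R) (M : R) :
  continuous H -> (forall x, M < `|x| -> G x = 0) ->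
  (forall x, is_derive x (unit_vec i) G (H x)) ->
  (\int[lebesgue_rV n]_x (H x)%:E = 0)%E.
Proof.
elim: n i G H => [[]//|n IH] i G H cH G0 GH.
have oM : open [set x : 'rV[R]_n.+1 | M < `|x|].
  by apply: (open_comp (fun x _ => @norm_continuous _ _ x) (@open_gt _ _)).
have H0 x : M < `|x| -> H x = 0.
  move=> h; have [_ <-] := GH x.
  rewrite (@near_eq_derive _ _ _ _ (cst 0)) ?derive_cst//.
  by have := open_nbhs_nbhs (conj oM h); apply: filterS => y; exact: G0.
have iH := continuous_integrable_supp cH H0.
have mH : measurable_fun setT (EFin \o H) by case/integrableP : iH.
have mHc : measurable_fun setT ((EFin \o H) \o @rV_cons R n).
  by apply: measurableT_comp => //; exact: measurable_rV_cons.
have iHc : (@lebesgue_measure R \x lebesgue_rV n)%E.-integrable setT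
    ((EFin \o H) \o @rV_cons R n).
  apply/integrableP; split => //.
  have /integrableP[_] := iH.
  have mc := @measurable_rV_cons R n.
  have mH' : measurable_fun setT (fun x => `|(EFin \o H) x|)%E.
    exact: measurableT_comp.
  by rewrite lebesgue_rV_succE (ge0_integral_pushforward mc _ measurableT mH').
rewrite lebesgue_rV_succE integral_pushforward//=; last exact: measurable_rV_cons.
rewrite preimage_setT.
have cons_shift a b (v w : 'rV[R]_n) (h : R) :
    rV_cons (h * a + b, h *: v + w) = h *: rV_cons (a, v) + rV_cons (b, w).
  by apply/rowP => j; rewrite /rV_cons !mxE; case: (@fintype.split 1 n j) => k; rewrite !mxE.
(* Fubini is used in the order that integrates direction [i] on the inside: over the last [n]
   coordinates, by induction, if [i] is one of them, and otherwise over the first one, by the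
   one-dimensional lemma. *)
case: (unliftP ord0 i) => [j|] iE.
  rewrite -integral12_prod_meas1//.
  rewrite integral0_eq// => a _; rewrite /fubini_F/=.
  apply: (IH j (fun v => G (rV_cons (a, v)))).
  - move=> v; apply: (@continuous_comp _ _ _ (fun v => rV_cons (a, v)) H).
      exact: continuous_rV_cons2.
    exact: cH.
  - by move=> v vM; apply: G0; have [_] := norm_rV_cons a v; exact: lt_le_trans.
  - move=> v; apply/is_derive1P; have /is_derive1P := GH (rV_cons (a, v)).
    congr (is_derive _ _ _ _); apply/funext => h; congr G.
    have -> : (unit_vec i : 'rV[R]_n.+1) = rV_cons (0, unit_vec j).
      apply/rowP => l; rewrite iE /unit_vec /rV_cons !mxE.
      case: (unliftP ord0 l) => [m|] ->; rewrite split1 ?liftK ?unlift_none /= !mxE//.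
    by rewrite -cons_shift mulr0 add0r.
rewrite -integral21_prod_meas1//.
rewrite integral0_eq// => v _; rewrite /fubini_G/=.
apply: (@integral_derive_eq0 (fun a => G (rV_cons (a, v))) _ M).
- move=> a; apply: (@continuous_comp _ _ _ (fun a => rV_cons (a, v)) H).
    exact: continuous_rV_cons1.
  exact: cH.
- by move=> a aM; apply: G0; have [+ _] := norm_rV_cons a v; exact: lt_le_trans.
- move=> a; apply/is_derive1P; have /is_derive1P := GH (rV_cons (a, v)).
  congr (is_derive _ _ _ _); apply/funext => h; congr G.
  have -> : (unit_vec i : 'rV[R]_n.+1) = rV_cons (1, 0).
    apply/rowP => l; rewrite iE /unit_vec /rV_cons !mxE.
    by case: (unliftP ord0 l) => [m|] ->; rewrite split1 ?liftK ?unlift_none /= !mxE ?eqxx.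
  by rewrite -cons_shift scaler0 add0r.
Qed.

End compact_support.

(** * Powers of the positive part and a spline step *)

Section positive_part_powers.
Context {R : realType}.
Implicit Types (y z : R) (k l : R -> R).

Lemma continuous_pos : continuous (fun z : R => Num.max 0 z).
Proof.
move=> z; apply: (@continuous_max _ _ (fun=> 0) id); first exact: cst_continuous.
exact: cvg_id.
Qed.

Lemma is_derive_posX n z :
  is_derive z (1 : R) (fun y => Num.max 0 y ^+ n.+2) (n.+2%:R * Num.max 0 z ^+ n.+1).
Proof.
have [z0|z0|<-] := ltgtP 0 z.
-   have h : is_derive z (1 : R) (fun y => y ^+ n.+2) (n.+2%:R * z ^+ n.+1).
    have := is_deriveX n.+2 (is_derive_id z (1 : R)).
    by rewrite exprfctE /GRing.scale/= mulr1.
  apply: near_eq_is_derive h.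
  have := open_nbhs_nbhs (conj (@open_gt R 0) z0).
  by apply: filterS => y /= y0; rewrite max_r ?ltW.
- rewrite expr0n mulr0.
  apply: near_eq_is_derive (is_derive_cst (0 : R) z (1 : R)).
  have := open_nbhs_nbhs (conj (@open_lt R 0) z0).
  by apply: filterS => y /= y0; rewrite max_l ?ltW// expr0n.
(* At the corner the difference quotient is itself a lower power of the positive part, which is
   continuous with value 0. *)
apply/is_derive1_caratheodory; exists (fun y => Num.max 0 y ^+ n.+1); split.
- move=> y; rewrite ?maxxx expr0n subr0 subr0.
  have [y0|y0] := leP 0 y; first by rewrite exprSr.
  by rewrite !expr0n mul0r.
- apply: (@continuous_comp _ _ _ (fun y : R => Num.max 0 y) (fun y => y ^+ n.+1)).
    exact: continuous_pos.
  exact: exprn_continuous.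
- by rewrite ?maxxx !expr0n mulr0.
Qed.

Lemma smooth1_comp n k l : smooth1 n k -> smooth1 n l -> smooth1 n (k \o l).
Proof.
elim: n k l => [|n IH] k l hk hl.
  split=> // y; apply: continuous_comp; [case: hl => + _|case: hk => + _]; exact.
have sk := smooth1W hk; have sl := smooth1W hl.
case: hk hl => ck [dk dks kdk] [cl [dl dls ldl]].
split; first by move=> y; apply: continuous_comp; [exact: cl|exact: ck].
exists (fun y => (dk \o l) y * dl y).
  by apply: smooth1M => //; exact: IH.
by move=> y; exact: is_derive_comp.
Qed.

Lemma smooth1_id n : smooth1 n (@id R).
Proof.
case: n => [|n]; split=> //; do ?by move=> ?; exact: cvg_id.
by exists (fun=> 1); [exact: smooth1_cst|move=> y; exact: is_derive_id].
Qed.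

Lemma smooth1_posX n m : (n <= m)%N -> smooth1 n (fun z : R => Num.max 0 z ^+ m.+1).
Proof.
have cp m' : continuous (fun z : R => Num.max 0 z ^+ m').
  move=> z; apply: (@continuous_comp _ _ _ (fun y : R => Num.max 0 y) (fun y => y ^+ m')).
    exact: continuous_pos.
  exact: exprn_continuous.
elim: n m => [|n IH] m nm; first by split.
split=> //; case: m nm => // m nm.
exists (fun z => m.+2%:R * Num.max 0 z ^+ m.+1).
  by apply: smooth1M; [exact: smooth1_cst|exact: IH].
exact: is_derive_posX.
Qed.

(** The integral of the quadratic B-spline with knots 0, 1, 2, 3, written as a third difference of
    [z_+^3 / 6]. It rises from 0 to 1 and is just regular enough, C^2, to enter a Laplacian. *)
Definition step (z : R) : R :=
  (Num.max 0 z ^+ 3 - 3 * Num.max 0 (z - 1) ^+ 3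
   + 3 * Num.max 0 (z - 2) ^+ 3 - Num.max 0 (z - 3) ^+ 3) / 6.

Definition dstep (z : R) : R :=
  (Num.max 0 z ^+ 2 - 3 * Num.max 0 (z - 1) ^+ 2
   + 3 * Num.max 0 (z - 2) ^+ 2 - Num.max 0 (z - 3) ^+ 2) / 2.

Definition ddstep (z : R) : R :=
  Num.max 0 z - 3 * Num.max 0 (z - 1) + 3 * Num.max 0 (z - 2) - Num.max 0 (z - 3).

Lemma is_derive_pos_shiftX n c z :
  is_derive z (1 : R) (fun y => Num.max 0 (y - c) ^+ n.+2)
    (n.+2%:R * Num.max 0 (z - c) ^+ n.+1).
Proof.
apply: is_derive_val (is_derive_comp (is_derive_posX n _)
  (is_derive_add (is_derive_id z (1 : R)) (is_derive_cst (- c) z (1 : R)))) _.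
by rewrite addr0 mulr1.
Qed.

Lemma is_derive_step z : is_derive z (1 : R) step (dstep z).
Proof.
have c (a : R) := is_derive_cst a z (1 : R).
have d j := is_derive_pos_shiftX 1 j z.
rewrite (_ : step = fun y => (Num.max 0 y ^+ 3 + (- 3) * Num.max 0 (y - 1) ^+ 3
   + 3 * Num.max 0 (y - 2) ^+ 3 + (- 1) * Num.max 0 (y - 3) ^+ 3) * 6^-1); last first.
  by apply/funext => y; rewrite /step; ring.
apply: is_derive_val (is_derive_mul (is_derive_add (is_derive_add (is_derive_add
  (is_derive_posX 1 z) (is_derive_mul (c (- 3)) (d 1))) (is_derive_mul (c 3) (d 2)))
  (is_derive_mul (c (- 1)) (d 3))) (c 6^-1)) _.
by rewrite /dstep /=; field.
Qed.

Lemma is_derive_dstep z : is_derive z (1 : R) dstep (ddstep z).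
Proof.
have c (a : R) := is_derive_cst a z (1 : R).
have d j := is_derive_pos_shiftX 0 j z.
rewrite (_ : dstep = fun y => (Num.max 0 y ^+ 2 + (- 3) * Num.max 0 (y - 1) ^+ 2
   + 3 * Num.max 0 (y - 2) ^+ 2 + (- 1) * Num.max 0 (y - 3) ^+ 2) * 2^-1); last first.
  by apply/funext => y; rewrite /dstep; ring.
apply: is_derive_val (is_derive_mul (is_derive_add (is_derive_add (is_derive_add
  (is_derive_posX 0 z) (is_derive_mul (c (- 3)) (d 1))) (is_derive_mul (c 3) (d 2)))
  (is_derive_mul (c (- 1)) (d 3))) (c 2^-1)) _.
by rewrite /ddstep /=; field.
Qed.

Lemma continuous_ddstep : continuous ddstep.
Proof.
have s j : smooth1 0 (fun y : R => Num.max 0 (y - j)).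
  by split=> // y; apply: (@continuous_comp _ _ _ (fun y => y - j) (fun y : R => Num.max 0 y));
    [apply: continuousB; [exact: cvg_id|exact: cst_continuous]|
     exact: continuous_pos].
suff [] : smooth1 0 ddstep by [].
rewrite (_ : ddstep = fun y => Num.max 0 (y - 0) + (- 3) * Num.max 0 (y - 1)
   + 3 * Num.max 0 (y - 2) + (- 1) * Num.max 0 (y - 3)); last first.
  by apply/funext => y; rewrite /ddstep subr0; ring.
have m (c j : R) := smooth1M (smooth1_cst 0 c) (s j).
exact: smooth1D (smooth1D (smooth1D (s 0) (m _ _)) (m _ _)) (m _ _).
Qed.

Lemma step_le0 z : z <= 0 -> [/\ step z = 0, dstep z = 0 & ddstep z = 0].
Proof.
move=> z0; rewrite /step /dstep /ddstep !max_l; do ?lra.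
by rewrite !expr0n /=; split; ring.
Qed.

Lemma step_ge3 z : 3 <= z -> [/\ step z = 1, dstep z = 0 & ddstep z = 0].
Proof.
move=> z3; rewrite /step /dstep /ddstep !max_r; do ?lra.
by split; field.
Qed.

Lemma step_bounds z :
  [/\ 0 <= step z <= 1, 0 <= dstep z <= 1 & `|ddstep z| <= 2].
Proof.
rewrite ler_norml.
have [/step_le0[-> -> ->]|z0] := lerP z 0; first by split; lra.
have [/step_ge3[-> -> ->]|z3] := lerP 3 z; first by split; lra.
rewrite /step /dstep /ddstep (max_r (ltW z0)) (@max_l _ _ 0 (z - 3)); last lra.
(* On each piece the spline is expanded in a variable [u] running over the unit interval; with these
   inequalities the bounds are linear in the powers of [u]. *)
have pow (u : R) : 0 <= u <= 1 -> [/\ 0 <= u ^+ 2 <= u, 0 <= u ^+ 3 <= u ^+ 2 &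
    0 <= 1 - 3 * u ^+ 2 + 2 * u ^+ 3].
  move=> /andP[u0 u1]; have u2 : 0 <= u ^+ 2 by exact: sqr_ge0.
  have v0 : 0 <= (1 - u) ^+ 2 * (1 + 2 * u) by rewrite mulr_ge0 ?sqr_ge0//; lra.
  have E : (1 - u) ^+ 2 * (1 + 2 * u) = 1 - 3 * u ^+ 2 + 2 * u ^+ 3 by ring.
  by rewrite exprSr; split; nra.
have [z1|z1] := lerP 1 z; last first.
  rewrite !max_l; do ?lra.
  have [|h2 h3 _] := pow z; first by lra.
  by rewrite !expr0n /=; split; lra.
rewrite (@max_r _ _ 0 (z - 1)); last lra.
have [z2|z2] := lerP 2 z; last first.
  rewrite !max_l; do ?lra.
  have [|h2 h3 h4] := pow (z - 1); first by lra.
  have E3 : z ^+ 3 = 1 + 3 * (z - 1) + 3 * (z - 1) ^+ 2 + (z - 1) ^+ 3 by ring.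
  have E2 : z ^+ 2 = 1 + 2 * (z - 1) + (z - 1) ^+ 2 by ring.
  have E4 : (2 * (z - 1) - 1) ^+ 2 = 4 * (z - 1) ^+ 2 - 4 * (z - 1) + 1 by ring.
  have h5 := sqr_ge0 (2 * (z - 1) - 1).
  by rewrite E3 E2 !expr0n /=; split; lra.
rewrite max_r; last lra.
have E : (z ^+ 3 - 3 * (z - 1) ^+ 3 + 3 * (z - 2) ^+ 3 - 0 ^+ 3) / 6 =
  1 - (3 - z) ^+ 3 / 6 by field.
have E' : (z ^+ 2 - 3 * (z - 1) ^+ 2 + 3 * (z - 2) ^+ 2 - 0 ^+ 2) / 2 =
  (3 - z) ^+ 2 / 2 by field.
have [|h2 h3 _] := pow (3 - z); first by lra.
by rewrite E E'; split; lra.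
Qed.

(** The middle piece of the quadratic B-spline is concave and equals 1/2 at both ends. This bounds
    the slope of a step from below across a whole layer. *)
Lemma dstep_ge z : 1 <= z <= 2 -> 1 / 2 <= dstep z.
Proof.
move=> /andP[z1 z2]; rewrite /dstep (@max_r _ _ 0 z); last lra.
rewrite (@max_r _ _ 0 (z - 1)); last lra.
rewrite !max_l; do ?lra.
by rewrite !expr0n/=; nra.
Qed.

End positive_part_powers.

(** * Volume of a thin layer outside the sphere *)

Section layer.
Context {R : realType} {N : nat}.
Local Notation mu := (@lebesgue_rV R N).

Lemma is_derive_continuous (k dk : R -> R) :
  (forall y, is_derive y (1 : R) k (dk y)) -> continuous k.
Proof.
move=> kd y; apply: differentiable_continuous; apply/derivable1_diffP.
by have [] := kd y.
Qed.

Lemma norm_gt_sqnorm (M : R) (x : 'rV[R]_N) : 0 <= M -> M < `|x| -> M ^+ 2 < sqnorm x.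
Proof.
move=> M0 Mx; rewrite -(sqr_sqrtr (sqnorm_ge0 x)) -enormE.
by rewrite ltr_pXn2r// ?nnegrE ?sqrtr_ge0// (lt_le_trans Mx)// norm_le_enorm.
Qed.

Lemma continuous_sqnorm_comp (k : R -> R) : continuous k ->
  continuous (fun x : 'rV[R]_N => k (sqnorm x)).
Proof.
move=> ck x; apply: (@continuous_comp _ _ _ (@sqnorm R N) k).
  exact: continuous_sqnorm.
exact: ck.
Qed.

Arguments continuous_sqnorm_comp {k} _ x.

(* The divergence of [x phi(|x|^2)] integrates to zero; for [phi] a steep step
   down at the unit sphere this bounds the volume of the layer. *)
Lemma layer_measure (e : R) : 0 < e <= 1 ->
  (mu [set x | (1 < sqnorm x < 1 + e)%R] <= (N%:R * 4 ^+ N * e)%:E)%E.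
Proof.
move=> /andP[e0 e1].
(* The layer [1 < q < 1 + e] goes to the middle piece of the spline, and the step is complete at
   [q = 1 + 2 e], below 4. *)
pose s (q : R) : R := (q - 1) * e^-1 + 1.
pose phi (q : R) : R := 1 - step (s q).
pose dphi (q : R) : R := - (dstep (s q) / e).
have c (a q : R) := is_derive_cst a q (1 : R).
have sd q : is_derive q (1 : R) s e^-1.
  apply: is_derive_val (is_derive_add (is_derive_mul
    (is_derive_add (is_derive_id q (1 : R)) (c (- 1) q)) (c e^-1 q)) (c 1 q)) _.
  by rewrite /=; ring.
have phid q : is_derive q (1 : R) phi (dphi q).
  rewrite (_ : phi = fun q => 1 + (- 1) * step (s q)); last first.
    by apply/funext => z; rewrite /phi; ring.
  apply: is_derive_val (is_derive_add (c 1 q) (is_derive_mul (c (- 1) q)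
    (is_derive_comp (is_derive_step (s q)) (sd q)))) _.
  by rewrite /dphi /=; ring.
have cphi := is_derive_continuous phid.
have cs := is_derive_continuous sd.
have cdphi : continuous dphi.
  rewrite (_ : dphi = fun q : R => - e^-1 * dstep (s q) : R); last first.
    by apply/funext => q; rewrite /dphi; ring.
  move=> q; refine (continuous_at_mul (continuous_at_cst _ q)
    (continuous_at_comp (is_derive_continuous (@is_derive_dstep R)) (cs q))).
have out q : 4 < q -> phi q = 0 /\ dphi q = 0.
  move=> q4; have [] := @step_ge3 R (s q).
    rewrite /s -lerBlDr ler_pdivlMr//; nra.
  by rewrite /phi /dphi => -> -> _; rewrite subrr mul0r oppr0.
have out4 (x : 'rV[R]_N) : 2 < `|x| -> 4 < sqnorm x.
  by move=> /norm_gt_sqnorm; rewrite (_ : 2 ^+ 2 = 4) => [|]; [exact|ring].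
pose G (i : 'I_N) (x : 'rV[R]_N) : R := x ord0 i * phi (sqnorm x).
pose H (i : 'I_N) (x : 'rV[R]_N) : R := phi (sqnorm x) + x ord0 i * (dphi (sqnorm x) * (2 * x ord0 i)).
have GH i x : is_derive x (unit_vec i) (G i) (H i x).
  apply: is_derive_val (is_derive_mul (is_derive_coord x i i)
    (is_derive_comp (phid (sqnorm x)) (is_derive_sqnorm x i))) _.
  by rewrite /H eqxx mul1r addrC.
have cc (i : 'I_N) := @coord_continuous R 1 N ord0 i.
have cH i : continuous (H i).
  move=> x; exact: (continuous_at_add (continuous_sqnorm_comp cphi x)
    (continuous_at_mul (cc i x) (continuous_at_mul (continuous_sqnorm_comp cdphi x)
      (continuous_at_mul (continuous_at_cst 2 x) (cc i x))))).
have H0 i x : 2 < `|x| -> H i x = 0.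
  by move=> /out4/out[]; rewrite /H => -> ->; rewrite mul0r mulr0 addr0.
have IH i : (\int[mu]_x (H i x)%:E = 0)%E.
  apply: (@integral_partial_eq0 _ _ i (G i) _ 2) => //.
  by move=> x /out4/out[]; rewrite /G => -> _; rewrite mulr0.
(* The divergence is [Q - P], so both have the same integral. [P] is at least [1 / e] on the layer,
   while [Q] is at most [N] and lives in a cube of side 4. *)
pose P (x : 'rV[R]_N) : R := 2 * sqnorm x * (dstep (s (sqnorm x)) / e).
pose Q (x : 'rV[R]_N) : R := N%:R * phi (sqnorm x).
have HE x : \sum_i H i x = Q x - P x.
  rewrite big_split/= sumr_const card_ord /Q -[_ *+ N]mulr_natl; congr (_ + _).
  rewrite (eq_bigr (fun i => 2 * dphi (sqnorm x) * x ord0 i ^+ 2)) => [|i _]; last ring.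
  by rewrite -mulr_sumr -/(sqnorm x) /P /dphi; ring.
have cP : continuous P.
  rewrite (_ : P = fun x => 2 * sqnorm x * (- 1 * dphi (sqnorm x))); last first.
    by apply/funext => x; rewrite /dphi mulN1r opprK.
  move=> x; exact: (continuous_at_mul
    (continuous_at_mul (continuous_at_cst 2 x) (@continuous_sqnorm R N x))
    (continuous_at_mul (continuous_at_cst (- 1) x) (continuous_sqnorm_comp cdphi x))).
have cQ : continuous Q.
  move=> x; exact: (continuous_at_mul (continuous_at_cst N%:R x)
    (continuous_sqnorm_comp cphi x)).
have iP : mu.-integrable setT (EFin \o P).
  apply: (@continuous_integrable_supp _ _ _ 2) => // x /out4/out[_] /eqP.
  by rewrite /dphi oppr_eq0 /P => /eqP ->; rewrite mulr0.
have Q0 x : 2 < `|x| -> Q x = 0 by move=> /out4/out[]; rewrite /Q => -> _; rewrite mulr0.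
have iQ : mu.-integrable setT (EFin \o Q) by exact: (@continuous_integrable_supp _ _ _ 2).
have mP : measurable_fun setT (EFin \o P) by have /integrableP[] := iP.
have mQ : measurable_fun setT (EFin \o Q) by have /integrableP[] := iQ.
have PQ : (\int[mu]_x (P x)%:E = \int[mu]_x (Q x)%:E)%E.
  have : (\int[mu]_x (\sum_i (H i x)%:E) = 0)%E.
    have iH i : mu.-integrable setT (EFin \o H i).
      by apply: (@continuous_integrable_supp _ _ _ 2) => //; exact: H0.
    by rewrite (integral_sum measurableT iH) big1// => i _; exact: IH.
  under eq_integral do rewrite sumEFin HE EFinB.
  rewrite integralB_EFin// => /eqP; rewrite sube_eq ?add0e; last 2 first.
  - exact: (integrable_fin_num measurableT iQ).
  - by rewrite fin_num_adde_defl// (integrable_fin_num measurableT iP).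
  by move/eqP.
pose L := [set x : 'rV[R]_N | 1 < sqnorm x < 1 + e].
have mL : measurable L.
  rewrite (_ : L = [set x | 1 < sqnorm x] `&` [set x | sqnorm x < 1 + e]).
    by apply: measurableI; apply: open_measurable_rV;
      [exact: open_sqnorm_gt|exact: open_sqnorm_lt].
  by apply/seteqP; split=> x; [move=> /andP[]|move=> [h1 h2]; apply/andP].
pose B := [set x : 'rV[R]_N | `|x| <= 2].
have mB : measurable B by apply: compact_measurable_rV; exact: compact_norm_le.
have P0 x : 0 <= P x.
  have [_ /andP[d0 _] _] := step_bounds (s (sqnorm x)).
  rewrite /P; apply: mulr_ge0; first by rewrite mulr_ge0 ?sqnorm_ge0.
  by rewrite divr_ge0 ?(ltW e0).
have h1 : ((e^-1)%:E * mu L <= \int[mu]_x (P x)%:E)%E.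
  rewrite -integral_cst//.
  apply: (@le_trans _ _ (\int[mu]_(x in L) (P x)%:E)%E); last first.
    apply: ge0_subset_integral => //.
    by move=> x _; rewrite lee_fin.
  apply: ge0_le_integral => //.
  - by move=> x _; rewrite lee_fin invr_ge0 ltW.
  - by apply: (measurable_funS measurableT) mP.
  move=> x /andP[x1 x2]; rewrite lee_fin /P.
  have : 1 / 2 <= dstep (s (sqnorm x)).
    apply: dstep_ge; rewrite /s; apply/andP; split.
      by rewrite lerDr mulr_ge0 ?invr_ge0 ?(ltW e0)// subr_ge0 ltW.
    have : (sqnorm x - 1) / e <= 1 by rewrite ler_pdivrMr// mul1r; lra.
    lra.
  move=> h; rewrite mulrA ler_pMl ?invr_gt0//; nra.
have h2 : (\int[mu]_x (Q x)%:E <= (N%:R * 4 ^+ N)%:E)%E.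
  rewrite (_ : (fun x => _) = (EFin \o Q) \_ B); last first.
    apply/funext => x; rewrite patchE; case: ifPn => //.
    by rewrite notin_setE /B /= => /negP; rewrite -ltNge => /Q0 ->.
  rewrite -integral_mkcond.
  apply: (@le_trans _ _ (\int[mu]_(x in B) (N%:R)%:E)%E).
    apply: ge0_le_integral => //.
    - move=> x _; rewrite lee_fin mulr_ge0// subr_ge0.
      by have [/andP[_]] := step_bounds (s (sqnorm x)).
    - by apply: (measurable_funS measurableT) mQ.
    - move=> x _; rewrite lee_fin /Q ler_piMr// /phi gerBl.
      by have [/andP[]] := step_bounds (s (sqnorm x)).
  rewrite integral_cst// EFinM lee_wpmul2l ?lee_fin//.
  apply: (@le_trans _ _ (mu [set x | forall i, `|x ord0 i| <= 2])).
    apply: le_measure; rewrite ?inE//.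
      apply: (measurable_rV_coords (P := fun i => [set z | `|z| <= 2])) => i.
      rewrite (_ : mkset _ = `[- 2, 2]%classic)//.
      by apply/seteqP; split=> z /=; rewrite in_itv/= ler_norml.
    by move=> x Bx i; exact: le_trans (coord_le_norm x i) Bx.
  by rewrite lebesgue_rV_box_le// -natrM.
have := le_trans h1 (eq_ind_r (fun z => z <= _)%E h2 PQ).
by rewrite lee_pdivrMl// -EFinM mulrC.
Qed.

End layer.

(** * Truncating a radial factor near the sphere *)

Section cutoff.
Context {R : realType}.

Lemma continuous_bounded_itv (f : R -> R) (a b : R) : continuous f ->
  exists2 A, 0 <= A & forall y, a <= y <= b -> `|f y| <= A.
Proof.
move=> cf; have cS : compact `[a, b]%classic by exact: segment_compact.
have cf' : {within `[a, b], continuous f} by exact: continuous_subspaceT.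
have /compact_bounded[M [Mr bM]] := continuous_compact cf' cS.
exists (`|M| + 1) => [|y yab]; first by rewrite addr_ge0.
apply: (bM (`|M| + 1)); first by rewrite (le_lt_trans (ler_norm M))// ltrDl.
by exists y => //=; rewrite in_itv.
Qed.

(** [V] is [v] times a step rising between [e] and [4 e]. The second derivative of the step costs
    [1 / e^2], but there [|v| <= A y] is [O(e)], which saves one factor. The constant is fixed
    before [e]. *)
Lemma cutoff (v v1 v2 : R -> R) :
  (forall y, is_derive y (1 : R) v (v1 y)) ->
  (forall y, is_derive y (1 : R) v1 (v2 y)) -> continuous v2 -> v 0 = 0 ->
  exists2 C, 0 <= C & forall e, 0 < e <= 1 / 4 -> exists V V1 V2 : R -> R,
    [/\ [/\ forall y, is_derive y (1 : R) V (V1 y),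
          forall y, is_derive y (1 : R) V1 (V2 y) & continuous V2],
        forall y, y <= e -> [/\ V y = 0, V1 y = 0 & V2 y = 0],
        forall y, 4 * e <= y -> [/\ V y = v y, V1 y = v1 y & V2 y = v2 y] &
        forall y, 0 <= y <= 4 * e ->
          [/\ `|V y| <= C, `|V1 y| <= C / e & `|V2 y| <= C / e]].
Proof.
move=> vd v1d cv2 v0.
have cv := is_derive_continuous vd; have cv1 := is_derive_continuous v1d.
have [A A0 vA] : exists2 A, 0 <= A & forall y, 0 <= y <= 1 ->
    [/\ `|v y| <= A * y, `|v1 y| <= A & `|v2 y| <= A].
  have [A1 A10 bA1] := continuous_bounded_itv 0 1 cv1.
  have [A2 A20 bA2] := continuous_bounded_itv 0 1 cv2.
  exists (A1 + A2) => [|y y01]; first by rewrite addr_ge0.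
  have h1 := bA1 y y01; have h2 := bA2 y y01.
  split; [|by rewrite (le_trans h1)// lerDl|by rewrite (le_trans h2)// lerDr].
  have /andP[y0 y1] := y01.
  have [c] := @MVT_segment R v v1 0 y y0 (fun x _ => vd x) (continuous_subspaceT cv).
  rewrite in_itv/= => /andP[c0 cy]; rewrite v0 !subr0 => ->.
  rewrite normrM (ger0_norm y0) ler_wpM2r// (le_trans (bA1 c _)) ?lerDl//.
  by rewrite c0 (le_trans cy).
(* The terms of [V2] are bounded by [8], [1], [1] and [1] times [A / e]; the bounds on [V] and [V1]
   are smaller. *)
exists (11 * A) => [|e /andP[e0 e1]]; first by rewrite mulr_ge0.
have en : e != 0 by rewrite gt_eqF.
pose s (y : R) : R := y * e^-1 - 1.
pose h (y : R) : R := step (s y).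
pose h1 (y : R) : R := dstep (s y) * e^-1.
pose h2 (y : R) : R := ddstep (s y) * e^-1 * e^-1.
have c (a q : R) := is_derive_cst a q (1 : R).
have sd q : is_derive q (1 : R) s e^-1.
  apply: is_derive_val (is_derive_add (is_derive_mul
    (is_derive_id q (1 : R)) (c e^-1 q)) (c (- 1) q)) _.
  by rewrite /=; ring.
have hd q : is_derive q (1 : R) h (h1 q).
  exact: (is_derive_comp (is_derive_step (s q)) (sd q)).
have h1d q : is_derive q (1 : R) h1 (h2 q).
  apply: is_derive_val (is_derive_mul
    (is_derive_comp (is_derive_dstep (s q)) (sd q)) (c e^-1 q)) _.
  by rewrite /h2 /=; ring.
have ch2 : continuous h2.
  move=> q; exact: (continuous_at_mul (continuous_at_mul
    (continuous_at_comp (@continuous_ddstep R) (is_derive_continuous sd (x := q)))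
    (continuous_at_cst e^-1 q)) (continuous_at_cst e^-1 q)).
exists (fun y => v y * h y), (fun y => v y * h1 y + v1 y * h y),
  (fun y => (v y * h2 y + v1 y * h1 y) + (v1 y * h1 y + v2 y * h y)); split.
- split=> y; [exact: is_derive_mul| |].
    by apply: is_derive_add; exact: is_derive_mul.
  have ch1 := is_derive_continuous h1d; have ch := is_derive_continuous hd.
  exact: (continuous_at_add
    (continuous_at_add (continuous_at_mul (cv y) (ch2 y))
                       (continuous_at_mul (cv1 y) (ch1 y)))
    (continuous_at_add (continuous_at_mul (cv1 y) (ch1 y))
                       (continuous_at_mul (cv2 y) (ch y)))).
- move=> y ye; have [|e1' e2' e3'] := @step_le0 R (s y).
    by rewrite /s subr_le0 ler_pdivrMr// mul1r.
  by rewrite /h /h1 /h2 e1' e2' e3'; split; ring.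
- move=> y ye; have [|e1' e2' e3'] := @step_ge3 R (s y).
    by rewrite /s lerBrDr ler_pdivlMr//; lra.
  by rewrite /h /h1 /h2 e1' e2' e3'; split; ring.
move=> y /andP[y0 y4].
have [|hv hv1 hv2] := vA y; first by rewrite y0; lra.
have [/andP[b1 b2] /andP[b3 b4] b5] := step_bounds (s y).
have ie : 4 <= e^-1 by rewrite -[4]invrK lef_pV2 ?posrE ?invr_gt0//; lra.
have i0 : 0 < e^-1 by rewrite invr_gt0.
have Hh : `|h y| <= 1 by rewrite ger0_norm.
have Hh1 : `|h1 y| <= e^-1.
  by rewrite normrM (ger0_norm b3) (gtr0_norm i0) ler_piMl// ltW.
have Hh2 : `|h2 y| <= 2 * e^-1 * e^-1.
  by rewrite 2!normrM (gtr0_norm i0) !ler_wpM2r// ltW.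
have Hv : `|v y| <= A * (4 * e) by rewrite (le_trans hv)// ler_wpM2l.
have He : e * e^-1 = 1 by rewrite divff.
have Ae : A <= A * e^-1 by rewrite ler_peMr//; lra.
have M (a b a' b' : R) : `|a| <= a' -> `|b| <= b' -> `|a * b| <= a' * b'.
  by move=> ? ?; rewrite normrM ler_pM.
have k1 : `|v y * h1 y| <= 4 * A.
  by apply: (le_trans (M _ _ _ _ Hv Hh1)); rewrite -mulrA -(mulrA 4) He; lra.
have k2 : `|v1 y * h y| <= A.
  by apply: (le_trans (M _ _ _ _ hv1 Hh)); rewrite mulr1.
have k3 : `|v y * h2 y| <= 8 * (A * e^-1).
  apply: (le_trans (M _ _ _ _ Hv Hh2)).
  have -> : A * (4 * e) * (2 * e^-1 * e^-1) = 8 * (A * e^-1) * (e * e^-1) by ring.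
  by rewrite He mulr1.
have k4 : `|v1 y * h1 y| <= A * e^-1 by exact: M.
have k5 : `|v2 y * h y| <= A by apply: (le_trans (M _ _ _ _ hv2 Hh)); rewrite mulr1.
have Ai : 11 * A / e = 11 * (A * e^-1) by ring.
split.
- by apply: (le_trans (M _ _ _ _ Hv Hh)); rewrite mulr1 mulrC ler_wpM2r//; lra.
- by rewrite Ai (le_trans (ler_normD _ _))//; lra.
- rewrite Ai (le_trans (ler_normD _ _))//.
  have := ler_normD (v y * h2 y) (v1 y * h1 y).
  have := ler_normD (v1 y * h1 y) (v2 y * h y); lra.
Qed.

End cutoff.

Section near_sphere.
Context {R : realType} {N : nat}.

(** Uniformity comes from compactness: points violating the bound ever closer to the sphere cluster
    at a point of the sphere, where the limit 0 contradicts them. *)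
Lemma zero_on_sphere_uniform (w : 'rV[R]_N -> R) : zero_on_sphere w ->
  forall d, 0 < d -> exists2 e, 0 < e &
    forall x, Omega_e x -> sqnorm x < 1 + e -> `|w x| < d.
Proof.
move=> w0 d d0; apply: contrapT => nE.
have P (n : nat) : exists x, [/\ Omega_e x, sqnorm x < 1 + n.+1%:R^-1 & d <= `|w x|].
  apply: contrapT => nP; apply: nE; exists (n.+1%:R^-1); first by rewrite invr_gt0.
  move=> x Ox xn; rewrite ltNge; apply/negP => dw; apply: nP; exists x; split=> //.
have {P} [x xP] := choice P.
pose K := [set y : 'rV[R]_N | `|y| <= 2].
have cK : compact K by exact: compact_norm_le.
have xK : \forall n \near \oo, K (x n).
  near=> n; rewrite /K /= leNgt; apply/negP => /norm_gt_sqnorm x2.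
  have [_ + _] := xP n; apply/negP; rewrite -leNgt.
  apply: le_trans (ltW (x2 _)) => //.
  have : (n.+1%:R^-1 : R) <= 1 by rewrite invf_le1// ler1n.
  by move=> h; rewrite expr2 (le_trans (lerD (lexx 1) h))//; lra.
have [y [_ /= yx]] := cK (x @ \oo) _ xK.
have ysub (A : set 'rV[R]_N) (n0 : nat) : nbhs y A ->
    exists2 n, (n0 <= n)%N & A (x n).
  move=> Ay; have [_ [[n /= n0n <-] An]] :=
      yx (x @` [set n | (n0 <= n)%N]) A (ltac:(exists n0 => // n /= nn; exists n => //)) Ay.
  by exists n.
have y1 : sqnorm y = 1.
  apply/eqP; rewrite eq_le; apply/andP; split.
    rewrite leNgt; apply/negP => y1.
    pose k := Num.bound (sqnorm y - 1)^-1.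
    have k1 : k.+1%:R^-1 < sqnorm y - 1.
      rewrite -[ltRHS]invrK ltf_pV2 ?posrE ?invr_gt0 ?subr_gt0//.
      have : (sqnorm y - 1)^-1 < k%:R by apply: archi_boundP; rewrite invr_ge0 subr_ge0 ltW.
      by move=> /lt_le_trans; apply; rewrite ler_nat.
    have [n kn] := ysub _ k (open_nbhs_nbhs (conj (@open_sqnorm_gt _ _ (1 + k.+1%:R^-1))
      (ltac:(by rewrite -ltrBrDl) : 1 + k.+1%:R^-1 < sqnorm y))).
    move=> /= h1; have [_ h2 _] := xP n; have := lt_trans h1 h2.
    rewrite ltrD2l ltf_pV2 ?posrE// ltr_nat ltnS ltnNge.
    by rewrite kn.
  rewrite leNgt; apply/negP => y1.
  have [n _ /= h1] := ysub _ 0%N (open_nbhs_nbhs (conj (@open_sqnorm_lt _ _ 1) y1)).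
  have [+ _ _] := xP n; rewrite Omega_eE /= => /(lt_trans h1).
  by rewrite ltxx.
have /w0 /cvgr0_norm_lt/(_ d d0) : unit_sphere y.
  by rewrite /unit_sphere /= enormE y1 sqrtr1.
move=> /(ysub _ 0%N)[n _ /=]; have [Ox _ dw] := xP n.
by move=> /(_ Ox); rewrite ltNge dw.
Unshelve. all: by end_near. Qed.

End near_sphere.

(** * Green's formula against a radial factor *)

Section Green.
Context {R : realType} {N : nat}.
Local Notation mu := (@lebesgue_rV R N).
Implicit Types (x : 'rV[R]_N) (w F : 'rV[R]_N -> R).

Lemma ln_norm_bounded (M : R) : exists Z : R, forall x, `|x| <= M -> ln_norm x <= Z.
Proof.
exists (N%:R * M ^+ 2 / 2) => x xM; rewrite ler_pM2r ?invr_gt0//.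
have qM : sqnorm x <= N%:R * M ^+ 2.
  rewrite -[N in leRHS]card_ord mulr_natl -sumr_const; apply: ler_sum => i _.
  rewrite -real_normK ?num_real// lerXn2r ?nnegrE//; first exact: le_trans xM.
  exact: le_trans (coord_le_norm x i) xM.
have [x0|x0] := ltP 0 (sqnorm x).
  by rewrite (le_trans _ qM)// ltW// ln_sublinear.
by rewrite ln0// (le_trans _ qM)// sqnorm_ge0.
Qed.

Lemma Omega_e_sqnorm_gt0 x : Omega_e x -> 0 < sqnorm x.
Proof. by rewrite Omega_eE /= => /(lt_trans ltr01). Qed.

Lemma integrable_Omega_e F (B M : R) : {in Omega_e, continuous F} ->
  (forall x, Omega_e x -> `|F x| <= B) -> (forall x, Omega_e x -> M < `|x| -> F x = 0) ->
  mu.-integrable Omega_e (EFin \o F).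
Proof.
move=> cF FB F0; have mO := @measurable_Omega_e R N.
have mB : measurable [set x : 'rV[R]_N | `|x| <= M].
  by apply: compact_measurable_rV; exact: compact_norm_le.
have mK : measurable (Omega_e `&` [set x : 'rV[R]_N | `|x| <= M]) by exact: measurableI.
have mF : measurable_fun Omega_e F.
  by apply: continuous_measurable_fun_rV => //; exact: open_Omega_e.
have : mu.-integrable (Omega_e `&` [set x | `|x| <= M]) (EFin \o F).
  apply: measurable_bounded_integrable => //.
  - by apply: (@lebesgue_rV_bounded_lty _ _ _ M) => // x [].
  - by apply: measurable_funS mF => //; exact: subIsetl.
  - exists B; split; first exact: num_real.
    by move=> y By x [Ox _] /=; rewrite (le_trans (FB x Ox))// ltW.
move/(integrable_mkcond _ mK) => h; apply/(integrable_mkcond _ mO).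
rewrite (_ : _ \_ _ = (EFin \o F) \_ (Omega_e `&` [set x | `|x| <= M]))//.
apply/funext => x; rewrite !patchE.
have [Ox|nOx] := pselect (Omega_e x); last first.
  by rewrite !memNset// => -[].
have [xM|xM] := leP `|x| M; first by rewrite !mem_set.
rewrite mem_set// memNset/= ?F0// => -[_].
by rewrite /= leNgt xM.
Qed.

Lemma continuous_near0 w (O : set 'rV[R]_N) x : open O -> O x ->
  (forall y, O y -> w y = 0) -> {for x, continuous w}.
Proof.
move=> oO Ox w0; change (w @ x --> w x); rewrite (w0 x Ox).
have h : {near x, (fun=> 0 : R) =1 w}.
  by have := open_nbhs_nbhs (conj oO Ox); apply: filterS => y Oy; rewrite /= w0.
exact: cvg_trans (near_eq_cvg h) (cvg_cst _).
Qed.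

Definition radial_laplacian (v1 v2 : R -> R) x : R :=
  @radial_lap R N v1 v2 (ln_norm x).

Lemma continuous_radial (k : R -> R) x : continuous k -> Omega_e x ->
  {for x, continuous (fun y => k (ln_norm y))}.
Proof.
move=> ck /Omega_e_sqnorm_gt0 x0; apply: (continuous_at_comp ck).
exact: continuous_ln_norm.
Qed.

Lemma continuous_radial_laplacian (v1 v2 : R -> R) x :
  continuous v1 -> continuous v2 -> Omega_e x ->
  {for x, continuous (radial_laplacian v1 v2)}.
Proof.
rewrite /radial_laplacian /radial_lap => c1 c2 Ox; have ce := smooth1_continuous (smooth1_expRM 0 (- 2 : R)).
exact: (continuous_at_mul (continuous_radial ce Ox)
  (continuous_at_add (continuous_radial c2 Ox)
    (continuous_at_mul (continuous_at_cst (N%:R - 2) x) (continuous_radial c1 Ox)))).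
Qed.

Lemma radial_laplacian_bound (v1 v2 : R -> R) x (A : R) : Omega_e x ->
  `|v1 (ln_norm x)| <= A -> `|v2 (ln_norm x)| <= A ->
  `|radial_laplacian v1 v2 x| <= A * (N%:R + 3).
Proof.
move=> /Omega_e_ln_norm Y0 h1 h2; rewrite /radial_laplacian /radial_lap normrM.
have A0 : 0 <= A by exact: le_trans h1.
have e1 : `|expR (- 2 * ln_norm x)| <= 1.
  by rewrite ger0_norm ?expR_ge0// expR_le1; lra.
have N2 : `|N%:R - 2 : R| <= N%:R + 2.
  by rewrite (le_trans (ler_normB _ _))// !ger0_norm.
rewrite -[leRHS]mul1r ler_pM// (le_trans (ler_normD _ _))// normrM.
have : `|N%:R - 2 : R| * `|v1 (ln_norm x)| <= (N%:R + 2) * A by rewrite ler_pM.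
lra.
Qed.

(** The integrand is the divergence of [V grad w - w grad V]. As [V] vanishes for [y <= e], this
    field vanishes near the complement of [Omega_e], so it is differentiable on the whole space with
    bounded support. *)
Lemma green_interior w (wi wii : 'I_N -> 'rV[R]_N -> R) (M e : R) (V V1 V2 : R -> R) :
  (forall i x, Omega_e x -> is_derive x (unit_vec i) w (wi i x)) ->
  (forall i x, Omega_e x -> is_derive x (unit_vec i) (wi i) (wii i x)) ->
  (forall x, Omega_e x -> {for x, continuous w}) ->
  (forall i x, Omega_e x -> {for x, continuous (wii i)}) ->
  (forall x, Omega_e x -> M < `|x| -> w x = 0) ->
  0 < e -> (forall y, is_derive y (1 : R) V (V1 y)) ->
  (forall y, is_derive y (1 : R) V1 (V2 y)) -> continuous V2 ->
  (forall y, y <= e -> [/\ V y = 0, V1 y = 0 & V2 y = 0]) ->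
  (\int[mu]_(x in Omega_e)
     (V (ln_norm x) * (\sum_i wii i x) - w x * radial_laplacian V1 V2 x)%:E = 0)%E.
Proof.
move=> wd wid cw cwii w0 e0 Vd V1d cV2 Ve.
have cV := is_derive_continuous Vd; have cV1 := is_derive_continuous V1d.
have oOM : open (@Omega_e R N `&` [set x | M < `|x|]).
  apply: openI; first exact: open_Omega_e.
  by apply: (open_comp (fun x _ => @norm_continuous _ _ x) (@open_gt _ _)).
have wi0 i x : Omega_e x -> M < `|x| -> wi i x = 0.
  move=> Ox xM; have [_ <-] := wd i x Ox.
  have := is_derive_open (g := w) oOM (conj Ox xM)
    (fun y Oy => esym (w0 y Oy.1 Oy.2)) (is_derive_cst 0 x (unit_vec i)).
  by case=> _ ->.
pose O := [set x : 'rV[R]_N | ln_norm x < e].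
have oO : open O.
  rewrite (_ : O = [set x | sqnorm x < expR (2 * e)]); first exact: open_sqnorm_lt.
  by apply/funext => x; rewrite /O /= ln_norm_lt.
have VO x : O x -> [/\ V (ln_norm x) = 0, V1 (ln_norm x) = 0 & V2 (ln_norm x) = 0].
  by move=> /ltW; exact: Ve.
have cover x : ~ Omega_e x -> O x.
  move=> nO; rewrite /O /=; apply: le_lt_trans e0; rewrite leNgt; apply/negP => Y0.
  by apply: nO; apply/Omega_e_ln_norm.
pose G (i : 'I_N) x : R := V (ln_norm x) * wi i x
  - w x * (expR (- 2 * ln_norm x) * V1 (ln_norm x) * x ord0 i).
pose H (i : 'I_N) x : R := V (ln_norm x) * wii i x
  - w x * radial_hess (V1 (ln_norm x)) (V2 (ln_norm x)) x i.
have G0 i x : O x -> G i x = 0.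
  by move=> /VO[]; rewrite /G => -> -> _; rewrite !(mul0r, mulr0) subr0.
have H0 i x : O x -> H i x = 0.
  by move=> /VO[]; rewrite /H /radial_hess => -> -> ->; rewrite !(mul0r, mulr0, subr0, addr0).
have GH i x : is_derive x (unit_vec i) (G i) (H i x).
  have [Ox|/cover Ox] := pselect (Omega_e x); last first.
    rewrite H0//.
    exact: (is_derive_open oO Ox (fun y Oy => esym (G0 i y Oy)) (is_derive_cst 0 x _)).
  have x0 := Omega_e_sqnorm_gt0 Ox.
  rewrite (_ : G i = fun x => V (ln_norm x) * wi i x
     + (- 1) * (w x * (expR (- 2 * ln_norm x) * V1 (ln_norm x) * x ord0 i))); last first.
    by apply/funext => y; rewrite /G; ring.
  apply: is_derive_val (is_derive_add
    (is_derive_mul (is_derive_radial i x0 (Vd _)) (wid i x Ox))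
    (is_derive_mul (is_derive_cst (- 1 : R) x (unit_vec i))
      (is_derive_mul (wd i x Ox) (is_derive_radial_grad i x0 (V1d _))))) _.
  by rewrite /H /=; ring.
have cH i : continuous (H i).
  move=> x; have [Ox|/cover Ox] := pselect (Omega_e x); last first.
    exact: continuous_near0 oO Ox (H0 i).
  rewrite (_ : H i = fun x => V (ln_norm x) * wii i x
     + (- 1) * (w x * (expR (- 2 * ln_norm x) * V1 (ln_norm x) +
     expR (- 2 * ln_norm x) * (expR (- 2 * ln_norm x) *
       (V2 (ln_norm x) + (- 2) * V1 (ln_norm x))) * (x ord0 i * x ord0 i)))); last first.
    by apply/funext => y; rewrite /H /radial_hess; ring.
  have ce := continuous_radial (smooth1_continuous (smooth1_expRM 0 (- 2 : R))) Ox.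
  have c1 := continuous_radial cV1 Ox; have c2 := continuous_radial cV2 Ox.
  have ci := @coord_continuous R 1 N ord0 i x.
  exact: (continuous_at_add (continuous_at_mul (continuous_radial cV Ox) (cwii i x Ox))
    (continuous_at_mul (continuous_at_cst (- 1) x) (continuous_at_mul (cw x Ox)
      (continuous_at_add (continuous_at_mul ce c1)
        (continuous_at_mul (continuous_at_mul ce (continuous_at_mul ce
          (continuous_at_add c2 (continuous_at_mul (continuous_at_cst (- 2) x) c1))))
            (continuous_at_mul ci ci)))))).
have GM i x : M < `|x| -> G i x = 0.
  move=> xM; have [Ox|/cover Ox] := pselect (Omega_e x); last exact: G0.
  by rewrite /G w0// wi0// mulr0 mul0r subr0.
have oM : open [set x : 'rV[R]_N | M < `|x|].
  by apply: (open_comp (fun x _ => @norm_continuous _ _ x) (@open_gt _ _)).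
have HM i x : M < `|x| -> H i x = 0.
  move=> xM; have [_ <-] := GH i x.
  have := is_derive_open (g := G i) oM xM
    (fun y yM => esym (GM i y yM)) (is_derive_cst 0 x (unit_vec i)).
  by case=> _ ->.
rewrite integral_mkcond (_ : _ \_ _ = fun x => (\sum_i (H i x)%:E)%E); last first.
  apply/funext => x; rewrite patchE sumEFin.
  have [Ox|nOx] := pselect (Omega_e x); last first.
    by rewrite memNset// big1// => i _; rewrite H0//; exact: cover.
  rewrite mem_set//; congr EFin; rewrite sumrB -!mulr_sumr; congr (_ - _ * _).
  by rewrite sum_radial_hess//; exact: Omega_e_sqnorm_gt0.
have iH i : mu.-integrable setT (EFin \o H i).
  by apply: (@continuous_integrable_supp _ _ _ M) => //; exact: HM.
rewrite (integral_sum measurableT iH) big1// => i _.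
exact: (integral_partial_eq0 (cH i) (GM i) (GH i)).
Qed.

End Green.

Section Green_formula.
Context {R : realType} {N : nat}.
Local Notation mu := (@lebesgue_rV R N).
Implicit Types (x : 'rV[R]_N) (w F : 'rV[R]_N -> R).

Lemma is_derive_far w (dw : 'rV[R]_N -> R) (M : R) (i : 'I_N) :
  (forall x, Omega_e x -> is_derive x (unit_vec i) w (dw x)) ->
  (forall x, Omega_e x -> M < `|x| -> w x = 0) ->
  forall x, Omega_e x -> M < `|x| -> dw x = 0.
Proof.
move=> wd w0 x Ox xM; have [_ <-] := wd x Ox.
have oOM : open (@Omega_e R N `&` [set x | M < `|x|]).
  apply: openI; first exact: open_Omega_e.
  by apply: (open_comp (fun x _ => @norm_continuous _ _ x) (@open_gt _ _)).
have := is_derive_open (g := w) oOM (conj Ox xM)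
  (fun y Oy => esym (w0 y Oy.1 Oy.2)) (is_derive_cst 0 x (unit_vec i)).
by case=> _ ->.
Qed.

Lemma layer_measure_ln (e : R) : 0 < e -> 8 * expR 1 * e <= 1 ->
  measurable [set x : 'rV[R]_N | 0 < ln_norm x < 4 * e] /\
  (mu [set x | (0 < ln_norm x < 4 * e)%R] <= (N%:R * 4 ^+ N * (8 * expR 1) * e)%:E)%E.
Proof.
move=> e0 e1; have E : [set x : 'rV[R]_N | 0 < ln_norm x < 4 * e] =
    Omega_e `&` [set x | sqnorm x < expR (2 * (4 * e))].
  apply/seteqP; split=> x /=.
    by move=> /andP[/Omega_e_ln_norm Ox]; rewrite ln_norm_lt ?mulr_gt0.
  move=> [/Omega_e_ln_norm -> /=]; rewrite ln_norm_lt ?mulr_gt0//.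
have mS : measurable [set x : 'rV[R]_N | 0 < ln_norm x < 4 * e].
  rewrite E; apply: measurableI; first exact: measurable_Omega_e.
  by apply: open_measurable_rV; exact: open_sqnorm_lt.
split=> //; have x1 : 1 <= expR 1 :> R by rewrite -expR0 ler_expR.
have z1 : 2 * (4 * e) <= 1 by nra.
(* This is [e^z <= 1 + z e^z], rewritten from [1 - z <= e^(-z)], for [z = 8 e <= 1]. *)
have z2 : expR (2 * (4 * e)) <= 1 + 8 * expR 1 * e.
  have h1 : 1 - 2 * (4 * e) <= (expR (2 * (4 * e)))^-1.
    by rewrite -expRN; exact: expR_ge1Dx.
  have h2 : expR (2 * (4 * e)) <= expR 1 by rewrite ler_expR.
  have h3 := expR_gt0 (2 * (4 * e)).
  have : (1 - 2 * (4 * e)) * expR (2 * (4 * e)) <= 1 by rewrite -ler_pdivlMr// div1r.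
  nra.
rewrite -mulrA; apply: le_trans (layer_measure (N := N) (e := 8 * expR 1 * e) _); last first.
  by rewrite e1 andbT !mulr_gt0// expR_gt0.
apply: le_measure; rewrite ?inE//.
  rewrite (_ : [set x | _] = Omega_e `&` [set x | sqnorm x < 1 + 8 * expR 1 * e]).
    apply: measurableI; first exact: measurable_Omega_e.
    by apply: open_measurable_rV; exact: open_sqnorm_lt.
  rewrite Omega_eE; apply/seteqP; split=> x /=; first by move=> /andP.
  by move=> ?; apply/andP.
rewrite E Omega_eE => x /= [-> /=] /lt_le_trans; apply; exact: z2.
Qed.

(** Replacing [v] by its truncation gives an exact identity, and the difference lives on
    [0 < y < 4 e]. There the term with the Laplacian of [w] is bounded and contributes [O(e)]; the
    other term is at most [sup |w|] times [O(1 / e)] and contributes [O(sup |w|)], small by the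
    boundary condition on [w]. *)
Lemma green w (wi wii : 'I_N -> 'rV[R]_N -> R) (M B : R) (v v1 v2 : R -> R) :
  (forall i x, Omega_e x -> is_derive x (unit_vec i) w (wi i x)) ->
  (forall i x, Omega_e x -> is_derive x (unit_vec i) (wi i) (wii i x)) ->
  (forall x, Omega_e x -> {for x, continuous w}) ->
  (forall i x, Omega_e x -> {for x, continuous (wii i)}) ->
  (forall x, Omega_e x -> M < `|x| -> w x = 0) ->
  (forall x, Omega_e x -> `|w x| <= B /\ `|\sum_i wii i x| <= B) ->
  zero_on_sphere w ->
  (forall y, is_derive y (1 : R) v (v1 y)) ->
  (forall y, is_derive y (1 : R) v1 (v2 y)) -> continuous v2 -> v 0 = 0 ->
  (\int[mu]_(x in Omega_e) (v (ln_norm x) * \sum_i wii i x)%:E =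
   \int[mu]_(x in Omega_e) (w x * radial_laplacian v1 v2 x)%:E)%E.
Proof.
move=> wd wid cw cwii w0 wB wS vd v1d cv2 v0.
have cv := is_derive_continuous vd; have cv1 := is_derive_continuous v1d.
have wi0 i := is_derive_far (wd i) w0.
have wii0 i := is_derive_far (wid i) (wi0 i).
have lw0 x : Omega_e x -> M < `|x| -> \sum_i wii i x = 0.
  by move=> Ox xM; rewrite big1// => i _; exact: wii0.
have clw x : Omega_e x -> {for x, continuous (fun x => \sum_i wii i x)}.
  move=> Ox; rewrite (_ : (fun x => _) = \sum_i wii i); last first.
    by apply/funext => y; rewrite fct_sumE.
  elim/big_ind: _ => [|f g cf cg|j _]; first exact: cst_continuous.
    exact: continuousD.
  exact: cwii.
have [Z YZ] := ln_norm_bounded (N := N) M.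
have bnd (f : R -> R) : continuous f -> exists2 A, 0 <= A &
    forall x, Omega_e x -> `|x| <= M -> `|f (ln_norm x)| <= A.
  move=> cf; have [A A0 fA] := continuous_bounded_itv 0 Z cf; exists A => // x Ox xM.
  by apply: fA; rewrite YZ// andbT ltW//; exact/Omega_e_ln_norm.
have [A A0 vA] := bnd v cv; have [A1 A10 vA1] := bnd v1 cv1.
have [A2 A20 vA2] := bnd v2 cv2.
have cvlw x : Omega_e x -> {for x, continuous (fun x => v (ln_norm x) * \sum_i wii i x)}.
  by move=> Ox; exact: (continuous_at_mul (continuous_radial cv Ox) (clw x Ox)).
have cwlv x : Omega_e x -> {for x, continuous (fun x => w x * radial_laplacian v1 v2 x)}.
  by move=> Ox; exact: (continuous_at_mul (cw x Ox) (continuous_radial_laplacian cv1 cv2 Ox)).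
have i1 : mu.-integrable Omega_e (EFin \o (fun x => v (ln_norm x) * \sum_i wii i x)).
  apply: (@integrable_Omega_e _ _ _ (A * B) M) => [x /[!inE]|x Ox|x Ox xM].
  - exact: cvlw.
  - have [xM|xM] := leP `|x| M; last first.
      rewrite lw0// mulr0 normr0 mulr_ge0//.
      by have [+ _] := wB x Ox; exact: le_trans.
    by rewrite normrM ler_pM// ?vA//; have [] := wB x Ox.
  - by rewrite lw0// mulr0.
have i2 : mu.-integrable Omega_e (EFin \o (fun x => w x * radial_laplacian v1 v2 x)).
  apply: (@integrable_Omega_e _ _ _ (B * ((A1 + A2) * (N%:R + 3))) M) => [x /[!inE]|x Ox|x Ox xM].
  - exact: cwlv.
  - have B0 : 0 <= B by have [+ _] := wB x Ox; exact: le_trans.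
    have [xM|xM] := leP `|x| M; last first.
      by rewrite w0// mul0r normr0 !mulr_ge0// addr_ge0.
    rewrite normrM ler_pM//; first by have [] := wB x Ox.
    apply: radial_laplacian_bound => //.
      by rewrite (le_trans (vA1 x Ox xM))// lerDl.
    by rewrite (le_trans (vA2 x Ox xM))// lerDr.
  - by rewrite w0// mul0r.
pose J x := v (ln_norm x) * (\sum_i wii i x) - w x * radial_laplacian v1 v2 x.
have JE : (\int[mu]_(x in Omega_e) (J x)%:E =
    \int[mu]_(x in Omega_e) (v (ln_norm x) * \sum_i wii i x)%:E -
    \int[mu]_(x in Omega_e) (w x * radial_laplacian v1 v2 x)%:E)%E.
  rewrite -integralB_EFin//; exact: measurable_Omega_e.
have mO := @measurable_Omega_e R N.
have f1 := integrable_fin_num mO i1; have f2 := integrable_fin_num mO i2.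
have iJ : mu.-integrable Omega_e (EFin \o J).
  by have := integrableB mO i1 i2; apply: eq_integrable.
suff J0 : (\int[mu]_(x in Omega_e) (J x)%:E = 0)%E.
  move: JE; rewrite J0 => /esym/eqP; rewrite sube_eq ?fin_num_adde_defl//.
  by rewrite add0e => /eqP.
have fJ := integrable_fin_num mO iJ.
have [C C0 cut] := cutoff vd v1d cv2 v0.
have [a a0 va] : exists2 a, 0 <= a & forall y, 0 <= y <= 1 ->
    [/\ `|v y| <= a, `|v1 y| <= a & `|v2 y| <= a].
  have [a a0 ha] := continuous_bounded_itv 0 1 cv.
  have [b b0 hb] := continuous_bounded_itv 0 1 cv1.
  have [c c0 hc] := continuous_bounded_itv 0 1 cv2.
  exists (a + b + c) => [|y y01]; first by rewrite !addr_ge0.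
  move: (ha y y01) (hb y y01) (hc y y01) => h1 h2 h3.
  by split; [move: h1|move: h2|move: h3]; move: a0 b0 c0; clear; lra.
pose m : R := N%:R * 4 ^+ N * (8 * expR 1).
have m0 : 0 <= m by rewrite !mulr_ge0 ?exprn_ge0 ?expR_ge0.
have key (d e : R) : 0 < d -> 0 < e -> e <= 1 / 4 -> 8 * expR 1 * e <= 1 ->
    (forall x, Omega_e x -> ln_norm x < 4 * e -> `|w x| <= d) ->
    (`|\int[mu]_(x in Omega_e) (J x)%:E| <=
      ((a + C) * `|B| * m * e + d * (a + C) * (N%:R + 3) * m)%:E)%E.
  move=> d0 e0 e4 e1 wd'.
  have [|V [V1 [V2 [[Vd V1d cV2] Ve V4 VC]]]] := cut e; first by rewrite e0.
  pose I x := V (ln_norm x) * (\sum_i wii i x) - w x * radial_laplacian V1 V2 x.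
  have I0 : (\int[mu]_(x in Omega_e) (I x)%:E = 0)%E.
    exact: (green_interior wd wid cw cwii w0 e0 Vd V1d cV2 Ve).
  have [mS muS] := layer_measure_ln e0 e1.
  pose S := [set x : 'rV[R]_N | 0 < ln_norm x < 4 * e].
  have cV := is_derive_continuous Vd; have cV1 := is_derive_continuous V1d.
  pose k := (a + C) * `|B| + d * ((a + C) / e * (N%:R + 3)).
  have k0 : 0 <= k.
    by rewrite addr_ge0 ?mulr_ge0 ?addr_ge0 ?invr_ge0 ?(ltW d0) ?(ltW e0).
  have JI x : Omega_e x -> `|J x - I x| <= k /\ (4 * e <= ln_norm x -> J x - I x = 0).
    move=> Ox; have Y0 : 0 < ln_norm x by exact/Omega_e_ln_norm.
    have JIE : J x - I x = (v (ln_norm x) - V (ln_norm x)) * (\sum_i wii i x)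
        - w x * radial_laplacian (fun y => v1 y - V1 y) (fun y => v2 y - V2 y) x.
      by rewrite /J /I /radial_laplacian /radial_lap; ring.
    have [Y4|Y4] := leP (4 * e) (ln_norm x).
      have z : J x - I x = 0.
        have [hV hV1 hV2] := V4 _ Y4.
        by rewrite JIE /radial_laplacian /radial_lap hV hV1 hV2; ring.
      by rewrite z normr0.
    split=> //; have [|hC hC1 hC2] := VC (ln_norm x); first by rewrite !ltW.
    have [|ha ha1 ha2] := va (ln_norm x).
      by rewrite ltW//=; move: Y4 e4; clear; lra.
    have ie : 1 <= e^-1 by rewrite invf_ge1//; move: e4; clear; lra.
    have aCe : a + C / e <= (a + C) / e by rewrite mulrDl lerD2r ler_peMr.
    rewrite JIE (le_trans (ler_normB _ _))// lerD//.
      rewrite normrM ler_pM//; first by rewrite (le_trans (ler_normB _ _))// lerD.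
      by have [_ h] := wB x Ox; rewrite (le_trans h)// ler_norm.
    rewrite normrM ler_pM//; first exact: wd'.
    apply: radial_laplacian_bound => //.
      by rewrite (le_trans _ aCe)// (le_trans (ler_normB _ _))// lerD.
    by rewrite (le_trans _ aCe)// (le_trans (ler_normB _ _))// lerD.
  have iI : mu.-integrable Omega_e (EFin \o (fun x => J x - I x)).
    apply: (@integrable_Omega_e _ _ _ k M) => [x /[!inE] Ox|x Ox|x Ox xM].
    - have c1 := continuous_radial_laplacian cv1 cv2 Ox.
      have c2 := continuous_radial_laplacian cV1 cV2 Ox.
      have c3 := continuous_radial cV Ox.
      rewrite (_ : (fun x => _) = fun x => (v (ln_norm x) * (\sum_i wii i x) +
         (- 1) * (w x * radial_laplacian v1 v2 x)) + (- 1) * (V (ln_norm x) *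
         (\sum_i wii i x) + (- 1) * (w x * radial_laplacian V1 V2 x))); last first.
        by apply/funext => y; rewrite /J /I; ring.
      pose cn := continuous_at_cst (- 1 : R) x.
      exact: (continuous_at_add
        (continuous_at_add (cvlw x Ox) (continuous_at_mul cn (cwlv x Ox)))
        (continuous_at_mul cn (continuous_at_add (continuous_at_mul c3 (clw x Ox))
          (continuous_at_mul cn (continuous_at_mul (cw x Ox) c2))))).
    - by have [] := JI x Ox.
    - by rewrite /J /I w0// lw0// !mulr0 !mul0r !subr0.
  have iIO : mu.-integrable Omega_e (EFin \o I).
    have := integrableB mO iJ iI; apply: eq_integrable => // x _ /=.
    by rewrite -EFinB; congr EFin; ring.
  have -> : (\int[mu]_(x in Omega_e) (J x)%:E = \int[mu]_(x in Omega_e) (J x - I x)%:E)%E.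
    have := integralB_EFin mO iJ iIO; rewrite [X in (_ - X)%E]I0 sube0 => <-.
    by apply: eq_integral => x _; rewrite EFinB.
  apply: (le_trans (le_abse_integral _ mO _)); first exact: (measurable_int mu iI).
  rewrite integral_mkcond (_ : _ \_ _ = (fun x => `|(J x - I x)%:E|%E) \_ S); last first.
    apply/funext => x; rewrite !patchE.
    have [Ox|nOx] := pselect (Omega_e x); last first.
      rewrite !memNset//= => /andP[Y0 _]; apply: nOx; exact/Omega_e_ln_norm.
    rewrite mem_set//; case: ifPn => //; rewrite notin_setE /S /= => /negP.
    have -> /= : 0 < ln_norm x by exact/Omega_e_ln_norm.
    by rewrite -leNgt => Y4; have [_ ->] := JI x Ox; rewrite ?normr0.
  rewrite -integral_mkcond; apply: (@le_trans _ _ (\int[mu]_(x in S) k%:E)%E).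
    apply: ge0_le_integral => //.
    - apply: measurableT_comp => //; apply: measurable_funS (measurable_int mu iI) => //.
      by move=> x /andP[? _]; exact/Omega_e_ln_norm.
    - by move=> x /andP[Y0 _]; rewrite lee_fin; have [|] := JI x _; first exact/Omega_e_ln_norm.
  rewrite integral_cst//; apply: (le_trans (lee_wpmul2l _ muS)); first by rewrite lee_fin.
  rewrite -EFinM lee_fin -/m le_eqVlt; apply/orP; left; apply/eqP; rewrite /k.
  by field; rewrite gt_eqF.
have abs0 : forall r : R, 0 < r -> (`|\int[mu]_(x in Omega_e) (J x)%:E| <= r%:E)%E.
  move=> r r0.
  pose q1 := (a + C) * `|B| * m; have q10 : 0 <= q1 by rewrite !mulr_ge0// addr_ge0.
  pose q2 := (a + C) * (N%:R + 3) * m.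
  have q20 : 0 <= q2 by rewrite !mulr_ge0// addr_ge0.
  pose d := r / (2 * (q2 + 1)).
  have d0 : 0 < d by rewrite divr_gt0// mulr_gt0// ltr_wpDl.
  have [e' e'0 we] := zero_on_sphere_uniform wS d0.
  have x0 := expR_gt0 (1 : R).
  (* The four bounds serve, in order, [cutoff], [layer_measure_ln], the inclusion of the layer in
     the region where [|w| < d], and the [O(e)] term, which must not exceed [r / 2]. The other half
     of [r] is spent by [d]. *)
  pose e := Num.min (Num.min (1 / 4) (8 * expR 1)^-1)
    (Num.min (ln (1 + e') / 8) (r / (2 * (q1 + 1)))).
  have l0 : 0 < ln (1 + e') by rewrite ln_gt0// ltrDl.
  have e0 : 0 < e by rewrite !lt_min !divr_gt0 ?invr_gt0 ?mulr_gt0// ltr_wpDl.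
  have : e <= e by []; rewrite {2}/e !le_min => /andP[/andP[e4 e8] /andP[eY eq]].
  apply: le_trans (key d e d0 e0 e4 _ _) _.
  - by rewrite -ler_pdivlMl ?mulr1// mulr_gt0.
  - move=> x Ox Yx; apply/ltW/we => //.
    have -> : 1 + e' = expR (2 * (ln (1 + e') / 2)).
      by rewrite mulrCA divff// mulr1 lnK// posrE ltr_wpDl.
    rewrite -ln_norm_lt ?divr_gt0// (lt_le_trans Yx)//.
    by move: eY; clear; lra.
  rewrite lee_fin -/q1.
  have -> : d * (a + C) * (N%:R + 3) * m = d * q2 by rewrite /q2; ring.
  have h1 : q1 * e <= r / 2.
    have : e * (2 * (q1 + 1)) <= r by rewrite -ler_pdivlMr// mulr_gt0// ltr_wpDl.
    by move: e0 q10; clear; nra.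
  have h2 : d * q2 <= r / 2.
    have : d * (2 * (q2 + 1)) = r by rewrite /d divfK// gt_eqF// mulr_gt0// ltr_wpDl.
    by move: d0 q20; clear; nra.
  by move: h1 h2; clear; lra.
apply/eqP; rewrite -abse_eq0 eq_le abse_ge0 andbT.
apply/lee_addgt0Pr => r r0; rewrite add0e; exact: abs0.
Qed.

End Green_formula.

(** * Bounds on test functions and the biharmonic Green formula *)

Section test_functions.
Context {R : realType} {N : nat}.
Local Notation mu := (@lebesgue_rV R N).
Implicit Types (x : 'rV[R]_N) (psi g : 'rV[R]_N -> R).

Lemma Ck_is_derive k g (s : seq 'I_N) i x : Ck_closure k g -> (size s < k)%N ->
  Omega_e x ->
  is_derive x (unit_vec i) (iter_partial s g) (iter_partial (i :: s) g x).
Proof. by move=> [_ gd _] sk Ox; apply: DeriveDef => //; exact: gd. Qed.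

Lemma Ck_continuous k g (s : seq 'I_N) x : Ck_closure k g -> (size s <= k)%N ->
  Omega_e x -> {for x, continuous (iter_partial s g)}.
Proof.
move=> [_ _ gc] sk Ox; have [h [ch hE]] := gc s sk.
have oO := @open_Omega_e R N.
have cO : {within Omega_e, continuous h}.
  by apply: continuous_subspaceW ch; exact: subset_closure.
rewrite continuous_open_subspace// in cO.
have := cO x (mem_set Ox).
rewrite /prop_for /continuous_at (hE x Ox) => cx.
have e : {near x, h =1 iter_partial s g}.
  by have := open_nbhs_nbhs (conj oO Ox); apply: filterS => y; exact: hE.
exact: cvg_trans (near_eq_cvg e) cx.
Qed.

(** The bound reaches up to the sphere because it is taken on the continuous extension, over a
    compact part of the closure. *)
Lemma Ck_bounded k g (s : seq 'I_N) (M : R) : Ck_closure k g -> (size s <= k)%N ->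
  (forall x, Omega_e x -> M < `|x| -> iter_partial s g x = 0) ->
  exists2 B, 0 <= B & forall x, Omega_e x -> `|iter_partial s g x| <= B.
Proof.
move=> [_ _ gc] sk g0; have [h [ch hE]] := gc s sk.
have cK : compact (closure Omega_e `&` [set x : 'rV[R]_N | `|x| <= M]).
  rewrite setIC; apply: compact_closedI; first exact: compact_norm_le.
  exact: closed_closure.
have ch' : {within closure Omega_e `&` [set x : 'rV[R]_N | `|x| <= M], continuous h}.
  by apply: continuous_subspaceW ch; exact: subIsetl.
have /compact_bounded[B [Br bB]] := continuous_compact ch' cK.
exists (`|B| + 1) => [|x Ox]; first by rewrite addr_ge0.
have [xM|xM] := leP `|x| M; last by rewrite g0// normr0 addr_ge0.
apply: (bB (`|B| + 1)); first by rewrite (le_lt_trans (ler_norm B))// ltrDl.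
exists x; last exact: hE.
by split => //; exact: subset_closure.
Qed.

(** One radius serves all derivatives: beyond it [psi] vanishes on an open set, hence so do its
    derivatives. *)
Lemma test_function_far psi : test_function psi ->
  exists M : R, forall (s : seq 'I_N) x, (size s <= 4)%N ->
    Omega_e x -> M < `|x| -> iter_partial s psi x = 0.
Proof.
move=> [psiC cK _ _ _]; have [M KM] := compact_norm_bounded cK; exists M.
elim=> [|i s IH] x sk Ox xM /=.
  apply/eqP/negPn/negP => px; have : `|x| <= M.
    by apply: KM; apply: subset_closure; split => //; exact: subset_closure.
  by rewrite leNgt xM.
apply: (@is_derive_far _ _ (iter_partial s psi) _ M i) => //.
  by move=> y Oy; exact: Ck_is_derive psiC sk Oy.
by move=> y Oy yM; apply: IH => //; exact: ltnW.
Qed.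

Lemma laplacian_iter g x : laplacian g x = \sum_j iter_partial [:: j; j] g x.
Proof. by []. Qed.

Lemma is_derive_big_sum (f df : 'I_N -> 'rV[R]_N -> R) x v :
  (forall j, is_derive x v (f j) (df j x)) ->
  is_derive x v (fun y => \sum_j f j y) (\sum_j df j x).
Proof.
move=> fd; rewrite (_ : (fun y => _) = \sum_j f j); first exact: is_derive_sum.
by apply/funext => y; rewrite fct_sumE.
Qed.

Lemma continuous_big_sum (f : 'I_N -> 'rV[R]_N -> R) x :
  (forall j, {for x, continuous (f j)}) ->
  {for x, continuous (fun y => \sum_j f j y)}.
Proof.
move=> fc; rewrite (_ : (fun y => _) = \sum_j f j); last first.
  by apply/funext => y; rewrite fct_sumE.
elim/big_ind: _ => [|h1 h2 c1 c2|j _]; last exact: fc.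
  exact: cst_continuous.
exact: continuousD.
Qed.

Lemma bilaplacian_iter g x : Ck_closure 4 g -> Omega_e x ->
  bilaplacian g x = \sum_i \sum_j iter_partial [:: i; i; j; j] g x.
Proof.
move=> gC Ox; apply: eq_bigr => i _.
have d1 y : Omega_e y ->
    partial i (laplacian g) y = \sum_j iter_partial [:: i; j; j] g y.
  move=> Oy; have h : is_derive y (unit_vec i) (laplacian g)
      (\sum_j iter_partial [:: i; j; j] g y).
    apply: (@is_derive_big_sum (fun j => iter_partial [:: j; j] g)
      (fun j => iter_partial [:: i; j; j] g)) => j.
    exact: (Ck_is_derive (s := [:: j; j]) i gC).
  by case: h.
have d2 : is_derive x (unit_vec i) (fun y => \sum_j iter_partial [:: i; j; j] g y)
    (\sum_j iter_partial [:: i; i; j; j] g x).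
  apply: (@is_derive_big_sum (fun j => iter_partial [:: i; j; j] g)
    (fun j => iter_partial [:: i; i; j; j] g)) => j.
  exact: (Ck_is_derive (s := [:: i; j; j]) i gC).
have := is_derive_open (@open_Omega_e R N) Ox (fun y Oy => esym (d1 y Oy)) d2.
by case.
Qed.

Lemma continuous_bilaplacian psi x : Ck_closure 4 psi -> Omega_e x ->
  {for x, continuous (bilaplacian psi)}.
Proof.
move=> psiC Ox; set S := fun y => \sum_i \sum_j iter_partial [:: i; i; j; j] psi y.
have cS : {for x, continuous S}.
  by apply: continuous_big_sum => i; apply: continuous_big_sum => j;
    exact: Ck_continuous psiC _ Ox.
have e : {near x, S =1 bilaplacian psi}.
  have := open_nbhs_nbhs (conj (@open_Omega_e R N) Ox).
  by apply: filterS => y Oy; rewrite /S bilaplacian_iter.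
change (bilaplacian psi @ x --> bilaplacian psi x); rewrite bilaplacian_iter//.
exact: cvg_trans (near_eq_cvg e) cS.
Qed.

Lemma big_sum_bounded (f : 'I_N -> 'rV[R]_N -> R) :
  (forall j, exists2 B, 0 <= B & forall x, Omega_e x -> `|f j x| <= B) ->
  exists2 B, 0 <= B & forall x, Omega_e x -> `|\sum_j f j x| <= B.
Proof.
move=> fB; have {}fB j : exists b, 0 <= b /\ forall x, Omega_e x -> `|f j x| <= b.
  by have [b ? ?] := fB j; exists b.
have {fB} [B fB] := choice fB.
exists (\sum_j B j) => [|x Ox]; first by apply: sumr_ge0 => j _; have [] := fB j.
by rewrite (le_trans (ler_norm_sum _ _ _))// ler_sum// => j _; have [_] := fB j; exact.
Qed.

Lemma test_function_bounds psi : test_function psi -> exists M : R,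
  [/\ forall x, Omega_e x -> M < `|x| ->
        [/\ psi x = 0, laplacian psi x = 0 & bilaplacian psi x = 0],
      exists2 B, 0 <= B & forall x, Omega_e x ->
        [/\ `|psi x| <= B, `|laplacian psi x| <= B & `|bilaplacian psi x| <= B] &
      forall x, Omega_e x -> [/\ {for x, continuous psi}, {for x, continuous (laplacian psi)} &
        {for x, continuous (bilaplacian psi)}]].
Proof.
move=> tpsi; have [M far] := test_function_far tpsi; have [psiC _ _ _ _] := tpsi.
have bnd (s : seq 'I_N) : (size s <= 4)%N ->
    exists2 B, 0 <= B & forall x, Omega_e x -> `|iter_partial s psi x| <= B.
  by move=> sk; apply: (Ck_bounded (M := M) psiC sk) => x Ox xM; exact: far.
exists M; split.
- move=> x Ox xM; split; first exact: (far [::]).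
    by rewrite laplacian_iter big1// => j _; exact: far.
  by rewrite bilaplacian_iter// big1// => i _; rewrite big1// => j _; exact: far.
- have [B0 B00 h0] := bnd [::] isT.
  have [B1 B10 h1] := @big_sum_bounded (fun j => iter_partial [:: j; j] psi)
    (fun j => bnd [:: j; j] isT).
  have [B2 B20 h2] := @big_sum_bounded (fun i x => \sum_j iter_partial [:: i; i; j; j] psi x)
    (fun i => @big_sum_bounded (fun j => iter_partial [:: i; i; j; j] psi)
      (fun j => bnd [:: i; i; j; j] isT)).
  exists (B0 + B1 + B2) => [|x Ox]; first by rewrite !addr_ge0.
  have := (h0 x Ox, h1 x Ox, h2 x Ox) => -[[/= k0 k1 k2]].
  by rewrite laplacian_iter bilaplacian_iter//; split; lra.
- move=> x Ox; split; first exact: (Ck_continuous (s := [::]) psiC).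
    by apply: continuous_big_sum => j; exact: (Ck_continuous (s := [:: j; j]) psiC).
  exact: continuous_bilaplacian.
Qed.

(** Each use of [green] needs both of its functions to vanish on the sphere: first the Laplacian of
    [psi] with [u], then [psi] with the Laplacian of [u]. The last hypothesis says that the latter
    is zero at [|x| = 1]. *)
Lemma green_biharmonic psi (u u1 u2 u3 u4 : R -> R) : test_function psi ->
  (forall y, is_derive y (1 : R) u (u1 y)) ->
  (forall y, is_derive y (1 : R) u1 (u2 y)) ->
  (forall y, is_derive y (1 : R) u2 (u3 y)) ->
  (forall y, is_derive y (1 : R) u3 (u4 y)) -> continuous u4 ->
  u 0 = 0 -> u2 0 + (N%:R - 2) * u1 0 = 0 ->
  (\int[mu]_(x in Omega_e) (u (ln_norm x) * bilaplacian psi x)%:E =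
   \int[mu]_(x in Omega_e) (expR (- 4 * ln_norm x) *
      @biharmonic_op R N u1 u2 u3 u4 (ln_norm x) * psi x)%:E)%E.
Proof.
move=> tpsi d0 d1 d2 d3 c4 u0 u20.
have [M [far [B B0 bnd] cont]] := test_function_bounds tpsi.
have [psiC _ _ psi0 lpsi0] := tpsi.
have c2 := is_derive_continuous d2; have c3 := is_derive_continuous d3.
have c1 := is_derive_continuous d1.
have step1 : (\int[mu]_(x in Omega_e) (u (ln_norm x) * bilaplacian psi x)%:E =
    \int[mu]_(x in Omega_e) (laplacian psi x * radial_laplacian u1 u2 x)%:E)%E.
  have g := @green _ _ (laplacian psi)
    (fun i x => \sum_j iter_partial [:: i; j; j] psi x)
    (fun i x => \sum_j iter_partial [:: i; i; j; j] psi x) M B u u1 u2.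
  refine (etrans _ (g _ _ _ _ _ _ _ d0 d1 c2 u0)) => //.
  - by apply: eq_integral => x /[!inE] Ox; rewrite bilaplacian_iter.
  - move=> i x Ox; apply: (@is_derive_big_sum (fun j => iter_partial [:: j; j] psi)
      (fun j => iter_partial [:: i; j; j] psi)) => j.
    exact: Ck_is_derive psiC _ Ox.
  - move=> i x Ox; apply: (@is_derive_big_sum (fun j => iter_partial [:: i; j; j] psi)
      (fun j => iter_partial [:: i; i; j; j] psi)) => j.
    exact: Ck_is_derive psiC _ Ox.
  - by move=> x Ox; have [] := cont x Ox.
  - by move=> i x Ox; apply: continuous_big_sum => j; exact: Ck_continuous psiC _ Ox.
  - by move=> x Ox xM; have [] := far x Ox xM.
  - by move=> x Ox; rewrite -bilaplacian_iter//; have [] := bnd x Ox.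
rewrite step1.
have cl2 : continuous (@radial_lap2 R N u1 u2 u3 u4).
  have ce := smooth1_continuous (smooth1_expRM 0 (- 2 : R)).
  move=> y; pose cst c := @continuous_at_cst R R c y.
  exact: (continuous_at_mul (ce y) (continuous_at_add (continuous_at_add
    (continuous_at_add (c4 y) (continuous_at_mul (cst (N%:R - 6)) (c3 y)))
    (continuous_at_mul (cst (- 4 * N%:R + 12)) (c2 y)))
    (continuous_at_mul (cst (4 * (N%:R - 2))) (c1 y)))).
have step2 := @green _ _ psi (fun i => iter_partial [:: i] psi)
  (fun i => iter_partial [:: i; i] psi) M B (@radial_lap R N u1 u2)
  (@radial_lap1 R N u1 u2 u3) (@radial_lap2 R N u1 u2 u3 u4).
transitivity (\int[mu]_(x in Omega_e)
    (@radial_lap R N u1 u2 (ln_norm x) * (\sum_i iter_partial [:: i; i] psi x))%:E)%E.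
  by apply: eq_integral => x _; rewrite mulrC laplacian_iter.
refine (etrans (step2 _ _ _ _ _ _ _ _ _ cl2 _) _) => //.
- by move=> i x Ox; exact: (Ck_is_derive (s := [::]) i psiC).
- by move=> i x Ox; exact: (Ck_is_derive (s := [:: i]) i psiC).
- by move=> x Ox; have [] := cont x Ox.
- by move=> i x Ox; exact: Ck_continuous psiC _ Ox.
- by move=> x Ox xM; have [] := far x Ox xM.
- by move=> x Ox; have [h1 h2 _] := bnd x Ox; split; [exact: h1|exact: h2].
- by move=> y; exact: is_derive_radial_lap.
- by move=> y; exact: is_derive_radial_lap1.
- by rewrite /radial_lap u20 mulr0.
- by apply: eq_integral => x _; rewrite /radial_laplacian radial_lap_lap mulrC.
Qed.

End test_functions.

(** * The supercritical range *)

Section radial_weak_solution.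
Context {R : realType} {N : nat}.
Local Notation lebN := (@lebesgue_rV R N).
Implicit Types (x : 'rV[R]_N) (psi g : 'rV[R]_N -> R).

Lemma continuous_powR_norm (p : R) : 0 < p -> continuous (fun z : R => `|z| `^ p).
Proof.
move=> p0 z; have [->|z0] := eqVneq z 0.
  rewrite /continuous_at normr0 powR0 ?gt_eqF//; apply/cvgrPdist_lt => e e0.
  have ep : 0 < e `^ p^-1 by exact: powR_gt0.
  near=> y; rewrite sub0r normrN ger0_norm ?powR_ge0//.
  have ye : `|y| < e `^ p^-1.
    near: y; have := nbhsx_ballx (0 : R) _ ep.
    by apply: filterS => y; rewrite -ball_normE /= sub0r normrN.
  rewrite -[ltRHS](powRr1 (ltW e0)) -(mulVf (lt0r_neq0 p0)) powRrM.
  by apply: gt0_ltr_powR => //; rewrite ?nnegrE ?normr_ge0 ?powR_ge0.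
have e : {near z, (fun y => expR (p * ln `|y|)) =1 (fun y => `|y| `^ p)}.
  have : nbhs z [set y : R | y != 0] := open_nbhs_nbhs (conj (@open_neq R 0) z0).
  by apply: filterS => y y0; rewrite /powR gt_eqF ?normr_gt0.
rewrite /continuous_at {2}/powR gt_eqF ?normr_gt0//.
apply: cvg_trans (near_eq_cvg e) _.
have cl : {for z, continuous (fun y : R => ln `|y|)}.
  apply: (@continuous_comp _ _ _ (fun y : R => `|y|) (@ln R)).
    exact: norm_continuous.
  by apply: continuous_ln; rewrite normr_gt0.
exact: (continuous_at_comp (@continuous_expR R)
  (continuous_at_mul (continuous_at_cst p z) cl)).
Unshelve. all: by end_near. Qed.

Lemma integrable_radial_mul (k : R -> R) g (M B : R) : continuous k ->
  (forall x, Omega_e x -> {for x, continuous g}) ->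
  (forall x, Omega_e x -> `|g x| <= B) -> (forall x, Omega_e x -> M < `|x| -> g x = 0) ->
  lebN.-integrable Omega_e (EFin \o (fun x => k (ln_norm x) * g x)).
Proof.
move=> ck cg gB g0; have [Z YZ] := @ln_norm_bounded R N M.
have [A A0 kA] := continuous_bounded_itv 0 Z ck.
apply: (@integrable_Omega_e _ _ _ (A * B) M) => [x /[!inE] Ox|x Ox|x Ox xM].
- exact: (continuous_at_mul (continuous_radial ck Ox) (cg x Ox)).
- have B0 : 0 <= B by rewrite (le_trans _ (gB x Ox)).
  have [xM|xM] := leP `|x| M; last by rewrite g0// mulr0 normr0 mulr_ge0.
  rewrite normrM ler_pM// ?gB//; apply: kA.
  by rewrite YZ// andbT ltW//; exact/Omega_e_ln_norm.
- by rewrite g0// mulr0.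
Qed.

Lemma zero_on_sphere_eq (f g : 'rV[R]_N -> R) : (forall x, Omega_e x -> f x = g x) ->
  zero_on_sphere g -> zero_on_sphere f.
Proof.
move=> fg g0 y /g0; apply: cvg_trans; apply: near_eq_cvg.
by rewrite near_withinE; apply: filterE => z Oz; rewrite /= fg.
Qed.

Lemma zero_on_sphere_radial (k k1 k2 : R -> R) :
  (forall y, is_derive y (1 : R) k (k1 y)) ->
  (forall y, is_derive y (1 : R) k1 (k2 y)) -> continuous k2 ->
  k 0 = 0 -> k2 0 + (N%:R - 2) * k1 0 = 0 ->
  zero_on_sphere (fun x : 'rV[R]_N => k (ln_norm x)) /\
  zero_on_sphere (laplacian (fun x : 'rV[R]_N => k (ln_norm x))).
Proof.
move=> d0 d1 c2 k0 k20; have c0 := is_derive_continuous d0.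
have c1 := is_derive_continuous d1.
have ce := smooth1_continuous (smooth1_expRM 0 (- 2 : R)).
split.
  have sk : smooth1 0 k by split.
  apply: (smooth_zero_on_sphere (smooth_radial sk)) => x.
  by move=> /ln_norm_sphere[_ /= ->].
apply: (@zero_on_sphere_eq _ (fun x => @radial_lap R N k1 k2 (ln_norm x))).
  by move=> x /Omega_e_sqnorm_gt0 x0; exact: (laplacian_radial d0 d1 x0).
have cl : smooth1 0 (@radial_lap R N k1 k2).
  split=> // y; exact: (continuous_at_mul (ce y) (continuous_at_add (c2 y)
    (continuous_at_mul (continuous_at_cst (N%:R - 2) y) (c1 y)))).
apply: (smooth_zero_on_sphere (smooth_radial cl)) => x.
by move=> /ln_norm_sphere[_ /= ->]; rewrite /radial_lap k20 mulr0.
Qed.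

Lemma Lp_loc_radial (q : R) (k : R -> R) : 0 < q -> continuous k ->
  Lp_loc q (fun x : 'rV[R]_N => k (ln_norm x)).
Proof.
move=> q0 ck; set U := [set x : 'rV[R]_N | 0 < sqnorm x].
have oU : open U by exact: open_sqnorm_gt.
have sub : closure Omega_e `<=` U.
  by move=> x /closure_Omega_e_sub /= /(lt_le_trans ltr01).
have c (l : R -> R) : continuous l -> {in U, continuous (fun x => l (ln_norm x))}.
  by move=> cl x /[!inE] x0; apply: (continuous_at_comp cl); exact: continuous_ln_norm.
split.
  apply: measurable_funS (continuous_measurable_fun_rV oU (c k ck)) => //.
  exact: open_measurable_rV.
move=> K cK KO; have cl : continuous (fun y => `|k y| `^ q).
  by move=> y; exact: (continuous_at_comp (continuous_powR_norm q0) (ck y)).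
apply: (continuous_integrable_compact oU (c _ cl) cK).
exact: subset_trans sub.
Qed.

Lemma enorm_powR x (s : R) : 0 < sqnorm x -> enorm x `^ s = expR (s * ln_norm x).
Proof. by move=> x0; rewrite enorm_expR// -expRM mulrC. Qed.

Lemma div_enorm4 x (m : R) : 0 < sqnorm x -> m / enorm x ^+ 4 = m * expR (- 4 * ln_norm x).
Proof.
move=> x0; rewrite enorm_expR// -expRM_natl mulNr expRN.
by congr (_ * (expR (_ * _))^-1).
Qed.

(** The source [f] is defined as the defect of the equation, so the strict inequality is its
    positivity. It is continuous up to the sphere, hence locally integrable, and the weak form
    reduces to [green_biharmonic]. *)
Lemma radial_solution (p sigma m : R) (u u1 u2 u3 u4 : R -> R) : 0 < p ->
  (forall y, is_derive y (1 : R) u (u1 y)) ->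
  (forall y, is_derive y (1 : R) u1 (u2 y)) ->
  (forall y, is_derive y (1 : R) u2 (u3 y)) ->
  (forall y, is_derive y (1 : R) u3 (u4 y)) -> (forall n, smooth1 n u) -> continuous u4 ->
  u 0 = 0 -> u2 0 + (N%:R - 2) * u1 0 = 0 ->
  (forall y, 0 < y -> expR (sigma * y) * `|u y| `^ p <
    expR (- 4 * y) * (@biharmonic_op R N u1 u2 u3 u4 y - m * u y)) ->
  exists f : 'rV[R]_N -> R, [/\ Lp_loc 1 f, positive_on_Omega_e f &
    exists u : 'rV[R]_N -> R, [/\ Cinf_closure u, classical_solution m p sigma f u &
      weak_solution m p sigma f u]].
Proof.
move=> p0 d0 d1 d2 d3 su c4 u0 u20 Fpos.
have c3 := is_derive_continuous d3; have c2 := is_derive_continuous d2.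
have c1 := is_derive_continuous d1; have c0 := is_derive_continuous d0.
have ce (c : R) := smooth1_continuous (smooth1_expRM 0 c).
pose cst c y := @continuous_at_cst R R c y.
pose K y : R := expR (sigma * y) * `|u y| `^ p.
have cK : continuous K.
  move=> y; exact: (continuous_at_mul (ce sigma y)
    (continuous_at_comp (continuous_powR_norm p0) (c0 y))).
pose L y : R := expR (- 4 * y) * @biharmonic_op R N u1 u2 u3 u4 y.
have cL : continuous L.
  move=> y; apply: (continuous_at_mul (ce (- 4) y)).
  exact: (continuous_at_add (continuous_at_add (continuous_at_add (c4 y)
    (continuous_at_mul (cst (2 * N%:R - 8) y) (c3 y)))
    (continuous_at_mul (cst ((N%:R - 6) * (N%:R - 2) - 2 * (N%:R - 4)) y) (c2 y)))
    (continuous_at_mul (cst (- (2 * (N%:R - 4) * (N%:R - 2))) y) (c1 y))).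
pose P y : R := (m * expR (- 4 * y)) * u y.
have cP : continuous P.
  by move=> y; exact: (continuous_at_mul (continuous_at_mul (cst m y) (ce (- 4) y)) (c0 y)).
pose F y : R := L y + (- 1) * P y + (- 1) * K y.
have cF : continuous F.
  move=> y; exact: (continuous_at_add (continuous_at_add (cL y)
    (continuous_at_mul (cst (- 1) y) (cP y))) (continuous_at_mul (cst (- 1) y) (cK y))).
have gt0 x : Omega_e x -> 0 < sqnorm x := @Omega_e_sqnorm_gt0 R N x.
exists (fun x => F (ln_norm x)); split.
- exact: Lp_loc_radial.
- move=> x /Omega_e_ln_norm /Fpos; rewrite /F /K /L /P => h.
  by rewrite -subr_gt0 in h; apply: lt_le_trans h _; lra.
exists (fun x => u (ln_norm x)); split.
- by move=> k; exact/smooth_Ck_closure/smooth_radial.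
- split.
  + move=> x /gt0 x0.
    rewrite (bilaplacian_radial d0 d1 d2 d3 x0) div_enorm4// enorm_powR//.
    by rewrite /F /L /P /K; ring.
  + by have [] := zero_on_sphere_radial d0 d1 c2 u0 u20.
  + by have [] := zero_on_sphere_radial d0 d1 c2 u0 u20.
split; first exact: Lp_loc_radial.
move=> psi tpsi; have [M [far [B B0 bnd] cont]] := test_function_bounds tpsi.
have mO := @measurable_Omega_e R N.
have ip (k : R -> R) : continuous k ->
    lebN.-integrable Omega_e (EFin \o (fun x => k (ln_norm x) * psi x)).
  move=> ck; apply: (integrable_radial_mul (M := M) (B := B) ck) => x Ox.
  - by have [] := cont x Ox.
  - by have [] := bnd x Ox.
  - by move=> xM; have [] := far x Ox xM.
have ib : lebN.-integrable Omega_e (EFin \o (fun x => u (ln_norm x) * bilaplacian psi x)).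
  apply: (integrable_radial_mul (M := M) (B := B) c0) => x Ox.
  - by have [] := cont x Ox.
  - by have [] := bnd x Ox.
  - by move=> xM; have [] := far x Ox xM.
transitivity (\int[lebN]_(x in Omega_e) (K (ln_norm x) * psi x)%:E +
   \int[lebN]_(x in Omega_e) (F (ln_norm x) * psi x)%:E)%E.
  congr (_ + _)%E; apply: eq_integral => x /[!inE] /gt0 x0.
  by rewrite enorm_powR.
rewrite -integralD//; [|exact: ip|exact: ip].
transitivity (\int[lebN]_(x in Omega_e) (u (ln_norm x) * bilaplacian psi x)%:E -
   \int[lebN]_(x in Omega_e) (P (ln_norm x) * psi x)%:E)%E; last first.
  rewrite -integralB_EFin//; last exact: ip.
  apply: eq_integral => x /[!inE] /gt0 x0; rewrite -EFinB; congr EFin.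
  by rewrite div_enorm4// /P; ring.
rewrite (green_biharmonic tpsi d0 d1 d2 d3 c4 u0 u20).
rewrite -integralB_EFin//; [|exact: (ip L)|exact: ip].
apply: eq_integral => x _; rewrite -EFinB -EFinD; congr EFin.
by rewrite /F /L; ring.
Qed.

End radial_weak_solution.

(** * Exponential polynomials and the characteristic equation *)

Section exponential_polynomials.
Context {R : realType} (N : nat) (l1 l2 l3 : R).

(** The linear coefficient provides the second solution at the double root [t = 0], where [y] is the
    factor [ln r]. *)
Definition expoly c1 c2 d c3 (y : R) : R :=
  c1 * expR (l1 * y) + (c2 + d * y) * expR (l2 * y) + c3 * expR (l3 * y).

Lemma is_derive_expoly c1 c2 d c3 y :
  is_derive y (1 : R) (expoly c1 c2 d c3)
    (expoly (l1 * c1) (l2 * c2 + d) (l2 * d) (l3 * c3) y).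
Proof.
have c (z : R) := is_derive_cst z y (1 : R).
rewrite /expoly; apply: is_derive_val (is_derive_add (is_derive_add
  (is_derive_mul (c c1) (is_derive_expRM l1 y))
  (is_derive_mul (is_derive_add (c c2) (is_derive_mul (c d) (is_derive_id y (1 : R))))
    (is_derive_expRM l2 y)))
  (is_derive_mul (c c3) (is_derive_expRM l3 y))) _.
by rewrite /=; ring.
Qed.

Lemma smooth1_expoly n c1 c2 d c3 : smooth1 n (expoly c1 c2 d c3).
Proof.
elim: n c1 c2 d c3 => [|n IH] c1 c2 d c3; split=> //;
  try exact: is_derive_continuous (is_derive_expoly c1 c2 d c3).
exists (expoly (l1 * c1) (l2 * c2 + d) (l2 * d) (l3 * c3)); first exact: IH.
by move=> y; exact: is_derive_expoly.
Qed.

Lemma expoly_le c1 c2 c3 y (l : R) : 0 <= y -> l1 <= l -> l2 <= l -> l3 <= l ->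
  `|expoly c1 c2 0 c3 y| <= (`|c1| + `|c2| + `|c3|) * expR (l * y).
Proof.
move=> y0 h1 h2 h3; rewrite /expoly mul0r addr0.
have e k c : k <= l -> `|c * expR (k * y)| <= `|c| * expR (l * y).
  move=> kl; rewrite normrM (ger0_norm (expR_ge0 _)) ler_wpM2l//.
  by rewrite ler_expR ler_wpM2r.
by rewrite (le_trans (ler_normD _ _))// !mulrDl lerD ?e// (le_trans (ler_normD _ _))//
  lerD// e.
Qed.

Definition char4 (l : R) : R := l * (l + N%:R - 2) * (l - 2) * (l + N%:R - 4).

(** The derivative of [char4], which appears when the operator acts on [y e^(l y)]; it vanishes at a
    double root. *)
Definition dchar4 (l : R) : R :=
  4 * l ^+ 3 + 3 * (2 * N%:R - 8) * l ^+ 2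
  + 2 * ((N%:R - 6) * (N%:R - 2) - 2 * (N%:R - 4)) * l
  - 2 * (N%:R - 4) * (N%:R - 2).

Definition expoly1 c1 c2 d c3 := expoly (l1 * c1) (l2 * c2 + d) (l2 * d) (l3 * c3).
Definition expoly2 c1 c2 d c3 := expoly (l1 ^+ 2 * c1) (l2 ^+ 2 * c2 + 2 * l2 * d)
  (l2 ^+ 2 * d) (l3 ^+ 2 * c3).
Definition expoly3 c1 c2 d c3 := expoly (l1 ^+ 3 * c1) (l2 ^+ 3 * c2 + 3 * l2 ^+ 2 * d)
  (l2 ^+ 3 * d) (l3 ^+ 3 * c3).
Definition expoly4 c1 c2 d c3 := expoly (l1 ^+ 4 * c1) (l2 ^+ 4 * c2 + 4 * l2 ^+ 3 * d)
  (l2 ^+ 4 * d) (l3 ^+ 4 * c3).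

Lemma is_derive_expoly1 c1 c2 d c3 y :
  is_derive y (1 : R) (expoly1 c1 c2 d c3) (expoly2 c1 c2 d c3 y).
Proof. by apply: is_derive_val (is_derive_expoly _ _ _ _ _) _; rewrite /expoly2 /expoly; ring. Qed.

Lemma is_derive_expoly2 c1 c2 d c3 y :
  is_derive y (1 : R) (expoly2 c1 c2 d c3) (expoly3 c1 c2 d c3 y).
Proof. by apply: is_derive_val (is_derive_expoly _ _ _ _ _) _; rewrite /expoly3 /expoly; ring. Qed.

Lemma is_derive_expoly3 c1 c2 d c3 y :
  is_derive y (1 : R) (expoly3 c1 c2 d c3) (expoly4 c1 c2 d c3 y).
Proof. by apply: is_derive_val (is_derive_expoly _ _ _ _ _) _; rewrite /expoly4 /expoly; ring. Qed.

Lemma biharmonic_expoly c1 c2 d c3 y :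
  @biharmonic_op R N (expoly1 c1 c2 d c3) (expoly2 c1 c2 d c3) (expoly3 c1 c2 d c3)
    (expoly4 c1 c2 d c3) y =
  expoly (char4 l1 * c1) (char4 l2 * c2 + dchar4 l2 * d) (char4 l2 * d) (char4 l3 * c3) y.
Proof.
rewrite /biharmonic_op /expoly1 /expoly2 /expoly3 /expoly4 /expoly /char4 /dchar4.
ring.
Qed.

End exponential_polynomials.

Section characteristic_roots.
Context {R : realType} (N : nat).
Local Notation a := ((N%:R - 4) / 2 : R).

Lemma char4_shift (s : R) :
  char4 N (s - a) = (s ^+ 2 - a ^+ 2) * (s ^+ 2 - (a + 2) ^+ 2).
Proof. by rewrite /char4; field. Qed.

(* With [s] the exponent shifted by [a], the characteristic equation is quadratic in
   [s ^+ 2]; its roots are [+- t] and [+- T]. *)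
Lemma char_roots (m : R) : (5 <= N)%N -> 0 < m <= mu_star N ->
  exists t T : R, [/\ mu_N N m = a + t, 0 <= t < a, a + 2 < T,
    m < mu_star N -> 0 < t &
    forall s : R, char4 N (s - a) - m = (s ^+ 2 - t ^+ 2) * (s ^+ 2 - T ^+ 2)].
Proof.
move=> N5 /andP[m0 mS].
have N5' : 5 <= N%:R :> R by rewrite (ler_nat R 5).
set n : R := N%:R in N5' *.
pose r := Num.sqrt ((n - 2) ^+ 2 + m).
pose X := ((n - 2) / 2) ^+ 2 + 1.
have r2 : r ^+ 2 = (n - 2) ^+ 2 + m by rewrite sqr_sqrtr// addr_ge0 ?sqr_ge0// ltW.
have r0 : 0 <= r by exact: sqrtr_ge0.
have rn : n - 2 < r.
  have : (n - 2) ^+ 2 < r ^+ 2 by rewrite r2 ltrDl.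
  by rewrite ltr_pXn2r// nnegrE; lra.
have X0 : 0 <= X by rewrite addr_ge0// sqr_ge0.
(* This is the origin of [mu_star]: it is the value of [m] at which [r = X], where the roots [t] and
   [- t] merge at 0. *)
have XE : X ^+ 2 = (n - 2) ^+ 2 + mu_star N by rewrite /X /mu_star -/n; field.
have rX : r <= X by rewrite -(@ler_pXn2r _ 2)// r2 XE lerD2l.
have rX' : m < mu_star N -> r < X by move=> h; rewrite -(@ltr_pXn2r _ 2)// r2 XE ltrD2l.
pose t := Num.sqrt (X - r); pose T := Num.sqrt (X + r).
have t2 : t ^+ 2 = X - r by rewrite sqr_sqrtr// subr_ge0.
have T2 : T ^+ 2 = X + r by rewrite sqr_sqrtr// addr_ge0.
have t0 : 0 <= t by exact: sqrtr_ge0.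
have T0 : 0 <= T by exact: sqrtr_ge0.
have a0 : 0 < (n - 4) / 2 by lra.
exists t, T; split.
- by [].
- rewrite t0 /= -(@ltr_pXn2r _ 2)// ?nnegrE ?(ltW a0)// t2.
  have -> : ((n - 4) / 2) ^+ 2 = X - (n - 2) by rewrite /X; field.
  by lra.
- rewrite -(@ltr_pXn2r _ 2)// ?nnegrE//; last lra.
  rewrite T2 (_ : ((n - 4) / 2 + 2) ^+ 2 = X + (n - 2)); last by rewrite /X; field.
  by lra.
- by move=> /rX' h; rewrite sqrtr_gt0 subr_gt0.
move=> s; rewrite char4_shift t2 T2 -/n.
have -> : m = r ^+ 2 - (n - 2) ^+ 2 by rewrite r2; ring.
by rewrite /X; field.
Qed.

End characteristic_roots.

(** * The explicit solution for supercritical exponents *)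

Section existence.
Context {R : realType} (N : nat).
Local Notation a := ((N%:R - 4) / 2 : R).

Lemma supercritical_existence (p sigma m : R) : (5 <= N)%N -> 1 < p -> - 4 < sigma ->
  0 < m <= mu_star N -> 1 + (sigma + 4) / mu_N N m < p ->
  exists f : 'rV[R]_N -> R, [/\ Lp_loc 1 f, positive_on_Omega_e f &
    exists u : 'rV[R]_N -> R, [/\ Cinf_closure u, classical_solution m p sigma f u &
      weak_solution m p sigma f u]].
Proof.
move=> N5 p1 s4 mS; have [t [T [-> /andP[t0 ta] aT _ rootE]]] := char_roots N5 mS.
have N5' : 5 <= N%:R :> R by rewrite (ler_nat R 5).
have a0 : 0 < a by lra.
rewrite addrC -ltrBrDr ltr_pdivrMr; last lra.
move=> pN; have tT : t < T by lra.
(* [D] is the surplus of decay of [r ^ (sigma - p (a + t))], the size of the nonlinear term, over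
   [r ^ (- 4 - a - t)]. With [del <= t + D] the term [r ^ (- 4 - a - del)] decays no faster than the
   nonlinear one. *)
pose D := (p - 1) * (a + t) - (sigma + 4).
have D0 : 0 < D by rewrite /D; lra.
have [del [del1 del2 del3]] : exists d, [/\ t < d, d < T & d <= t + D].
  exists (Num.min ((t + T) / 2) (t + D)); rewrite lt_min gt_min ge_min lexx orbT; split=> //.
    by apply/andP; split; lra.
  by apply/orP; left; lra.
(* [g s] is the symbol of the Laplacian on [r ^ (s - a)]. The coefficients [-1], [1 - b], [b] sum to
   0, and [b] is then determined by the vanishing of the Laplacian on the sphere; the signs of [g]
   keep its denominator away from 0. *)
pose g (s : R) := (s - a) * (s + (a + 2)).
have gT : 0 < g (- T) by rewrite /g -[_ * _]mulrNN mulr_gt0//; lra.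
have gt' : g (- t) < 0 by rewrite /g pmulr_llt0; lra.
pose b := (g (- del) - g (- t)) / (g (- T) - g (- t)).
pose l1 := - del - a; pose l2 := - t - a; pose l3 := - T - a.
pose C := `|- 1 : R| + `|1 - b| + `|b|.
have C0 : 0 < C by rewrite /C normrN1; have := normr_ge0 (1 - b); have := normr_ge0 b; lra.
(* The operator annihilates the two root exponents and multiplies [- r ^ (- a - del)] by [k0 r ^ -4]
   up to the sign; [k0] is positive because [del] lies between the roots. *)
pose k0 := - (del ^+ 2 - t ^+ 2) * (del ^+ 2 - T ^+ 2).
have k00 : 0 < k0.
  rewrite /k0 -mulrNN opprK mulr_gt0// ?opprB subr_gt0 ltr_pXn2r// ?nnegrE; lra.
have p0 : 0 < p by lra.
have Cp : 0 < C `^ p by exact: powR_gt0.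
(* The solution of [eps ^ (p - 1) C ^ p = k0 / 2]: the nonlinear term then takes at most half of the
   available [eps k0], leaving a positive source. *)
pose eps := (k0 / 2 / C `^ p) `^ (p - 1)^-1.
have eps0 : 0 < eps by rewrite powR_gt0// !divr_gt0.
have epsE : eps `^ p * C `^ p = eps * (k0 / 2).
  have -> : eps `^ p = eps * eps `^ (p - 1).
    rewrite -{2}(powRr1 (ltW eps0)) -powRD; first by congr (_ `^ _); ring.
    by rewrite (gt_eqF eps0) implybT.
  rewrite {2}/eps -powRrM mulVf ?powRr1; [|by rewrite !divr_ge0 ?ltW|lra].
  by rewrite -mulrA divfK// gt_eqF.
pose c1 := - eps; pose c2 := eps * (1 - b); pose c3 := eps * b.
have root2 : char4 N l2 = m.
  by apply/eqP; rewrite -subr_eq0 /l2 rootE sqrrN subrr mul0r.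
have root3 : char4 N l3 = m.
  by apply/eqP; rewrite -subr_eq0 /l3 rootE sqrrN subrr mulr0.
have root1 : char4 N l1 = m - k0.
  have : char4 N l1 - m = - k0 by rewrite /l1 rootE sqrrN /k0; ring.
  by move=> h; rewrite -[char4 N l1](subrK m) h addrC.
apply: (@radial_solution _ _ p sigma m (expoly l1 l2 l3 c1 c2 0 c3)
  (expoly1 l1 l2 l3 c1 c2 0 c3) (expoly2 l1 l2 l3 c1 c2 0 c3)
  (expoly3 l1 l2 l3 c1 c2 0 c3) (expoly4 l1 l2 l3 c1 c2 0 c3)).
- exact: p0.
- exact: is_derive_expoly.
- exact: is_derive_expoly1.
- exact: is_derive_expoly2.
- exact: is_derive_expoly3.
- by move=> n; exact: smooth1_expoly.
- exact: (is_derive_continuous (is_derive_expoly _ _ _ _ _ _ _)).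
- by rewrite /expoly !mulr0 expR0 /c1 /c2 /c3; ring.
- rewrite /expoly2 /expoly1 /expoly !mulr0 expR0 /c1 /c2 /c3.
  have gE : b * (g (- T) - g (- t)) = g (- del) - g (- t) by rewrite divfK// gt_eqF// subr_gt0 (lt_trans gt').
  transitivity (eps * (b * (g (- T) - g (- t)) - (g (- del) - g (- t)))).
    by rewrite /g /l1 /l2 /l3; field.
  by rewrite gE subrr mulr0.
move=> y y0; rewrite biharmonic_expoly root1 root2 root3.
have -> : expoly l1 l2 l3 ((m - k0) * c1) (m * c2 + dchar4 N l2 * 0) (m * 0) (m * c3) y
    - m * expoly l1 l2 l3 c1 c2 0 c3 y = eps * k0 * expR (l1 * y).
  by rewrite /expoly /c1; ring.
have ub : `|expoly l1 l2 l3 c1 c2 0 c3 y| <= eps * C * expR (l2 * y).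
  have l12 : l1 <= l2 by rewrite /l1 /l2; lra.
  have l32 : l3 <= l2 by rewrite /l3 /l2; lra.
  apply: (le_trans (expoly_le c1 c2 c3 (ltW y0) l12 (lexx l2) l32)).
  rewrite ler_wpM2r ?expR_ge0// /c1 /c2 /c3 /C !normrM normrN (gtr0_norm eps0) normrN1.
  by rewrite le_eqVlt; apply/orP; left; apply/eqP; ring.
have ub2 : `|expoly l1 l2 l3 c1 c2 0 c3 y| `^ p <= eps * (k0 / 2) * expR (p * (l2 * y)).
  apply: (@le_trans _ _ ((eps * C * expR (l2 * y)) `^ p)).
    apply: ge0_ler_powR; rewrite ?nnegrE; [exact: ltW|exact: normr_ge0| |exact: ub].
    by rewrite !mulr_ge0 ?expR_ge0 ?(ltW eps0) ?(ltW C0).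
  rewrite powRM ?expR_ge0 ?mulr_ge0 ?(ltW eps0) ?(ltW C0)//.
  by rewrite powRM ?(ltW eps0) ?(ltW C0)// epsE -expRM [p * _]mulrC.
apply: (@le_lt_trans _ _ (expR (sigma * y) * (eps * (k0 / 2) * expR (p * (l2 * y))))).
  by rewrite ler_wpM2l ?expR_ge0.
have -> : expR (sigma * y) * (eps * (k0 / 2) * expR (p * (l2 * y))) =
   eps * (k0 / 2) * expR (sigma * y + p * (l2 * y)) by rewrite expRD; ring.
have -> : expR (- 4 * y) * (eps * k0 * expR (l1 * y)) =
   eps * k0 * expR (- 4 * y + l1 * y) by rewrite expRD; ring.
apply: (@le_lt_trans _ _ (eps * (k0 / 2) * expR (- 4 * y + l1 * y))).
  apply: ler_wpM2l; first by rewrite (mulr_ge0 (ltW eps0))// divr_ge0// ltW.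
  rewrite ler_expR.
  have : sigma + p * l2 <= - 4 + l1 by rewrite /l1 /l2; rewrite /D in del3; lra.
  by move=> /(ler_wpM2r (ltW y0)); lra.
by rewrite ltr_pM2r ?expR_gt0// ltr_pM2l//; lra.
Qed.

End existence.

(** * The subcritical range *)

Section barrier.
Context {R : realType} (N : nat).
Local Notation a := ((N%:R - 4) / 2 : R).

(** The strict inequality at [l2] pays for the linear factor, through
    [(l - l2) y <= e^((l - l2) y)]. *)
Lemma expoly_bounded (l1 l2 l3 l c1 c2 d c3 : R) : l1 <= l -> l2 < l -> l3 <= l ->
  exists2 C, 0 <= C & forall y, 0 <= y ->
    `|expoly l1 l2 l3 c1 c2 d c3 y| <= C * expR (l * y).
Proof.
move=> h1 h2 h3; exists (`|c1| + `|c2| + `|c3| + `|d| / (l - l2)) => [|y y0].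
  by rewrite !addr_ge0// divr_ge0// subr_ge0 ltW.
have -> : expoly l1 l2 l3 c1 c2 d c3 y =
    expoly l1 l2 l3 c1 c2 0 c3 y + d * (y * expR (l2 * y)) by rewrite /expoly; ring.
rewrite (le_trans (ler_normD _ _))// [leRHS]mulrDl lerD//.
  by apply: expoly_le => //; exact: ltW.
rewrite normrM -mulrA ler_wpM2l// ger0_norm ?mulr_ge0 ?expR_ge0//.
have -> : expR (l * y) = expR ((l - l2) * y) * expR (l2 * y).
  by rewrite -expRD; congr expR; ring.
rewrite mulrA ler_wpM2r ?expR_ge0// ler_pdivlMl ?subr_gt0//.
by apply: le_trans (expR_ge1Dx _); rewrite lerDr.
Qed.

Lemma dchar4_shift (s : R) : dchar4 N (s - a) =
  2 * s * ((s ^+ 2 - a ^+ 2) + (s ^+ 2 - (a + 2) ^+ 2)).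
Proof. by rewrite /dchar4; field. Qed.

(** From [e^(-z y) <= 1 / (1 + z y)]; the minimum records both the linear growth at 0 and the
    saturation at infinity. *)
Lemma expR_lower (z y : R) : 0 < z -> 0 <= y ->
  z / (1 + z) * Num.min 1 y <= 1 - expR (- (z * y)).
Proof.
move=> z0 y0; have h : expR (- (z * y)) <= (1 + z * y)^-1.
  rewrite expRN lef_pV2 ?posrE ?expR_gt0 ?ltr_pwDl ?mulr_ge0 ?(ltW z0)//.
  exact: expR_ge1Dx.
have zy : 0 <= z * y by rewrite mulr_ge0// ltW.
suff : z / (1 + z) * Num.min 1 y <= 1 - (1 + z * y)^-1 by lra.
have -> : 1 - (1 + z * y)^-1 = z * y / (1 + z * y) by field; rewrite gt_eqF//; lra.
set k := Num.min 1 y; have [k1 ky] : k <= 1 /\ k <= y by rewrite !ge_min !lexx orbT.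
rewrite ler_pdivlMr; last by lra.
have -> : z / (1 + z) * k * (1 + z * y) = z * (k * (1 + z * y)) / (1 + z) by ring.
rewrite ler_pdivrMr; last by lra.
have := ler_wpM2r zy k1; rewrite -mulrA ler_pM2l//; nra.
Qed.

(* A solution of the homogeneous equation satisfying the Navier conditions on the
   sphere and growing like [r ^ (t - a)], with a logarithmic factor if [t = 0]. *)
Lemma barrier (m t T : R) : 0 <= t < a -> a + 2 < T ->
  (forall s : R, char4 N (s - a) - m = (s ^+ 2 - t ^+ 2) * (s ^+ 2 - T ^+ 2)) ->
  exists c1 c2 d c3 : R,
    let E := expoly (t - a) (- t - a) (- T - a) c1 c2 d c3 in
    let E1 := expoly1 (t - a) (- t - a) (- T - a) c1 c2 d c3 in
    let E2 := expoly2 (t - a) (- t - a) (- T - a) c1 c2 d c3 in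
    let E3 := expoly3 (t - a) (- t - a) (- T - a) c1 c2 d c3 in
    let E4 := expoly4 (t - a) (- t - a) (- T - a) c1 c2 d c3 in
    [/\ forall y, @biharmonic_op R N E1 E2 E3 E4 y = m * E y, E 0 = 0,
      E2 0 + (N%:R - 2) * E1 0 = 0 &
      exists2 c, 0 < c & forall y, 0 <= y ->
        c * (Num.min 1 y * expR ((t - a) * y)) <= E y].
Proof.
move=> /andP[t0 ta] aT rootE.
pose g (s : R) := (s - a) * (s + (a + 2)).
have gT : 0 < g (- T) by rewrite /g -[_ * _]mulrNN mulr_gt0//; lra.
have gt' : g (- t) < 0 by rewrite /g pmulr_llt0; lra.
have g0 : 0 < g (- T) - g (- t) by lra.
have root1 : char4 N (t - a) = m.
  by apply/eqP; rewrite -subr_eq0 rootE subrr mul0r.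
have root2 : char4 N (- t - a) = m.
  by apply/eqP; rewrite -subr_eq0 rootE sqrrN subrr mul0r.
have root3 : char4 N (- T - a) = m.
  by apply/eqP; rewrite -subr_eq0 rootE sqrrN subrr mulr0.
have decT y : 0 <= y -> expR ((- T - a) * y) <= expR ((- t - a) * y).
  by move=> y0; rewrite ler_expR ler_wpM2r//; lra.
have [tp|tn] := ltP 0 t.
  (* The profile is [r ^ (t - a) - r ^ (- t - a)] minus [b] times a nonnegative difference of
     powers. Since [g t - g (- t) = 4 t], this [b] makes the Laplacian vanish on the sphere; as
     [b <= 0], it only raises the profile. *)
  pose b := - (4 * t) / (g (- T) - g (- t)).
  have b0 : b <= 0 by rewrite /b mulNr oppr_le0 divr_ge0 ?mulr_ge0// ltW.
  have bE : b * (g (- T) - g (- t)) = - (4 * t) by rewrite divfK// gt_eqF.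
  exists 1, (- 1 - b), 0, b => /=; split.
  - by move=> y; rewrite biharmonic_expoly root1 root2 root3 /expoly; ring.
  - by rewrite /expoly !mulr0 expR0; ring.
  - rewrite /expoly2 /expoly1 /expoly !mulr0 expR0.
    transitivity (b * (g (- T) - g (- t)) + 4 * t); last by rewrite bE addNr.
    by rewrite /g; field.
  exists (2 * t / (1 + 2 * t)) => [|y y0]; first by rewrite divr_gt0//; lra.
  apply: (@le_trans _ _ (expR ((t - a) * y) - expR ((- t - a) * y))).
    rewrite mulrA (_ : expR ((- t - a) * y) =
      expR (- (2 * t * y)) * expR ((t - a) * y)); last first.
      by rewrite -expRD; congr expR; ring.
    rewrite -[X in _ <= X - _]mul1r -mulrBl ler_wpM2r ?expR_ge0//.
    by apply: expR_lower => //; lra.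
  by have := decT y y0; rewrite /expoly; nra.
have t00 : t = 0 by apply/eqP; rewrite eq_le tn t0.
(* At the double root the leading part is [y e^(- a y)], and [4 t] is replaced by the derivative of
   [g] at 0, which is 2. *)
pose b := - 2 / (g (- T) - g (- t)).
have b0 : b <= 0 by rewrite /b mulNr oppr_le0 divr_ge0// ltW.
have bE : b * (g (- T) - g (- t)) = - 2 by rewrite divfK// gt_eqF.
have root2' : dchar4 N (- t - a) = 0 by rewrite dchar4_shift t00 oppr0 mulr0 mul0r.
exists 0, (- b), 1, b => /=; split.
- by move=> y; rewrite biharmonic_expoly root1 root2 root3 root2' /expoly; ring.
- by rewrite /expoly !mulr0 expR0; ring.
- rewrite /expoly2 /expoly1 /expoly !mulr0 expR0.
  transitivity (b * (g (- T) - g (- t)) + 2); last by rewrite bE addNr.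
  by rewrite /g t00; field.
exists 1 => // y y0; rewrite mul1r.
apply: (@le_trans _ _ (y * expR ((t - a) * y))).
  by rewrite ler_wpM2r ?expR_ge0// ge_min lexx orbT.
have := decT y y0; rewrite /expoly t00 oppr0 => h.
nra.
Qed.

End barrier.

(** * The logarithmic cutoff and its derivatives *)

Section logarithmic_cutoff.
Context {R : realType} (n : nat) (L : R).

(** Five is the least exponent for which four differentiations leave a factor [y / L]; in particular
    the cutoff preserves the Navier conditions. *)
Definition cutoff_base (y : R) : R := 1 - (y / L) ^+ 5.

(** The cutoff proper is [j = 4]. Its four derivatives lower [j] at most to 0, so that [n + 1]
    powers of the base survive; [n] is fixed later in terms of [p]. *)
Definition cutoff_pow (j : nat) (y : R) : R := Num.max 0 (cutoff_base y) ^+ (n + j).+1.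

Let K1 : R := (n + 4).+1%:R.
Let K2 : R := K1 * (n + 3).+1%:R.
Let K3 : R := K2 * (n + 2).+1%:R.
Let K4 : R := K3 * (n + 1).+1%:R.

Definition logcut (y : R) : R := cutoff_pow 4 y.

Definition logcut1 (y : R) : R := L^-1 * (- 5 * K1 * (y / L) ^+ 4 * cutoff_pow 3 y).

Definition logcut2 (y : R) : R := L^-1 ^+ 2 * (- 20 * K1 * (y / L) ^+ 3 * cutoff_pow 3 y
  + 25 * K2 * (y / L) ^+ 8 * cutoff_pow 2 y).

Definition logcut3 (y : R) : R := L^-1 ^+ 3 * (- 60 * K1 * (y / L) ^+ 2 * cutoff_pow 3 y
  + 300 * K2 * (y / L) ^+ 7 * cutoff_pow 2 y
  + - 125 * K3 * (y / L) ^+ 12 * cutoff_pow 1 y).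

Definition logcut4 (y : R) : R := L^-1 ^+ 4 * (- 120 * K1 * (y / L) * cutoff_pow 3 y
  + 2400 * K2 * (y / L) ^+ 6 * cutoff_pow 2 y
  + - 3000 * K3 * (y / L) ^+ 11 * cutoff_pow 1 y
  + 625 * K4 * (y / L) ^+ 16 * cutoff_pow 0 y).

Let is_derive_scaledX k (y : R) : is_derive y (1 : R) (fun y => (y / L) ^+ k.+1)
  (L^-1 * (k.+1%:R * (y / L) ^+ k)).
Proof.
have h : is_derive (y / L) (1 : R) (fun y : R => y ^+ k.+1) (k.+1%:R * (y / L) ^+ k).
  have := is_deriveX k.+1 (is_derive_id (y / L) (1 : R)).
  by rewrite exprfctE /GRing.scale/= mulr1.
have hs : is_derive y (1 : R) (fun y => y / L) L^-1.
  apply: is_derive_val (is_derive_mul (is_derive_id y (1 : R))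
    (is_derive_cst (L^-1 : R) y (1 : R))) _.
  by rewrite mulr0 add0r mul1r.
apply: is_derive_val (@is_derive_comp R R (fun y => y ^+ k.+1) (fun y => y / L) y 1 _ _ h hs) _.
by rewrite mulrC.
Qed.

Let is_derive_cutoff_pow j (y : R) : is_derive y (1 : R) (cutoff_pow j.+1)
  (L^-1 * (- 5 * (n + j.+1).+1%:R * (y / L) ^+ 4 * cutoff_pow j y)).
Proof.
have h := is_derive_add (is_derive_cst (1 : R) y (1 : R))
  (is_derive_mul (is_derive_cst (- 1 : R) y (1 : R)) (is_derive_scaledX 4 y)).
have := is_derive_comp (is_derive_posX (n + j) _) h.
rewrite (_ : (fun y => Num.max 0 _ ^+ _) = cutoff_pow j.+1); last first.
  by apply/funext => z; rewrite /cutoff_pow /cutoff_base mulN1r addnS.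
move=> /is_derive_val; apply.
by rewrite /cutoff_pow /cutoff_base /= mulN1r !addnS; ring.
Qed.

Lemma is_derive_logcut y : is_derive y (1 : R) logcut (logcut1 y).
Proof. by apply: is_derive_val (is_derive_cutoff_pow 3 y) _; rewrite /logcut1 /K1; ring. Qed.

Let cst (c y : R) := is_derive_cst c y (1 : R).

Let is_derive_term (c : R) k j y : is_derive y (1 : R)
  (fun y => c * (y / L) ^+ k.+1 * cutoff_pow j.+1 y)
  (L^-1 * (k.+1%:R * c * (y / L) ^+ k * cutoff_pow j.+1 y
     + - 5 * (n + j.+1).+1%:R * c * (y / L) ^+ k.+4.+1 * cutoff_pow j y)).
Proof.
apply: is_derive_val (is_derive_mul (is_derive_mul (cst c y) (is_derive_scaledX k y))
  (is_derive_cutoff_pow j y)) _.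
by rewrite /= !exprS; ring.
Qed.

Lemma is_derive_logcut1 y : is_derive y (1 : R) logcut1 (logcut2 y).
Proof.
apply: is_derive_val (is_derive_mul (cst L^-1 y) (is_derive_term (- 5 * K1) 3 2 y)) _.
by rewrite /logcut2 /K2 /=; ring.
Qed.

Lemma is_derive_logcut2 y : is_derive y (1 : R) logcut2 (logcut3 y).
Proof.
apply: is_derive_val (is_derive_mul (cst (L^-1 ^+ 2) y) (is_derive_add
  (is_derive_term (- 20 * K1) 2 2 y) (is_derive_term (25 * K2) 7 1 y))) _.
by rewrite /logcut3 /K3 /K2 /=; ring.
Qed.

Lemma is_derive_logcut3 y : is_derive y (1 : R) logcut3 (logcut4 y).
Proof.
apply: is_derive_val (is_derive_mul (cst (L^-1 ^+ 3) y) (is_derive_add (is_derive_add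
  (is_derive_term (- 60 * K1) 1 2 y) (is_derive_term (300 * K2) 6 1 y))
  (is_derive_term (- 125 * K3) 11 0 y))) _.
by rewrite /logcut4 /K4 /K3 /K2 /= expr1; ring.
Qed.

Let smooth1_scaled k : smooth1 k (fun y : R => y / L).
Proof. by apply: smooth1M; [exact: smooth1_id|exact: smooth1_cst]. Qed.

Let smooth1_scaledX k i : smooth1 k (fun y : R => (y / L) ^+ i).
Proof.
elim: i => [|i IH]; first by under eq_fun do rewrite expr0; exact: smooth1_cst.
by under eq_fun do rewrite exprS; exact: smooth1M.
Qed.

Let smooth1_base k : smooth1 k cutoff_base.
Proof.
rewrite (_ : cutoff_base = fun y => 1 + (- 1) * (y / L) ^+ 5); last first.
  by apply/funext => y; rewrite /cutoff_base; ring.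
by apply: smooth1D; [exact: smooth1_cst|apply: smooth1M => //; exact: smooth1_cst].
Qed.

Lemma smooth1_cutoff_pow k j : (k <= n + j)%N -> smooth1 k (cutoff_pow j).
Proof.
move=> kj; exact: (smooth1_comp (smooth1_posX kj) (smooth1_base k)).
Qed.

Lemma smooth1_logcut : smooth1 4 logcut.
Proof. by apply: smooth1_cutoff_pow; rewrite leq_addl. Qed.

Lemma continuous_logcut4 : continuous logcut4.
Proof.
suff [] : smooth1 0 logcut4 by [].
have c (z : R) := smooth1_cst 0 z.
have p j : smooth1 0 (cutoff_pow j) by exact: smooth1_cutoff_pow.
have s i := smooth1_scaledX 0 i.
exact: (smooth1M (c _) (smooth1D (smooth1D (smooth1D
  (smooth1M (smooth1M (c _) (smooth1_scaled 0)) (p 3%N))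
  (smooth1M (smooth1M (c _) (s 6%N)) (p 2%N)))
  (smooth1M (smooth1M (c _) (s 11%N)) (p 1%N)))
  (smooth1M (smooth1M (c _) (s 16%N)) (p 0%N)))).
Qed.

Lemma logcut_ge0 y : 0 <= logcut y.
Proof. by rewrite exprn_ge0// le_max lexx. Qed.

Lemma logcut_out y : 0 < L -> L <= y ->
  [/\ logcut y = 0, logcut1 y = 0, logcut2 y = 0, logcut3 y = 0 & logcut4 y = 0].
Proof.
move=> L0 Ly; have b : Num.max 0 (cutoff_base y) = 0.
  by apply/max_l; rewrite subr_le0; apply: exprn_ege1; rewrite ler_pdivlMr// mul1r.
by rewrite /logcut /logcut1 /logcut2 /logcut3 /logcut4 /cutoff_pow b !expr0n /=
  !(mulr0, addr0).
Qed.

Lemma logcut_at0 : [/\ logcut 0 = 1, logcut1 0 = 0 & logcut2 0 = 0].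
Proof.
rewrite /logcut /logcut1 /logcut2 /cutoff_pow /cutoff_base mul0r !expr0n /= subr0.
by rewrite max_r// expr1n !(mulr0, mul0r, addr0).
Qed.

Definition logcut_const : R := 120 * K1 + 2400 * K2 + 3000 * K3 + 625 * K4.

Let K10 : 0 <= K1. Proof. exact: ler0n. Qed.

Let K20 : 0 <= K2. Proof. by rewrite mulr_ge0. Qed.

Let K30 : 0 <= K3. Proof. by rewrite mulr_ge0. Qed.

Let K40 : 0 <= K4. Proof. by rewrite mulr_ge0. Qed.

Lemma logcut_const_ge0 : 0 <= logcut_const.
Proof. rewrite /logcut_const; move: K10 K20 K30 K40; lra. Qed.

Lemma logcut_bounds y : 1 <= L -> 0 <= y < L ->
  [/\ 0 < cutoff_base y <= 1, logcut y = cutoff_base y ^+ n.+1 * cutoff_base y ^+ 4 &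
   let B := logcut_const * (L^-1 * (Num.min 1 y * cutoff_base y ^+ n.+1)) in
   [/\ `|logcut1 y| <= B, `|logcut2 y| <= B, `|logcut3 y| <= B & `|logcut4 y| <= B]].
Proof.
move=> L1 /andP[y0 yL]; have L0 : 0 < L by lra.
set s := y / L; set z := cutoff_base y; set h := L^-1.
have s0 : 0 <= s by rewrite divr_ge0// ltW.
have s1 : s < 1 by rewrite ltr_pdivrMr// mul1r.
have h0 : 0 <= h by rewrite invr_ge0 ltW.
have h1 : h <= 1 by rewrite invf_le1.
have sX k : 0 <= s ^+ k.+1 <= s.
  by rewrite exprn_ge0//= exprS ler_piMr// exprn_ile1// ltW.
have z01 : 0 < z <= 1.
  rewrite /z /cutoff_base -/s; have /andP[q1 q2] := sX 4%N.
  by apply/andP; split; lra.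
have /andP[z0 z1] := z01.
have maxz : Num.max 0 (cutoff_base y) = z by rewrite max_r// ltW.
have sw : s <= Num.min 1 y.
  rewrite le_min (ltW s1) /= /s ler_pdivrMr// ler_peMr//.
have P j : 0 <= cutoff_pow j y <= z ^+ n.+1.
  rewrite /cutoff_pow maxz exprn_ge0 ?(ltW z0)//= -addSn exprD ler_piMr ?exprn_ge0 ?(ltW z0)//.
  by rewrite exprn_ile1 ?(ltW z0).
have k10 := K10; have k20 := K20; have k30 := K30; have k40 := K40.
set w := Num.min 1 y in sw *.
set Z := z ^+ n.+1 in P *.
have Z0 : 0 <= Z by rewrite exprn_ge0// ltW.
have w0 : 0 <= w by exact: le_trans sw.
have term (c C : R) k j : `|c| <= C -> `|c * s ^+ k.+1 * cutoff_pow j y| <= C * (w * Z).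
  move=> cC; have /andP[q1 q2] := sX k; have /andP[q3 q4] := P j.
  rewrite -mulrA normrM ler_pM// ger0_norm ?mulr_ge0// ler_pM//.
  exact: le_trans sw.
have hX k : 0 <= h ^+ k.+1 <= h.
  by rewrite exprn_ge0//= exprS ler_piMr// exprn_ile1.
have fin k (v C : R) : `|v| <= C * (w * Z) -> C <= logcut_const ->
    `|h ^+ k.+1 * v| <= logcut_const * (h * (w * Z)).
  move=> vC Cl; have /andP[q1 q2] := hX k.
  rewrite normrM (ger0_norm q1) mulrCA ler_pM// (le_trans vC)// ler_wpM2r//.
  by rewrite mulr_ge0.
have nrm (c K : R) : 0 <= K -> `|- c * K| <= `|c| * K.
  by move=> K0; rewrite normrM normrN (ger0_norm K0).
have nrp (c K : R) : 0 <= K -> `|c * K| <= `|c| * K.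
  by move=> K0; rewrite normrM (ger0_norm K0).
have addB (u v C C' W : R) : `|u| <= C * W -> `|v| <= C' * W ->
    `|u + v| <= (C + C') * W.
  by move=> uC vC; rewrite mulrDl (le_trans (ler_normD _ _))// lerD.
have nn (k : nat) : `|k%:R : R| = k%:R by rewrite ger0_norm.
split => //=.
  by rewrite /logcut /cutoff_pow maxz -exprD addSn.
split.
- rewrite /logcut1 -/s -/h -[X in `|X * _|]expr1.
  apply: (fin 0%N _ (5 * K1)); last by rewrite /logcut_const; lra.
  by apply: (term _ _); rewrite (le_trans (nrm _ _ _))// nn.
- rewrite /logcut2 -/s -/h; apply: (fin 1%N _ (20 * K1 + 25 * K2)); last first.
    by rewrite /logcut_const; lra.
  by apply: (addB _ _ _ _ _); apply: (term _ _); rewrite (le_trans (nrm _ _ _), le_trans (nrp _ _ _))// nn.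
- rewrite /logcut3 -/s -/h; apply: (fin 2%N _ (60 * K1 + 300 * K2 + 125 * K3)); last first.
    by rewrite /logcut_const; lra.
  apply: (addB _ _ _ _ _); last by apply: (term _ _); rewrite (le_trans (nrm _ _ _))// nn.
  by apply: (addB _ _ _ _ _); apply: (term _ _); rewrite (le_trans (nrm _ _ _), le_trans (nrp _ _ _))// nn.
- rewrite /logcut4 -/s -/h.
  apply: (fin 3%N _ (120 * K1 + 2400 * K2 + 3000 * K3 + 625 * K4)) => //.
  apply: (addB _ _ _ _ _); last by apply: (term _ _); rewrite (le_trans (nrp _ _ _))// nn.
  apply: (addB _ _ _ _ _); last by apply: (term _ _); rewrite (le_trans (nrm _ _ _))// nn.
  apply: (addB _ _ _ _ _); last by apply: (term _ _); rewrite (le_trans (nrp _ _ _))// nn.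
  rewrite -[X in _ * X * _]expr1.
  by apply: (term _ _); rewrite (le_trans (nrm _ _ _))// nn.
Qed.

End logarithmic_cutoff.

(** * The operator on a barrier times a cutoff *)

Section product_profile.
Context {R : realType} (N : nat) (e e1 e2 e3 e4 c c1 c2 c3 c4 : R -> R)
  (ed : forall y, is_derive y (1 : R) e (e1 y))
  (e1d : forall y, is_derive y (1 : R) e1 (e2 y))
  (e2d : forall y, is_derive y (1 : R) e2 (e3 y))
  (e3d : forall y, is_derive y (1 : R) e3 (e4 y))
  (cd : forall y, is_derive y (1 : R) c (c1 y))
  (c1d : forall y, is_derive y (1 : R) c1 (c2 y))
  (c2d : forall y, is_derive y (1 : R) c2 (c3 y))
  (c3d : forall y, is_derive y (1 : R) c3 (c4 y)).

Definition prod0 y := e y * c y.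
Definition prod1 y := e y * c1 y + e1 y * c y.
Definition prod2 y := e y * c2 y + 2 * (e1 y * c1 y) + e2 y * c y.
Definition prod3 y :=
  e y * c3 y + 3 * (e1 y * c2 y) + 3 * (e2 y * c1 y) + e3 y * c y.
Definition prod4 y := e y * c4 y + 4 * (e1 y * c3 y) + 6 * (e2 y * c2 y)
  + 4 * (e3 y * c1 y) + e4 y * c y.

Let cst (a y : R) := is_derive_cst a y (1 : R).

Lemma is_derive_prod0 y : is_derive y (1 : R) prod0 (prod1 y).
Proof. by apply: is_derive_val (is_derive_mul (ed y) (cd y)) _. Qed.

Lemma is_derive_prod1 y : is_derive y (1 : R) prod1 (prod2 y).
Proof.
apply: is_derive_val (is_derive_add (is_derive_mul (ed y) (c1d y))
  (is_derive_mul (e1d y) (cd y))) _.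
by rewrite /prod2; ring.
Qed.

Lemma is_derive_prod2 y : is_derive y (1 : R) prod2 (prod3 y).
Proof.
apply: is_derive_val (is_derive_add (is_derive_add (is_derive_mul (ed y) (c2d y))
  (is_derive_mul (cst 2 y) (is_derive_mul (e1d y) (c1d y))))
  (is_derive_mul (e2d y) (cd y))) _.
by rewrite /prod3 /=; ring.
Qed.

Lemma is_derive_prod3 y : is_derive y (1 : R) prod3 (prod4 y).
Proof.
apply: is_derive_val (is_derive_add (is_derive_add (is_derive_add
  (is_derive_mul (ed y) (c3d y))
  (is_derive_mul (cst 3 y) (is_derive_mul (e1d y) (c2d y))))
  (is_derive_mul (cst 3 y) (is_derive_mul (e2d y) (c1d y))))
  (is_derive_mul (e3d y) (cd y))) _.
by rewrite /prod4 /=; ring.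
Qed.

Lemma biharmonic_prod y : @biharmonic_op R N prod1 prod2 prod3 prod4 y =
  @biharmonic_op R N e1 e2 e3 e4 y * c y + (e y * c4 y + 4 * (e1 y * c3 y)
  + 6 * (e2 y * c2 y) + 4 * (e3 y * c1 y)
  + (2 * N%:R - 8) * (e y * c3 y + 3 * (e1 y * c2 y) + 3 * (e2 y * c1 y))
  + ((N%:R - 6) * (N%:R - 2) - 2 * (N%:R - 4)) * (e y * c2 y + 2 * (e1 y * c1 y))
  + - (2 * (N%:R - 4) * (N%:R - 2)) * (e y * c1 y)).
Proof. by rewrite /biharmonic_op /prod1 /prod2 /prod3 /prod4; ring. Qed.

(** Since [e] solves the equation, only Leibniz terms with a derivative on [c] remain. Their
    binomial coefficients add up to [15 = 1 + 4 + 6 + 4], [7 = 1 + 3 + 3], [3 = 1 + 2] and 1. *)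
Lemma biharmonic_prod_bound (m A B y : R) :
  @biharmonic_op R N e1 e2 e3 e4 y = m * e y ->
  [/\ `|e y| <= A, `|e1 y| <= A, `|e2 y| <= A & `|e3 y| <= A] ->
  [/\ `|c1 y| <= B, `|c2 y| <= B, `|c3 y| <= B & `|c4 y| <= B] ->
  `|@biharmonic_op R N prod1 prod2 prod3 prod4 y - m * prod0 y| <=
  (15 + 7 * `|2 * N%:R - 8 : R| + 3 * `|(N%:R - 6) * (N%:R - 2) - 2 * (N%:R - 4) : R|
   + `|- (2 * (N%:R - 4) * (N%:R - 2)) : R|) * (A * B).
Proof.
move=> eq [h0 h1 h2 h3] [g1 g2 g3 g4]; rewrite biharmonic_prod eq.
set b3 := 2 * N%:R - 8; set b2 := (N%:R - 6) * (N%:R - 2) - 2 * (N%:R - 4).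
set b1 := - (2 * (N%:R - 4) * (N%:R - 2)).
rewrite (_ : _ - _ = e y * c4 y + 4 * (e1 y * c3 y)
  + 6 * (e2 y * c2 y) + 4 * (e3 y * c1 y)
  + b3 * (e y * c3 y + 3 * (e1 y * c2 y) + 3 * (e2 y * c1 y))
  + b2 * (e y * c2 y + 2 * (e1 y * c1 y)) + b1 * (e y * c1 y)); last first.
  by rewrite /prod0; ring.
have M (u v : R) : `|u| <= A -> `|v| <= B -> `|u * v| <= A * B.
  by move=> ? ?; rewrite normrM ler_pM.
have P (u v x z : R) : `|u| <= x -> `|v| <= z -> `|u + v| <= x + z.
  by move=> ? ?; rewrite (le_trans (ler_normD _ _))// lerD.
have Q (k v x : R) : `|v| <= x -> `|k * v| <= `|k| * x.
  by move=> ?; rewrite normrM ler_wpM2l.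
have nn (k : nat) : `|k%:R : R| = k%:R by rewrite ger0_norm.
have Qn (k : nat) (v x : R) : `|v| <= x -> `|k%:R * v| <= k%:R * x.
  by move=> /(Q k%:R); rewrite nn.
pose X := A * B.
have T1 : `|e y * c4 y + 4 * (e1 y * c3 y) + 6 * (e2 y * c2 y) + 4 * (e3 y * c1 y)| <=
    X + 4 * X + 6 * X + 4 * X.
  by do 3?[apply: (P _ _ _ _)]; rewrite ?Qn ?M.
have T2 : `|e y * c3 y + 3 * (e1 y * c2 y) + 3 * (e2 y * c1 y)| <= X + 3 * X + 3 * X.
  by do 2?[apply: (P _ _ _ _)]; rewrite ?Qn ?M.
have T3 : `|e y * c2 y + 2 * (e1 y * c1 y)| <= X + 2 * X.
  by apply: (P _ _ _ _); rewrite ?Qn ?M.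
have T4 : `|e y * c1 y| <= X by exact: M.
apply: le_trans (P _ _ _ _ (P _ _ _ _ (P _ _ _ _ T1 (Q b3 _ _ T2)) (Q b2 _ _ T3))
  (Q b1 _ _ T4)) _.
by rewrite le_eqVlt; apply/orP; left; apply/eqP; rewrite /X; ring.
Qed.

End product_profile.

Section log_test_functions.
Context {R : realType} {N : nat}.
Implicit Types (x : 'rV[R]_N).

(** [W] is the defect created by cutting the barrier off. The point is that [C] is chosen before
    [L], so the gain [1 / L] is genuine. *)
Lemma log_test_function (n : nat) (m l M : R) (e e1 e2 e3 e4 : R -> R) :
  (forall k, smooth1 k e) ->
  (forall y, is_derive y (1 : R) e (e1 y)) ->
  (forall y, is_derive y (1 : R) e1 (e2 y)) ->
  (forall y, is_derive y (1 : R) e2 (e3 y)) ->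
  (forall y, is_derive y (1 : R) e3 (e4 y)) -> continuous e4 ->
  (forall y, @biharmonic_op R N e1 e2 e3 e4 y = m * e y) ->
  e 0 = 0 -> e2 0 + (N%:R - 2) * e1 0 = 0 -> (forall y, 0 <= y -> 0 <= e y) ->
  (forall y, 0 <= y -> [/\ `|e y| <= M * expR (l * y), `|e1 y| <= M * expR (l * y),
    `|e2 y| <= M * expR (l * y) & `|e3 y| <= M * expR (l * y)]) ->
  exists2 C : R, 0 < C & forall L : R, 1 <= L ->
    test_function (fun x => e (ln_norm x) * logcut n L (ln_norm x)) /\
    exists W : R -> R, [/\ continuous W,
      forall x, Omega_e x ->
        bilaplacian (fun x => e (ln_norm x) * logcut n L (ln_norm x)) x
        - m / enorm x ^+ 4 * (e (ln_norm x) * logcut n L (ln_norm x)) =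
        expR (- 4 * ln_norm x) * W (ln_norm x),
      forall y, L <= y -> W y = 0 &
      forall y, 0 <= y < L -> `|W y| <= C *
        (L^-1 * (Num.min 1 y * cutoff_base L y ^+ n.+1)) * expR (l * y)].
Proof.
move=> es ed e1d e2d e3d ce4 eq e0 e20 epos ebd.
pose C0 : R := 15 + 7 * `|2 * N%:R - 8 : R|
  + 3 * `|(N%:R - 6) * (N%:R - 2) - 2 * (N%:R - 4) : R|
  + `|- (2 * (N%:R - 4) * (N%:R - 2)) : R|.
have C00 : 0 <= C0 by rewrite !addr_ge0.
have M0 : 0 <= M.
  have [h _ _ _] := ebd 0 (lexx _).
  by move: h; rewrite mulr0 expR0 mulr1; exact: le_trans.
have K0 := @logcut_const_ge0 R n.
(* The [+ 1] makes the constant positive, as [absorb] requires. *)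
exists (C0 * M * logcut_const n + 1) => [|L L1].
  by rewrite ltr_wpDl// !mulr_ge0.
have L0 : 0 < L by lra.
pose c := logcut n L; pose c1 := logcut1 n L; pose c2 := logcut2 n L.
pose c3 := logcut3 n L; pose c4 := logcut4 n L.
have cd := is_derive_logcut n L; have c1d := is_derive_logcut1 n L.
have c2d := is_derive_logcut2 n L; have c3d := is_derive_logcut3 n L.
have d0 y : is_derive y (1 : R) (prod0 e c) (prod1 e e1 c c1 y).
  exact: (is_derive_prod0 ed cd).
have d1 y : is_derive y (1 : R) (prod1 e e1 c c1) (prod2 e e1 e2 c c1 c2 y).
  exact: (is_derive_prod1 ed e1d cd c1d).
have d2 y : is_derive y (1 : R) (prod2 e e1 e2 c c1 c2) (prod3 e e1 e2 e3 c c1 c2 c3 y).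
  exact: (is_derive_prod2 ed e1d e2d cd c1d c2d).
have d3 y : is_derive y (1 : R) (prod3 e e1 e2 e3 c c1 c2 c3)
    (prod4 e e1 e2 e3 e4 c c1 c2 c3 c4 y).
  exact: (is_derive_prod3 ed e1d e2d e3d cd c1d c2d c3d).
have ce := is_derive_continuous ed; have ce1 := is_derive_continuous e1d.
have ce2 := is_derive_continuous e2d; have ce3 := is_derive_continuous e3d.
have cc := is_derive_continuous cd; have cc1 := is_derive_continuous c1d.
have cc2 := is_derive_continuous c2d; have cc3 := is_derive_continuous c3d.
have cc4 := @continuous_logcut4 R n L.
pose cst k y := @continuous_at_cst R R k y.
have cp4 : continuous (prod4 e e1 e2 e3 e4 c c1 c2 c3 c4).
  move=> y; exact: (continuous_at_add (continuous_at_add (continuous_at_add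
    (continuous_at_add (continuous_at_mul (ce y) (cc4 y))
      (continuous_at_mul (cst 4 y) (continuous_at_mul (ce1 y) (cc3 y))))
      (continuous_at_mul (cst 6 y) (continuous_at_mul (ce2 y) (cc2 y))))
      (continuous_at_mul (cst 4 y) (continuous_at_mul (ce3 y) (cc1 y))))
      (continuous_at_mul (ce4 y) (cc y))).
have cp3 := is_derive_continuous d3; have cp2 := is_derive_continuous d2.
have cp1 := is_derive_continuous d1; have cp0 := is_derive_continuous d0.
pose W y := @biharmonic_op R N (prod1 e e1 c c1) (prod2 e e1 e2 c c1 c2)
  (prod3 e e1 e2 e3 c c1 c2 c3) (prod4 e e1 e2 e3 e4 c c1 c2 c3 c4) y
  + (- m) * prod0 e c y.
have sp : smooth1 4 (prod0 e c) by apply: smooth1M; [exact: es|exact: smooth1_logcut].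
have [l0 l10 l20] := logcut_at0 n L.
split.
- split.
  + exact: (smooth_Ck_closure (smooth_radial sp)).
  + have sub : closure [set x : 'rV[R]_N | closure Omega_e x /\
        e (ln_norm x) * logcut n L (ln_norm x) != 0] `<=` [set x | `|x| <= expR L].
      have cB : closed [set x : 'rV[R]_N | `|x| <= expR L].
        by apply: compact_closed; [exact: norm_hausdorff|exact: compact_norm_le].
      rewrite [X in _ `<=` X](iffLR (closure_id _) cB).
      apply: closure_subset => x /= [/closure_Omega_e_sub /= x1 px].
      have x0 : 0 < sqnorm x by lra.
      rewrite (le_trans (norm_le_enorm x))// enorm_expR// ler_expR leNgt.
      apply/negP => Lx; move: px; have [-> _ _ _ _] := logcut_out n L0 (ltW Lx).
      by rewrite mulr0 eqxx.
    rewrite -(setIidr sub).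
    by apply: compact_closedI; [exact: compact_norm_le|exact: closed_closure].
  + move=> x /closure_Omega_e_sub /= /ln_norm_ge0 Y0.
    by rewrite mulr_ge0 ?logcut_ge0// epos.
  + have [] // := @zero_on_sphere_radial R N _ _ _ d0 d1 cp2.
      by rewrite /prod0 e0 mul0r.
    rewrite /prod1 /prod2 /c1 /c2 l10 l20 /c l0 e0.
    by rewrite !(mul0r, mulr0, mulr1, add0r).
  + have [] // := @zero_on_sphere_radial R N _ _ _ d0 d1 cp2.
      by rewrite /prod0 e0 mul0r.
    rewrite /prod1 /prod2 /c1 /c2 l10 l20 /c l0 e0.
    by rewrite !(mul0r, mulr0, mulr1, add0r).
exists W; split.
- move=> y; exact: (continuous_at_add (continuous_at_add (continuous_at_add (continuous_at_add
    (cp4 y) (continuous_at_mul (cst (2 * N%:R - 8) y) (cp3 y)))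
    (continuous_at_mul (cst ((N%:R - 6) * (N%:R - 2) - 2 * (N%:R - 4)) y) (cp2 y)))
    (continuous_at_mul (cst (- (2 * (N%:R - 4) * (N%:R - 2))) y) (cp1 y)))
    (continuous_at_mul (cst (- m) y) (cp0 y))).
- move=> x /Omega_e_sqnorm_gt0 x0; rewrite div_enorm4//.
  rewrite (bilaplacian_radial d0 d1 d2 d3 x0) /W /prod0 -/c.
  by ring.
- move=> y Ly; have [z0 z1 z2 z3 z4] := logcut_out n L0 Ly.
  rewrite /W biharmonic_prod /prod0 /c /c1 /c2 /c3 /c4 z0 z1 z2 z3 z4.
  by rewrite !(mulr0, addr0).
move=> y yL; have [z01 _ /= cB] := logcut_bounds n L1 yL.
have y0 : 0 <= y by case/andP: yL.
rewrite /W mulNr.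
apply: le_trans (biharmonic_prod_bound c (eq y) (ebd y y0) cB) _; rewrite -/C0.
set Z := L^-1 * _.
have Z0 : 0 <= Z.
  case/andP: z01 => z0 _; rewrite /Z mulr_ge0 ?invr_ge0 ?(ltW L0)// mulr_ge0//.
    by rewrite le_min ler01.
  by rewrite exprn_ge0// ltW.
have -> : C0 * (M * expR (l * y) * (logcut_const n * Z)) =
  C0 * M * logcut_const n * Z * expR (l * y) by ring.
by rewrite ler_wpM2r ?expR_ge0// ler_wpM2r// lerDl.
Qed.

End log_test_functions.

(** * Annuli and the logarithmic growth of the integral of [r ^ -N] *)

Section shells.
Context {R : realType} {N : nat}.
Local Notation lebN := (@lebesgue_rV R N).
Implicit Types (x : 'rV[R]_N).

Lemma lebesgue_rV_open_gt0 (U : set 'rV[R]_N) x : open U -> U x -> (0 < lebN U)%E.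
Proof.
move=> oU Ux; have /nbhs_ballP[e /= e0 xeU] := open_nbhs_nbhs (conj oU Ux).
apply: (@lt_le_trans _ _ (lebN (ball x e))); last first.
  by apply: le_measure => //; rewrite inE; [exact: measurable_ball_rV|exact: open_measurable_rV].
rewrite ball_rVE// (lebesgue_rV_box (A := fun i => ball (x ord0 i) e)) => [|i]; last first.
  exact: measurable_ball.
elim/big_ind: _ => [|y z|i _]; [exact: lte01|exact: mule_gt0|].
by rewrite lebesgue_measure_ball ?(ltW e0)// lte_fin mulrn_wgt0.
Qed.

Definition annulus (L : R) : set 'rV[R]_N := [set x | 0 < ln_norm x < L].

Lemma annulusE (L : R) : 0 < L ->
  annulus L = Omega_e `&` [set x | sqnorm x < expR (2 * L)].
Proof.
move=> L0; apply/seteqP; split=> x /=.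
  by move=> /andP[/Omega_e_ln_norm Ox]; rewrite ln_norm_lt.
by move=> [/Omega_e_ln_norm h1 h2]; apply/andP; rewrite ln_norm_lt.
Qed.

Lemma measurable_annulus (L : R) : 0 < L -> measurable (annulus L).
Proof.
move=> L0; rewrite annulusE//; apply: measurableI; first exact: measurable_Omega_e.
by apply: open_measurable_rV; exact: open_sqnorm_lt.
Qed.

Lemma annulus_sub (L : R) : annulus L `<=` Omega_e.
Proof. by move=> x /andP[? _]; exact/Omega_e_ln_norm. Qed.

Lemma annulus_gt0 (L : R) : (0 < N)%N -> 1 <= L -> (0 < lebN (annulus L))%E.
Proof.
move=> N0 L1; have oA : open (annulus L).
  rewrite annulusE; last lra.
  by apply: openI; [exact: open_Omega_e|exact: open_sqnorm_lt].
(* This point has squared norm 2, between 1 and [e^(2 L) >= 1 + 2 L]. *)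
apply: (@lebesgue_rV_open_gt0 _ (const_mx (Num.sqrt (2 / N%:R)))) => //.
rewrite annulusE; last lra.
have E : sqnorm (const_mx (Num.sqrt (2 / N%:R)) : 'rV[R]_N) = 2.
  rewrite /sqnorm; under eq_bigr do rewrite mxE sqr_sqrtr ?divr_ge0//.
  by rewrite sumr_const card_ord -[_ *+ N]mulr_natr divfK// pnatr_eq0 -lt0n.
split; first by rewrite Omega_eE /= E; lra.
rewrite /= E; have := expR_ge1Dx (2 * L); lra.
Qed.

Lemma measurable_fun_radial (k : R -> R) (D : set 'rV[R]_N) : continuous k ->
  measurable D -> D `<=` Omega_e -> measurable_fun D (fun x => k (ln_norm x)).
Proof.
move=> ck mD DO; have h : measurable_fun Omega_e (fun x : 'rV[R]_N => k (ln_norm x)).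
  apply: continuous_measurable_fun_rV; first exact: open_Omega_e.
  by move=> x /[!inE]; exact: continuous_radial.
exact: measurable_funS (measurable_Omega_e) DO h.
Qed.

(* Summing over the shells [e^k <= |x| < e^(k+1)], each contained in a cube of
   volume [(2 e^(k+1))^N]. *)
Lemma integral_shells (K : nat) : (0 < K)%N ->
  (\int[lebN]_(x in annulus K%:R) (expR (- N%:R * ln_norm x))%:E <=
   (K%:R * (2 * expR 1) ^+ N)%:E)%E.
Proof.
have ck : continuous (fun y : R => expR (- N%:R * y)).
  exact: smooth1_continuous (smooth1_expRM 0 _).
have shell (k : nat) (A : set 'rV[R]_N) : measurable A ->
    (forall x, A x -> Omega_e x /\ k%:R <= ln_norm x < k.+1%:R) ->
    (\int[lebN]_(x in A) (expR (- N%:R * ln_norm x))%:E <= ((2 * expR 1) ^+ N)%:E)%E.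
  move=> mA Ak.
  apply: (@le_trans _ _ (\int[lebN]_(x in A) (expR (- N%:R * k%:R))%:E)%E).
    apply: ge0_le_integral => //.
    - apply/measurable_EFinP; apply: (measurable_fun_radial ck) => // x /Ak[].
      by [].
    - move=> x /Ak[_ /andP[kx _]].
      by rewrite lee_fin ler_expR !mulNr lerN2 ler_wpM2l.
  rewrite integral_cst//.
  apply: (@le_trans _ _ ((expR (- N%:R * k%:R))%:E * ((2 * expR k.+1%:R) ^+ N)%:E)%E).
    rewrite lee_wpmul2l ?lee_fin ?expR_ge0// -lebesgue_rV_box_le ?expR_ge0//.
    apply: le_measure; rewrite ?inE//.
      apply: (measurable_rV_coords (P := fun i => [set z | `|z| <= expR k.+1%:R])) => i.
      rewrite (_ : mkset _ = `[- expR k.+1%:R, expR k.+1%:R]%classic)//.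
      by apply/seteqP; split=> z /=; rewrite in_itv/= ler_norml.
    move=> x /Ak[/Omega_e_sqnorm_gt0 x0 /andP[_ xk]] i.
    apply: le_trans (coord_le_norm x i) _; apply: le_trans (norm_le_enorm x) _.
    by rewrite enorm_expR// ler_expR ltW.
  rewrite -EFinM lee_fin mulNr expRN expRM_natl.
  rewrite le_eqVlt; apply/orP; left; apply/eqP.
  have -> : expR k.+1%:R = expR k%:R * expR 1 :> R by rewrite -expRD -natr1.
  by rewrite mulrA !exprMn; field; rewrite expf_neq0// gt_eqF ?expR_gt0.
have e0 : 0 <= (2 * expR 1) ^+ N :> R by rewrite exprn_ge0// mulr_ge0 ?expR_ge0.
elim: K => // K IH _; case: K IH => [_|K IH].
  rewrite mul1r; apply: (shell 0%N); first exact: measurable_annulus.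
  by move=> x /[dup] /annulus_sub Ox /andP[h1 h2]; split; rewrite ?h2 ?(ltW h1).
have mK := @measurable_annulus K.+1%:R (ltr0Sn _ _).
have mK1 := @measurable_annulus K.+2%:R (ltr0Sn _ _).
have sub : annulus K.+1%:R `<=` annulus K.+2%:R.
  by move=> x /andP[h1 h2]; rewrite /annulus /= h1 (lt_trans h2)// ltr_nat.
rewrite -(setDUK sub) ge0_integral_setU//.
- have -> : K.+2%:R * (2 * expR 1) ^+ N =
    K.+1%:R * (2 * expR 1) ^+ N + (2 * expR 1) ^+ N :> R.
    by rewrite -[in LHS]natr1 mulrDl mul1r.
  rewrite EFinD leeD//; first exact: IH.
  apply: (shell K.+1); first exact: measurableD.
  move=> x [/[dup] /annulus_sub Ox /andP[h1 h2] nK]; split=> //; rewrite h2 andbT leNgt.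
  by apply/negP => h; apply: nK; rewrite /annulus /= h1.
- exact: measurableD.
- rewrite setDUK//; apply/measurable_EFinP; apply: (measurable_fun_radial ck) => //.
  exact: annulus_sub.
- by rewrite disj_set2E setDIK.
Qed.

End shells.

Section pointwise.
Context {R : realType}.

(* Young's inequality [v B <= v^p W + ...] by comparing [v] with [(B / W)^(1 / (p-1))]. *)
Lemma absorb (p bet c C h w z la ka M y v W B : R) (n : nat) :
  1 < p -> bet * (p - 1) = 1 -> 0 < c -> 0 < C -> 0 < h -> 0 < w <= 1 -> 0 < z <= 1 ->
  4 * bet <= n.+1%:R -> ka + bet * (ka - la) <= - M -> 0 <= y -> 0 <= v ->
  c * (w * expR (la * y)) * (z ^+ n.+1 * z ^+ 4) <= W ->
  B <= C * (h * (w * z ^+ n.+1)) * expR (ka * y) ->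
  v * B <= `|v| `^ p * W + C * (C / c) `^ bet * (h * h `^ bet) * expR (- M * y).
Proof.
move=> p1 betE c0 C0 h0 /andP[w0 w1] /andP[z0 z1] nbet kala y0 v0 hW hB.
rewrite (ger0_norm v0).
have bet0 : 0 < bet by rewrite -(@pmulr_lgt0 _ (p - 1)) ?betE//; lra.
set Bb := C * (h * (w * z ^+ n.+1)) * expR (ka * y) in hB.
set Wb := c * (w * expR (la * y)) * (z ^+ n.+1 * z ^+ 4) in hW.
(* With [z = e^(-q)] all powers of [z] become exponentials; the one left at the end,
   [z ^ (n + 1 - 4 bet)], is at most 1 by [nbet]. *)
pose q := - ln z; have q0 : 0 <= q by rewrite oppr_ge0 ln_le0.
have zE : z = expR (- q) by rewrite opprK lnK.
(* The quotient of the two bounds, in which [w] cancels: nothing is singular at the sphere. *)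
pose rho := C / c * (h * (expR (4 * q) * expR ((ka - la) * y))).
have Cc : 0 < C / c by rewrite divr_gt0.
have rho0 : 0 < rho by rewrite /rho mulr_gt0// mulr_gt0// mulr_gt0 ?expR_gt0.
have BW : Bb = rho * Wb.
  rewrite /Bb /Wb /rho; have -> : z ^+ 4 = (expR (4 * q))^-1.
    by rewrite zE -expRM_natl mulrN expRN.
  have -> : expR (ka * y) = expR ((ka - la) * y) * expR (la * y).
    by rewrite -expRD; congr expR; ring.
  by field; rewrite !gt_eqF ?expR_gt0.
have Wb0 : 0 <= Wb.
  by rewrite /Wb !mulr_ge0 ?expR_ge0 ?exprn_ge0 ?(ltW c0) ?(ltW w0) ?(ltW z0).
have err0 : 0 <= C * (C / c) `^ bet * (h * h `^ bet) * expR (- M * y).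
  by rewrite !mulr_ge0 ?powR_ge0 ?expR_ge0 ?(ltW C0) ?(ltW h0).
have [vt|vt] := leP (rho `^ bet) v.
  apply: (@le_trans _ _ (v `^ p * W)); last by rewrite lerDl.
  have v00 : 0 < v by apply: lt_le_trans vt; exact: powR_gt0.
  have vp : v `^ p = v * v `^ (p - 1).
    rewrite -{2}(powRr1 v0) -powRD; first by congr (_ `^ _); ring.
    by rewrite (gt_eqF v00) implybT.
  have rv : rho <= v `^ (p - 1).
    have {1}-> : rho = (rho `^ bet) `^ (p - 1) by rewrite -powRrM betE powRr1 ?ltW.
    by apply: ge0_ler_powR; rewrite ?nnegrE ?powR_ge0//; lra.
  rewrite vp -mulrA ler_wpM2l// (le_trans hB)// BW ler_pM//; exact: ltW.
apply: (@le_trans _ _ (rho `^ bet * Bb)).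
  apply: (le_trans (ler_wpM2l v0 hB)); rewrite ler_wpM2r ?(ltW vt)//.
  by rewrite BW mulr_ge0// ltW.
rewrite -[X in X <= _]add0r lerD ?mulr_ge0 ?powR_ge0//; first exact: le_trans hW.
have Cc0 := ltW Cc.
have ee0 : 0 <= expR (4 * q) * expR ((ka - la) * y) by rewrite mulr_ge0 ?expR_ge0.
have he0 : 0 <= h * (expR (4 * q) * expR ((ka - la) * y)) by rewrite mulr_ge0// ltW.
rewrite /rho (powRM _ Cc0 he0) (powRM _ (ltW h0) ee0) (powRM _ (expR_ge0 _) (expR_ge0 _)).
rewrite -!expRM.
set X := (C / c) `^ bet; set Y := h `^ bet.
have X0 : 0 <= X by exact: powR_ge0.
have Y0 : 0 <= Y by exact: powR_ge0.
rewrite /Bb zE -expRM_natl.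
have -> : X * (Y * (expR (4 * q * bet) * expR ((ka - la) * y * bet))) *
    (C * (h * (w * expR (n.+1%:R * - q))) * expR (ka * y)) =
    C * X * (h * Y) * (w * (expR (4 * q * bet) * expR (n.+1%:R * - q) *
       (expR ((ka - la) * y * bet) * expR (ka * y)))) by ring.
rewrite ler_wpM2l ?mulr_ge0 ?(ltW C0) ?(ltW h0)// -!expRD.
rewrite -[leRHS]mul1r ler_pM ?expR_ge0 ?(ltW w0)// ler_expR.
have k1 := ler_wpM2r q0 nbet; have k2 := ler_wpM2r y0 kala.
lra.
Qed.

(** It allows the integral against the cutoff with [L = 1] to be bounded by the one for every larger
    [L]. *)
Lemma logcut_monotone (n : nat) (L L' y : R) : 0 < L -> L <= L' -> 0 <= y ->
  logcut n L y <= logcut n L' y.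
Proof.
move=> L0 LL y0; have L'0 : 0 < L' by lra.
have m0 (r : R) : 0 <= Num.max 0 r by rewrite le_max lexx.
rewrite /logcut /cutoff_pow; apply: lerXn2r; rewrite ?nnegrE ?m0//.
apply: le_max2 => //; rewrite lerD2l lerN2 lerXn2r ?nnegrE ?divr_ge0 ?(ltW L0) ?(ltW L'0)//.
by rewrite ler_wpM2l// lef_pV2.
Qed.

End pointwise.

(** * The nonexistence argument *)

Section nonexistence.
Context {R : realType} (N : nat).
Local Notation a := ((N%:R - 4) / 2 : R).
Local Notation lebN := (@lebesgue_rV R N).
Implicit Types (x : 'rV[R]_N).

Lemma closure_annulus_compact (L : R) :
  exists K : set 'rV[R]_N, [/\ compact K, K `<=` closure Omega_e & annulus L `<=` K].
Proof.
exists ([set x : 'rV[R]_N | `|x| <= expR L] `&` closure Omega_e); split.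
- by apply: compact_closedI; [exact: compact_norm_le|exact: closed_closure].
- exact: subIsetr.
move=> x /[dup] /annulus_sub Ox /andP[_ h]; split; last exact: subset_closure.
have x0 := Omega_e_sqnorm_gt0 Ox.
by rewrite /= (le_trans (norm_le_enorm x))// enorm_expR// ler_expR ltW.
Qed.

(* The weak formulation tested against a function supported in an annulus, with the
   right-hand side absorbed by the nonlinear term. *)
Lemma weak_solution_bound (m p sigma L : R) (f u : 'rV[R]_N -> R) (psi W : R -> R)
    (c : R) : 0 < p -> 0 < L -> 0 <= c -> Lp_loc 1 f -> positive_on_Omega_e f ->
  weak_solution m p sigma f u -> test_function (fun x => psi (ln_norm x)) ->
  continuous psi -> continuous W -> (forall y, 0 <= y -> 0 <= psi y) ->
  (forall y, L <= y -> psi y = 0) -> (forall y, L <= y -> W y = 0) ->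
  (forall x, Omega_e x -> bilaplacian (fun x => psi (ln_norm x)) x
     - m / enorm x ^+ 4 * psi (ln_norm x) = expR (- 4 * ln_norm x) * W (ln_norm x)) ->
  (forall y v : R, 0 < y < L -> `|v| * (expR (- 4 * y) * `|W y|) <=
     `|v| `^ p * (expR (sigma * y) * psi y) + c * expR (- N%:R * y)) ->
  (\int[lebN]_(x in Omega_e) (f x * psi (ln_norm x))%:E <=
   c%:E * \int[lebN]_(x in annulus L) (expR (- N%:R * ln_norm x))%:E)%E.
Proof.
move=> p0 L0 c0 [mf _] fpos [[mu_ iu] weak] tpsi cpsi cW psi0 psiL WL bil ineq.
have {weak} := weak _ tpsi.
have mD := @measurable_annulus R N L L0; set D := annulus L in mD *.
have DO : D `<=` Omega_e := @annulus_sub R N L.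
have mO := @measurable_Omega_e R N.
have mclO : measurable (closure (@Omega_e R N)).
  by apply: closed_measurable_rV; exact: closed_closure.
have ce s := smooth1_continuous (smooth1_expRM 0 (s : R)).
have clO : @Omega_e R N `<=` closure Omega_e by exact: subset_closure.
have muD : measurable_fun D u by exact: measurable_funS mclO (subset_trans DO clO) mu_.
have mfO : measurable_fun Omega_e f by exact: measurable_funS mclO clO mf.
have rad (k : R -> R) (A : set 'rV[R]_N) : continuous k -> measurable A -> A `<=` Omega_e ->
    measurable_fun A (fun x => k (ln_norm x)) by move=> ck mA AO; exact: measurable_fun_radial.
have outD x : Omega_e x -> ~ D x -> L <= ln_norm x.
  by move=> /Omega_e_ln_norm Y0 nD; rewrite leNgt; apply/negP => YL; apply: nD; apply/andP.
pose S x := `|u x| `^ p * (expR (sigma * ln_norm x) * psi (ln_norm x)).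
pose q y := expR (sigma * y) * psi y.
have cq : continuous q by move=> y; exact: (continuous_at_mul (ce sigma y) (cpsi y)).
have q0 y : 0 <= y -> 0 <= q y by move=> y0; rewrite mulr_ge0 ?expR_ge0 ?psi0.
have S0 x : D x -> 0 <= S x.
  by move=> /andP[/ltW Y0 _]; rewrite mulr_ge0 ?powR_ge0//; exact: q0.
have mup : measurable_fun D (fun x => `|u x| `^ p).
  apply: (@measurableT_comp _ _ _ _ _ _ (fun z : R => z `^ p)) => //.
  exact: measurableT_comp.
have mS : measurable_fun D S by apply: measurable_funM => //; exact: (rad q).
have restrict (g : 'rV[R]_N -> \bar R) : (forall x, Omega_e x -> L <= ln_norm x -> g x = 0%E) ->
    (\int[lebN]_(x in Omega_e) g x = \int[lebN]_(x in D) g x)%E.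
  move=> g0; rewrite integral_mkcond [RHS]integral_mkcond; congr (integral _ _ _).
  apply/funext => x; rewrite !patchE.
  have [Ox|nOx] := pselect (Omega_e x); last first.
    by rewrite !memNset// => /DO.
  have [Dx|nDx] := pselect (D x); first by rewrite !mem_set.
  by rewrite mem_set// memNset// g0//; exact: outD.
have -> : (\int[lebN]_(x in Omega_e)
     (enorm x `^ sigma * `|u x| `^ p * psi (ln_norm x))%:E = \int[lebN]_(x in D) (S x)%:E)%E.
  rewrite restrict => [|x Ox Yx]; last by rewrite psiL// mulr0.
  apply: eq_integral => x /[!inE] /DO /Omega_e_sqnorm_gt0 x0.
  by rewrite enorm_powR// /S; congr EFin; ring.
have -> : (\int[lebN]_(x in Omega_e) (u x * (bilaplacian (fun x => psi (ln_norm x)) x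
     - m / enorm x ^+ 4 * psi (ln_norm x)))%:E =
   \int[lebN]_(x in D) (u x * (expR (- 4 * ln_norm x) * W (ln_norm x)))%:E)%E.
  rewrite restrict => [|x Ox Yx]; last by rewrite bil// WL// !mulr0.
  by apply: eq_integral => x /[!inE] /DO Ox; rewrite bil.
pose T x := u x * (expR (- 4 * ln_norm x) * W (ln_norm x)).
pose G x := c * expR (- N%:R * ln_norm x).
have mG : measurable_fun D G.
  by apply: measurable_funM => //; exact: (rad (fun y => expR (- N%:R * y))).
have cT : continuous (fun y : R => expR (- 4 * y) * W y).
  by move=> y; exact: (continuous_at_mul (ce (- 4) y) (cW y)).
have mT : measurable_fun D T by apply: measurable_funM => //; exact: rad cT mD DO.
have TS : (\int[lebN]_(x in D) (T x)%:E <=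
    \int[lebN]_(x in D) (S x)%:E + \int[lebN]_(x in D) (G x)%:E)%E.
  have mTE : measurable_fun D (EFin \o T) by exact/measurable_EFinP.
  have mSE : measurable_fun D (EFin \o S) by exact/measurable_EFinP.
  have mGE : measurable_fun D (EFin \o G) by exact/measurable_EFinP.
  apply: (le_trans (lee_abs _)); apply: (le_trans (le_abse_integral _ mD mTE)).
  rewrite -ge0_integralD//; last first.
  - by move=> x _; rewrite lee_fin mulr_ge0 ?expR_ge0.
  apply: ge0_le_integral => //.
  - exact: measurableT_comp.
  - exact: emeasurable_funD.
  move=> x Dx; rewrite /= -EFinD lee_fin /T normrM normrM (ger0_norm (expR_ge0 _)).
  exact: ineq.
(* The nonlinear integral has to be finite before it can be cancelled on both sides; this uses [u]
   in [L^p] on a compact set that contains the annulus. *)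
have SF : (\int[lebN]_(x in D) (S x)%:E \is a fin_num)%E.
  have [K [cK KO DK]] := closure_annulus_compact L.
  have iuD : lebN.-integrable D (fun x => (`|u x| `^ p)%:E).
    by apply: (integrableS (compact_measurable_rV cK) mD DK); exact: iu.
  have [A A0 qA] := continuous_bounded_itv 0 L cq.
  apply: (integrable_fin_num mD); apply: (le_integrable mD _ _ (integrableZl mD A iuD)).
    exact/measurable_EFinP.
  move=> x /[dup] Dx /andP[Y0 YL]; rewrite -EFinM !abse_EFin lee_fin /S !normrM mulrC.
  rewrite ler_wpM2r// -normrM (ger0_norm A0); apply: qA.
  by rewrite (ltW Y0) ltW.
move=> eqw.
have : (\int[lebN]_(x in D) (S x)%:E +
  \int[lebN]_(x in Omega_e) (f x * psi (ln_norm x))%:E <=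
  \int[lebN]_(x in D) (S x)%:E + \int[lebN]_(x in D) (G x)%:E)%E by rewrite eqw.
rewrite leeD2lE// => /le_trans; apply.
rewrite /G; under eq_integral do rewrite EFinM.
rewrite ge0_integralZl_EFin//.
- by apply/measurable_EFinP; exact: (rad (fun y => expR (- N%:R * y))).
Qed.

Lemma subcritical_nonexistence (p sigma m : R) (f u : 'rV[R]_N -> R) :
  (5 <= N)%N -> 1 < p -> - 4 < sigma ->
  (0 < m <= mu_star N /\ 1 < p < 1 + (sigma + 4) / mu_N N m \/
    0 < m < mu_star N /\ p = 1 + (sigma + 4) / mu_N N m) ->
  Lp_loc 1 f -> positive_on_Omega_e f -> ~ weak_solution m p sigma f u.
Proof.
move=> N5 p1 s4 cases Lf fpos wsol.
have N5' : 5 <= N%:R :> R by rewrite (ler_nat R 5).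
have mS : 0 < m <= mu_star N.
  by case: cases => [[]//|[/andP[m0 /ltW ms] _]]; rewrite m0 ms.
have [t [T [muE /andP[t0 ta] aT tpos rootE]]] := char_roots N5 mS.
have a0 : 0 < a by lra.
have mN0 : 0 < a + t by lra.
(* The distance to the critical exponent: positive below it, 0 at it. In the critical case
   [0 < t + e] comes from [mu < mu_star]. *)
pose e := (sigma + 4 - (p - 1) * (a + t)) / p.
have [e0 te] : 0 <= e /\ 0 < t + e.
  have p0 : 0 < p by lra.
  case: cases => [[_ /andP[_]]|[/andP[_ /tpos tp]]].
    rewrite addrC -ltrBlDr muE ltr_pdivlMr// => h.
    have e0 : 0 < e by rewrite divr_gt0//; lra.
    by split; lra.
  rewrite muE => pE.
  have h : (p - 1) * (a + t) = sigma + 4 by rewrite pE addrAC subrr add0r divfK// gt_eqF.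
  by rewrite /e h subrr mul0r addr0; split.
have eE : p * e = sigma + 4 - (p - 1) * (a + t) by rewrite mulrC divfK// gt_eqF//; lra.
pose l := t + e - a.
have l1 : t - a <= l by rewrite /l; lra.
have l2 : - t - a < l by rewrite /l; lra.
have l3 : - T - a <= l by rewrite /l; lra.
have [c1 [c2 [d [c3 /= [eqE E0 E20 [c cp Elow]]]]]] := barrier (introT andP (conj t0 ta)) aT rootE.
set E := expoly _ _ _ c1 c2 d c3 in eqE E0 Elow.
set E1 := expoly1 _ _ _ c1 c2 d c3 in eqE E20.
set E2 := expoly2 _ _ _ c1 c2 d c3 in eqE E20.
set E3 := expoly3 _ _ _ c1 c2 d c3 in eqE.
set E4 := expoly4 _ _ _ c1 c2 d c3 in eqE.
have [M0 M00 bE0] := expoly_bounded c1 c2 d c3 l1 l2 l3.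
have [M1 M10 bE1] := expoly_bounded ((t - a) * c1) ((- t - a) * c2 + d) ((- t - a) * d)
  ((- T - a) * c3) l1 l2 l3.
have [M2 M20 bE2] := expoly_bounded ((t - a) ^+ 2 * c1)
  ((- t - a) ^+ 2 * c2 + 2 * (- t - a) * d) ((- t - a) ^+ 2 * d)
  ((- T - a) ^+ 2 * c3) l1 l2 l3.
have [M3 M30 bE3] := expoly_bounded ((t - a) ^+ 3 * c1)
  ((- t - a) ^+ 3 * c2 + 3 * (- t - a) ^+ 2 * d) ((- t - a) ^+ 3 * d)
  ((- T - a) ^+ 3 * c3) l1 l2 l3.
pose M := M0 + M1 + M2 + M3.
have Ebd y : 0 <= y -> [/\ `|E y| <= M * expR (l * y), `|E1 y| <= M * expR (l * y),
    `|E2 y| <= M * expR (l * y) & `|E3 y| <= M * expR (l * y)].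
  move=> y0; have ey := expR_ge0 (l * y).
  by split; [apply: (le_trans (bE0 y y0))|apply: (le_trans (bE1 y y0))|
    apply: (le_trans (bE2 y y0))|apply: (le_trans (bE3 y y0))];
    rewrite ler_wpM2r// /M; move: M00 M10 M20 M30; clear; lra.
have Epos y : 0 <= y -> 0 <= E y.
  move=> y0; apply: le_trans (Elow y y0).
  by rewrite !mulr_ge0 ?expR_ge0 ?(ltW cp)// le_min ler01.
pose bet := (p - 1)^-1.
have betE : bet * (p - 1) = 1 by rewrite mulVf// gt_eqF// subr_gt0.
have bet0 : 0 < bet by rewrite invr_gt0 subr_gt0.
(* The remainder in Young's inequality loses [4 / (p - 1)] powers of the cutoff base; [n + 1] powers
   are there to cover them. *)
pose n := Num.bound (4 * bet).
have nbet : 4 * bet <= n.+1%:R.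
  have /ltW h : 4 * bet < n%:R by apply: archi_boundP; rewrite mulr_ge0// ltW.
  by rewrite (le_trans h)// ler_nat.
have [C C0 tests] := @log_test_function R N n m l M E E1 E2 E3 E4
  (fun k => smooth1_expoly _ _ _ k _ _ _ _) (is_derive_expoly _ _ _ _ _ _ _)
  (is_derive_expoly1 _ _ _ _ _ _ _) (is_derive_expoly2 _ _ _ _ _ _ _)
  (is_derive_expoly3 _ _ _ _ _ _ _)
  (is_derive_continuous (is_derive_expoly _ _ _ _ _ _ _)) eqE E0 E20 Epos Ebd.
have cE : continuous E := is_derive_continuous (is_derive_expoly _ _ _ c1 c2 d c3).
pose psi (K : nat) y := E y * logcut n K%:R y.
have cpsi K : continuous (psi K).
  move=> y; exact: (continuous_at_mul (cE y)
    (is_derive_continuous (is_derive_logcut n K%:R) (x := y))).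
have psi0 K y : 0 <= y -> 0 <= psi K y.
  by move=> y0; rewrite mulr_ge0 ?Epos ?logcut_ge0.
pose Q := C * (C / c) `^ bet.
have Q0 : 0 <= Q by rewrite mulr_ge0 ?powR_ge0 ?(ltW C0).
pose A := Q * (2 * expR 1) ^+ N.
have A0 : 0 <= A by rewrite mulr_ge0// exprn_ge0// mulr_ge0 ?expR_ge0.
have bound (K : nat) : (0 < K)%N ->
    (\int[lebN]_(x in Omega_e) (f x * psi K (ln_norm x))%:E <=
      (A * (K%:R^-1) `^ bet)%:E)%E.
  move=> K0; have K1 : 1 <= K%:R :> R by rewrite ler1n.
  have K0' : 0 < K%:R :> R by rewrite ltr0n.
  have [tpsi [W [cW bil WL Wb]]] := tests K%:R K1.
  have h0 : 0 < K%:R^-1 :> R by rewrite invr_gt0.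
  (* The exponent is [1 + bet = p / (p - 1)]; the factor [K] from the shells brings it back to
     [bet]. *)
  pose b := Q * (K%:R^-1 * K%:R^-1 `^ bet).
  have b0 : 0 <= b by apply: mulr_ge0 => //; rewrite mulr_ge0 ?powR_ge0 ?(ltW h0).
  apply: (le_trans (weak_solution_bound (m := m) (p := p) (sigma := sigma) (L := K%:R)
    (psi := psi K) (W := W) (c := b) _ K0' b0 Lf fpos wsol tpsi (cpsi K) cW (psi0 K) _ WL bil _)).
  - exact: lt_trans p1.
  - by move=> y Ky; rewrite /psi; have [-> _ _ _ _] := logcut_out n K0' Ky; rewrite mulr0.
  - move=> y v /andP[y0 yK].
    have yK' : 0 <= y < K%:R by rewrite (ltW y0).
    have [z01 lE _] := logcut_bounds n K1 yK'.
    have w01 : 0 < Num.min 1 y <= 1 by rewrite lt_min ltr01 y0 ge_min lexx.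
    have H := @absorb R p bet c C K%:R^-1 (Num.min 1 y) (cutoff_base K%:R y)
      (sigma + (t - a)) (l - 4) N%:R y `|v| (expR (sigma * y) * psi K y)
      (expR (- 4 * y) * `|W y|) n p1 betE cp C0 h0 w01 z01 nbet _ (ltW y0) (normr_ge0 v) _ _.
    rewrite normr_id in H; apply: H.
    (* By the choice of [e] the second part of the exponent is [- (e + a + t)], so the whole is [(t
       + e - a - 4) - (e + a + t) = - 2 a - 4 = - N], with equality. *)
    + have : bet * (p * e - (sigma + 4) + (p - 1) * (a + t)) = 0 by rewrite eE; ring.
      have E5 : bet * (p * e - (sigma + 4) + (p - 1) * (a + t)) =
        (bet * (p - 1)) * (e + a + t) + bet * (e - (sigma + 4)) by ring.
      rewrite E5 betE /l; clear; lra.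
    + rewrite /psi lE [leRHS]mulrA.
      have z0 : 0 <= cutoff_base K%:R y ^+ n.+1 * cutoff_base K%:R y ^+ 4.
        by case/andP: z01 => z0 _; rewrite mulr_ge0// exprn_ge0// ltW.
      rewrite ler_wpM2r// mulrDl expRD.
      have -> : c * (Num.min 1 y * (expR (sigma * y) * expR ((t - a) * y))) =
        expR (sigma * y) * (c * (Num.min 1 y * expR ((t - a) * y))) by ring.
      by rewrite ler_wpM2l ?expR_ge0// Elow// ltW.
    + have -> : (l - 4) * y = - 4 * y + l * y by ring.
      by rewrite expRD mulrCA ler_wpM2l ?expR_ge0// Wb.
  have iS := @integral_shells R N K K0.
  apply: (le_trans (lee_wpmul2l _ iS)); first by rewrite lee_fin.
  rewrite -EFinM lee_fin le_eqVlt; apply/orP; left; apply/eqP.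
  by rewrite /b /A; field; rewrite gt_eqF.
have mO := @measurable_Omega_e R N.
have clO : @Omega_e R N `<=` closure Omega_e by exact: subset_closure.
have mfp K : measurable_fun Omega_e (fun x => f x * psi K (ln_norm x)).
  apply: measurable_funM; last exact: measurable_fun_radial.
  case: Lf => mf _; apply: measurable_funS clO mf.
  by apply: closed_measurable_rV; exact: closed_closure.
have fp0 K x : Omega_e x -> 0 <= f x * psi K (ln_norm x).
  move=> Ox; apply: mulr_ge0; first exact/ltW/fpos.
  by apply/psi0/ltW; exact/Omega_e_ln_norm.
have bound1 (K : nat) : (0 < K)%N ->
    (\int[lebN]_(x in Omega_e) (f x * psi 1%N (ln_norm x))%:E <=
      (A * (K%:R^-1) `^ bet)%:E)%E.
  move=> K0; apply: le_trans (bound K K0); apply: ge0_le_integral => //.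
  - by move=> x Ox; rewrite lee_fin fp0.
  - exact/measurable_EFinP.
  - exact/measurable_EFinP.
  move=> x Ox; have Y0 : 0 <= ln_norm x by apply/ltW/Omega_e_ln_norm.
  rewrite lee_fin; apply: ler_wpM2l; first exact/ltW/fpos.
  apply: ler_wpM2l; first exact: Epos.
  by apply: logcut_monotone => //; rewrite ler1n.
have I0 : (\int[lebN]_(x in Omega_e) (f x * psi 1%N (ln_norm x))%:E = 0)%E.
  apply/eqP; rewrite eq_le integral_ge0 ?andbT => [|x Ox]; last by rewrite lee_fin fp0.
  apply/lee_addgt0Pr => r r0; rewrite add0e.
  (* The inverse of the power [bet]: [1 / K <= r'] gives [A K ^ (- bet) <= r], and [A + 1] avoids
     dividing by 0. *)
  pose r' := (r / (A + 1)) `^ (p - 1).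
  have A1 : 0 < A + 1 by rewrite ltr_wpDl.
  have r'0 : 0 < r' by apply: powR_gt0; exact: divr_gt0.
  pose K := (Num.bound r'^-1).+1.
  apply: (le_trans (bound1 K isT)); rewrite lee_fin.
  have hK : K%:R^-1 <= r'.
    rewrite -[r']invrK lef_pV2 ?posrE ?invr_gt0//.
    have /ltW h : r'^-1 < (Num.bound r'^-1)%:R by apply: archi_boundP; rewrite invr_ge0 ltW.
    by rewrite (le_trans h)// ler_nat.
  have : K%:R^-1 `^ bet <= r / (A + 1).
    have -> : r / (A + 1) = r' `^ bet.
      by rewrite /r' -powRrM [(p - 1) * bet]mulrC betE powRr1// divr_ge0 ?ltW.
    apply: ge0_ler_powR; rewrite ?nnegrE; [exact: ltW| |exact: ltW|exact: hK].
    by rewrite invr_ge0 ler0n.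
  move=> /(ler_wpM2l A0) /le_trans; apply.
  by rewrite mulrA ler_pdivrMr// mulrC ler_wpM2l ?(ltW r0)// lerDl.
(* On this annulus [f], the barrier and the cutoff are all positive, so a vanishing integral would
   make it a null set, although it is open and nonempty. *)
pose D := @annulus R N 1.
have mD : measurable D by exact: measurable_annulus.
have : ae_eq lebN D (fun x => (f x * psi 1%N (ln_norm x))%:E) (cst 0%E).
  apply/ae_eq_integral_abs => //.
    by apply/measurable_EFinP; exact: measurable_funS mO (@annulus_sub _ _ _) (mfp 1%N).
  apply/eqP; rewrite eq_le integral_ge0// andbT -I0.
  under eq_integral => x /[!inE] /annulus_sub Ox do rewrite gee0_abs ?lee_fin ?fp0//.
  apply: ge0_subset_integral => //.
  - exact/measurable_EFinP.
  - by move=> x Ox; rewrite lee_fin fp0.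
  - exact: annulus_sub.
move=> [Z [mZ Z0 DZ]].
have : (lebN D <= lebN Z)%E.
  apply: le_measure; rewrite ?inE// => x Dx; apply: DZ => /= /(_ Dx) /eqP.
  rewrite /= eqe mulf_eq0; have /andP[Y0 Y1] := Dx.
  have Ox := annulus_sub Dx; rewrite gt_eqF ?fpos//= mulf_eq0.
  have Y01 : 0 <= ln_norm x < 1 by rewrite (ltW Y0).
  have [/andP[z0 _] -> _] := logcut_bounds n (lexx (1 : R)) Y01.
  have zz : 0 < cutoff_base 1 (ln_norm x) ^+ n.+1 * cutoff_base 1 (ln_norm x) ^+ 4.
    by rewrite mulr_gt0 ?exprn_gt0.
  have Ey : 0 < E (ln_norm x).
    apply: lt_le_trans (Elow _ (ltW Y0)); rewrite !mulr_gt0 ?expR_gt0//.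
    by rewrite lt_min ltr01.
  by rewrite (gt_eqF Ey) (gt_eqF zz).
rewrite Z0 leNgt; apply/negP; rewrite negbK; apply: annulus_gt0 => //.
exact: leq_trans N5.
Qed.

End nonexistence.

Theorem corollary1p6 (R : realType) (N : nat) (p sigma mu : R) :
  (5 <= N)%N -> 1 < p -> - 4 < sigma ->
  ((0 < mu <= mu_star N /\ 1 < p < 1 + (sigma + 4) / mu_N N mu \/
    0 < mu < mu_star N /\ p = 1 + (sigma + 4) / mu_N N mu) ->
   forall f : 'rV[R]_N -> R, Lp_loc 1 f -> positive_on_Omega_e f ->
   ~ exists u : 'rV[R]_N -> R, weak_solution mu p sigma f u)
  /\
  (0 < mu <= mu_star N -> 1 + (sigma + 4) / mu_N N mu < p ->
   exists f : 'rV[R]_N -> R,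
     [/\ Lp_loc 1 f, positive_on_Omega_e f
       & exists u : 'rV[R]_N -> R,
           [/\ Cinf_closure u, classical_solution mu p sigma f u
             & weak_solution mu p sigma f u]]).
Proof.
move=> N5 p1 s4; split=> [cases f Lf fpos [u wu]|mS pN].
  exact: subcritical_nonexistence N5 p1 s4 cases Lf fpos wu.
exact: supercritical_existence N5 p1 s4 mS pN.
Qed.
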